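(* Assume that Assumptions A0 (solvability), A1 (stability), A2 (noncharacteristic discrete boundary, weak form) and A3 (technical restriction) stated in the context are satisfied, let $(\Delta t,\Delta x)\in\boldsymbol\Delta$, and let $(\boldsymbol\Pi_n)_{n\ge0}$ be the operators on $\ell^2(\mathbb Z^{d-1};\mathbb C^{p_1+r_1})$ defined in the context. Let $f^0,\dots,f^s\in\ell^2$ be initial data indexed by $\{j\in\mathbb Z^d: j_1\ge1-r_1\}$, and let $(g^n)_{n\ge s+1}$ be a sequence in $\ell^2(\mathbb Z^{d-1};\mathbb C^{p_1+r_1})$. Define, for $n=0,\dots,s$, $$g^n:=\sum_{m=0}^n\boldsymbol\Pi_{n-m}\begin{pmatrix}f^m_{(p_1,\cdot)}\\ \vdots\\ f^m_{(1-r_1,\cdot)}\end{pmatrix},$$ and assume further that $$\forall\, n\ge0,\quad g^n=\sum_{m=0}^n\boldsymbol\Pi_{n-m}\,g^m.$$ Then for every sequence of interior source terms $(F^n)_{n\ge s+1}$ with values in $\ell^2$ (sequences indexed by $\{j\in\mathbb Z^d:j_1\ge1\}$), there exists a unique sequence $(u^n)_{n\in\mathbb N}$ with values in $\ell^2$ (sequences indexed by $\{j\in\mathbb Z^d:j_1\ge1-r_1\}$) solution to $$\begin{cases}\displaystyle\sum_{\sigma=0}^{s+1}Q_\sigma\,u_j^{n+\sigma}=\Delta t\,F_j^{n+s+1},&n\ge0,\ j_1\ge1,\\ \displaystyle\sum_{m=0}^{n+s+1}\boldsymbol\Pi_{n+s+1-m}\begin{pmatrix}u^m_{(p_1,\cdot)}\\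 \vdots\\ u^m_{(1-r_1,\cdot)}\end{pmatrix}=g^{n+s+1},&n\ge0,\\(u_j^0,\dots,u_j^s)=(f_j^0,\dots,f_j^s),&j_1\ge1-r_1.\end{cases}$$
   Context: Notation. $\mathcal U=\{\zeta\in\mathbb C:|\zeta|>1\}$, $\mathbb D=\{|\zeta|<1\}$, $\mathbb S^1=\{|\zeta|=1\}$. $d\ge1$ and $s\in\mathbb N$ are fixed ($\mathbb N\ni0$), and $r=(r_1,\dots,r_d)$, $p=(p_1,\dots,p_d)\in\mathbb N^d$ are fixed. $\sum_{\ell=-r}^{p}$ means the sum over all $\ell\in\mathbb Z^d$ with $-r_k\le\ell_k\le p_k$ for each $k$. We write $j=(j_1,j')\in\mathbb Z\times\mathbb Z^{d-1}$, $\ell=(\ell_1,\ell')$, $r'=(r_2,\dots,r_d)$, $p'=(p_2,\dots,p_d)$, and $u_{(j_1,\cdot)}$ for the sequence $j'\mapsto u_{(j_1,j')}$ on $\mathbb Z^{d-1}$. If $d=1$, $\ell^2(\mathbb Z^{d-1};\mathbb C^k)$ is $\mathbb C^k$ and the variable $\boldsymbol\eta\in\mathbb R^{d-1}$ is absent. Scheme. $\boldsymbol\Delta\subset(0,+\infty)^{d+1}$ is a set of discretization parameters $(\Delta t,\Delta x)=(\Delta t,\Delta x_1,\dots,\Delta x_d)$. The coefficients $a_{\ell,\sigma}(\Delta t,\Delta x)\in\mathbb C$ are defined on $\boldsymbol\Delta$; for $\sigma=0,\dots,s+1$, $Q_\sigma=\sum_{\ell=-r}^pa_{\ell,\sigma}(\Delta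 t,\Delta x)\mathbf S^\ell$, $(\mathbf S^\ell u)_j=u_{j+\ell}$, acting on complex scalar sequences ($Q_\sigma u_j$ means $(Q_\sigma u)_j$). Symbols: $\widehat{Q_\sigma}(\boldsymbol\kappa)=\sum_{\ell=-r}^pa_{\ell,\sigma}(\Delta t,\Delta x)\boldsymbol\kappa^\ell$, $\boldsymbol\kappa^\ell=\kappa_1^{\ell_1}\cdots\kappa_d^{\ell_d}$. The Cauchy problem on $\mathbb Z^d$ is $\sum_{\sigma=0}^{s+1}Q_\sigma u^{n+\sigma}=0$ for $n\ge0$, $(u^0,\dots,u^s)=(f^0,\dots,f^s)\in\ell^2(\mathbb Z^d)^{s+1}$, $u^n\in\ell^2(\mathbb Z^d)$. Let $|||u|||^2_{-\infty,+\infty}=\big(\prod_{k=1}^d\Delta x_k\big)\sum_{j\in\mathbb Z^d}|u_j|^2$. For $\ell_1=-r_1,\dots,p_1$, $z\in\mathbb C$, $\boldsymbol\eta\in\mathbb R^{d-1}$: $a_{\ell_1}(z,\boldsymbol\eta)=\sum_{\sigma=0}^{s+1}z^\sigma\sum_{\ell'=-r'}^{p'}a_{(\ell_1,\ell'),\sigma}(\Delta t,\Delta x)e^{i\ell'\cdot\boldsymbol\eta}$. Assumptions (for all $(\Delta t,\Delta x)\in\boldsymbol\Delta$). A0: $Q_{s+1}$ is an isomorphism on $\ell^2(\mathbb Z^d)$, equivalently $\widehat{Q_{s+1}}\ne0$ on $(\mathbb S^1)^d$; and for all $\boldsymbol\eta=(\eta_2,\dots,\eta_d)\in\mathbb R^{d-1}$,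 $\frac1{2i\pi}\int_{\mathbb S^1}\frac{\partial_{\kappa_1}\widehat{Q_{s+1}}(\kappa_1,e^{i\eta_2},\dots,e^{i\eta_d})}{\widehat{Q_{s+1}}(\kappa_1,e^{i\eta_2},\dots,e^{i\eta_d})}d\kappa_1=0$. A1: there is $C(\Delta t,\Delta x)>0$ such that for all initial data the solution of the Cauchy problem on $\mathbb Z^d$ satisfies $\sup_{n\in\mathbb N}|||u^n|||^2_{-\infty,+\infty}\le C(\Delta t,\Delta x)\sum_{\sigma=0}^s|||f^\sigma|||^2_{-\infty,+\infty}$. A2: $a_{-r_1}$ and $a_{p_1}$ do not vanish on $\mathcal U\times\mathbb R^{d-1}$. A3: either (i) $Q_{s+1}=I$ (explicit) and for all $\boldsymbol\eta\in\mathbb R^{d-1}$, $\sum_{\ell'=-r'}^{p'}a_{(-r_1,\ell'),s}(\Delta t,\Delta x)e^{i\ell'\cdot\boldsymbol\eta}\ne0$ if $r_1>0$ and $\sum_{\ell'=-r'}^{p'}a_{(p_1,\ell'),s}(\Delta t,\Delta x)e^{i\ell'\cdot\boldsymbol\eta}\ne0$ if $p_1>0$; or (ii) $Q_{s+1}\ne I$ (implicit) and for all $\boldsymbol\eta\in\mathbb R^{d-1}$, $\sum_{\ell'=-r'}^{p'}a_{(-r_1,\ell'),s+1}(\Delta t,\Delta x)e^{i\ell'\cdot\boldsymbol\eta}\ne0$ and $\sum_{\ell'=-r'}^{p'}a_{(p_1,\ell'),s+1}(\Delta t,\Delta x)e^{i\ell'\cdot\boldsymbol\eta}\ne0$. Operators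 $\boldsymbol\Pi_n$. For $(z,\boldsymbol\eta)\in\mathcal U\times\mathbb R^{d-1}$ let $\mathbb M(z,\boldsymbol\eta)\in\mathcal M_{p_1+r_1}(\mathbb C)$ be the companion matrix with first row $\big(-a_{p_1-1}/a_{p_1},\dots,-a_{-r_1}/a_{p_1}\big)(z,\boldsymbol\eta)$, ones on the subdiagonal and zeros elsewhere. Under the assumptions, $\mathbb M(z,\boldsymbol\eta)$ has no eigenvalue on $\mathbb S^1$; let $\Pi^s(z,\boldsymbol\eta)$ be the projector onto the sum of its generalized eigenspaces for eigenvalues in $\mathbb D$, parallel to the sum of those for eigenvalues in $\mathcal U$. Under the assumptions $\Pi^s$ extends holomorphically in $z$ to $\mathcal U\cup\{\infty\}$, analytically and $2\pi$-periodically in each coordinate of $\boldsymbol\eta$, so $\Pi^s(z,\boldsymbol\eta)=\sum_{n\ge0}z^{-n}\Pi_n(\boldsymbol\eta)$. $\boldsymbol\Pi_n$ is the bounded operator on $\ell^2(\mathbb Z^{d-1};\mathbb C^{p_1+r_1})$ that is the Fourier multiplier with symbol $\Pi_n(\boldsymbol\eta)$: $\sum_{j'}(\boldsymbol\Pi_nv)_{j'}e^{-ij'\cdot\boldsymbol\eta}=\Pi_n(\boldsymbol\eta)\sum_{j'}v_{j'}e^{-ij'\cdot\boldsymbol\eta}$ (for $d=1$, $\boldsymbol\Pi_n=\Pi_n$ is a matrix). *)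

(* Defs.v *)
From HB Require Import structures.
From mathcomp Require Import all_boot all_order all_algebra.
From mathcomp Require Import all_classical all_reals all_analysis.
From mathcomp Require Import complex.
Set Implicit Arguments.
Unset Strict Implicit.
Unset Printing Implicit Defensive.
Import Order.TTheory GRing.Theory Num.Theory.
Import numFieldNormedType.Exports Normc.

Local Open Scope classical_set_scope.
Local Open Scope ring_scope.

(* Throughout, D stands for d - 1, so that d = D.+1 >= 1, and Z^d is
   Z x Z^(d-1).  Row vectors of size D = 0 are the "absent" variable of the
   one-dimensional case. *)
Notation Zd D := (int * 'rV[int]_D)%type.
Notation Nd D := (nat * 'rV[nat]_D)%type.

Definition tbox D (r p : 'rV[nat]_D) : set 'rV[int]_D :=
  [set l | forall k, - (r 0 k)%:Z <= l 0 k <= (p 0 k)%:Z].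

Definition box D (r p : Nd D) : set (Zd D) :=
  [set l | - (r.1)%:Z <= l.1 <= (p.1)%:Z /\ tbox r.2 p.2 l.2].

(* Sequences on a half-space are represented by functions on all of Z^d whose
   values outside of the half-space are irrelevant. *)
Definition half_space D (r : Nd D) : set (Zd D) :=
  [set j | 1 - (r.1)%:Z <= j.1].

Definition interior_cells D : set (Zd D) := [set j | 1 <= j.1].

Definition expi (R : realType) (t : R) : R[i] := (cos t +i* sin t)%C.

Definition dotZ (R : realType) D (l : 'rV[int]_D) (eta : 'rV[R]_D) : R :=
  \sum_k (l 0 k)%:~R * eta 0 k.

Definition sqnorm (R : realType) D (A : set (Zd D)) (u : Zd D -> R[i]) :
    \bar R :=
  \esum_(j in A) (normc (u j) ^+ 2)%:E.

Definition l2 (R : realType) D (A : set (Zd D)) (u : Zd D -> R[i]) : Prop :=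
  (sqnorm A u < +oo)%E.

Definition wnorm (R : realType) D (dx : 'rV[R]_D.+1) (u : Zd D -> R[i]) :
    \bar R :=
  ((\prod_k dx 0 k)%:E * sqnorm setT u)%E.

Definition vsq (R : realType) N (v : 'cV[R[i]]_N) : R :=
  \sum_i normc (v i 0) ^+ 2.

Definition vsqnorm (R : realType) D N (v : 'rV[int]_D -> 'cV[R[i]]_N) :
    \bar R :=
  \esum_(j in setT) (vsq (v j))%:E.

Definition vl2 (R : realType) D N (v : 'rV[int]_D -> 'cV[R[i]]_N) : Prop :=
  (vsqnorm v < +oo)%E.

Definition Qop (R : realType) D (r p : Nd D) (c : Zd D -> R[i])
    (u : Zd D -> R[i]) : Zd D -> R[i] :=
  fun j => \sum_(l \in box r p) c l * u (j + l).

Definition kpow (R : realType) D (k1 : R[i]) (k' : 'rV[R[i]]_D) (l : Zd D) :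
    R[i] :=
  k1 ^ l.1 * \prod_i (k' 0 i) ^ (l.2 0 i).

Definition Qhat (R : realType) D (r p : Nd D) (c : Zd D -> R[i])
    (k1 : R[i]) (k' : 'rV[R[i]]_D) : R[i] :=
  \sum_(l \in box r p) c l * kpow k1 k' l.

(* (2 i pi)^-1 times the contour integral of f over the unit circle, through
   kappa = e^(i t), d kappa = i e^(i t) dt. *)
Definition circle_mean (R : realType) (f : R[i] -> R[i]) : R[i] :=
  let h t := f (expi t) * expi t in
  let I : set R := `[0, 2 * pi]%classic in
  ((2 * pi)^-1)%:C%C *
  (Rintegral lebesgue_measure I (fun t => complex.Re (h t)) +i*
   Rintegral lebesgue_measure I (fun t => complex.Im (h t)))%C.

Definition cauchy_solution (R : realType) D (r p : Nd D) (s : nat)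
    (c : nat -> Zd D -> R[i]) (f u : nat -> Zd D -> R[i]) : Prop :=
  [/\ forall n, l2 setT (u n),
      forall n j, \sum_(sg < s.+2) Qop r p (c sg) (u (n + sg)%N) j = 0 &
      forall n, (n <= s)%N -> u n = f n].

Definition l2_isomorphism (R : realType) D
    (Q : (Zd D -> R[i]) -> (Zd D -> R[i])) : Prop :=
  [/\ forall u, l2 setT u -> l2 setT (Q u),
      forall f, l2 setT f -> exists2 u, l2 setT u & Q u = f &
      exists K : R, forall u, l2 setT u ->
        (sqnorm setT u <= K%:E * sqnorm setT (Q u))%E].

(* The two descriptions of the solvability of Q_(s+1), on sequences and on
   symbols, are equivalent; both are recorded. *)
Definition assumption_A0 (R : realType) D (r p : Nd D) (s : nat)
    (c : nat -> Zd D -> R[i]) : Prop :=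
  [/\ l2_isomorphism (Qop r p (c s.+1)),
      forall (k1 : R[i]) (k' : 'rV[R[i]]_D), normc k1 = 1 -> (forall i, normc (k' 0 i) = 1) ->
        Qhat r p (c s.+1) k1 k' != 0 &
      forall eta : 'rV[R]_D,
        let q k1 := Qhat r p (c s.+1) k1 (\row_i expi (eta 0 i)) in
        circle_mean (fun k1 => derive1 (q : R[i] -> R[i]^o) k1 / q k1) = 0].

Definition assumption_A1 (R : realType) D (r p : Nd D) (s : nat)
    (c : nat -> Zd D -> R[i]) (dx : 'rV[R]_D.+1) : Prop :=
  exists C : R, 0 < C /\
    forall f u, (forall n, (n <= s)%N -> l2 setT (f n)) ->
      cauchy_solution r p s c f u ->
      (ereal_sup (range (fun n => wnorm dx (u n)))
         <= C%:E * \sum_(sg < s.+1) wnorm dx (f sg))%E.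

Definition partial_symbol (R : realType) D (r p : Nd D) (c : Zd D -> R[i])
    (l1 : int) (eta : 'rV[R]_D) : R[i] :=
  \sum_(l' \in tbox r.2 p.2) c (l1, l') * expi (dotZ l' eta).

Definition a_sym (R : realType) D (r p : Nd D) (s : nat)
    (c : nat -> Zd D -> R[i]) (l1 : int) (z : R[i]) (eta : 'rV[R]_D) : R[i] :=
  \sum_(sg < s.+2) z ^+ sg * partial_symbol r p (c sg) l1 eta.

Definition assumption_A2 (R : realType) D (r p : Nd D) (s : nat)
    (c : nat -> Zd D -> R[i]) : Prop :=
  forall (z : R[i]) (eta : 'rV[R]_D), 1 < normc z ->
    a_sym r p s c (- (r.1)%:Z) z eta != 0 /\ a_sym r p s c (p.1)%:Z z eta != 0.

Definition assumption_A3 (R : realType) D (r p : Nd D) (s : nat)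
    (c : nat -> Zd D -> R[i]) : Prop :=
  (Qop r p (c s.+1) = id /\
   forall eta : 'rV[R]_D,
     ((0 < r.1)%N -> partial_symbol r p (c s) (- (r.1)%:Z) eta != 0) /\
     ((0 < p.1)%N -> partial_symbol r p (c s) (p.1)%:Z eta != 0))
  \/
  (Qop r p (c s.+1) <> id /\
   forall eta : 'rV[R]_D,
     partial_symbol r p (c s.+1) (- (r.1)%:Z) eta != 0 /\
     partial_symbol r p (c s.+1) (p.1)%:Z eta != 0).

Definition companion (R : realType) D (r p : Nd D) (s : nat)
    (c : nat -> Zd D -> R[i]) (z : R[i]) (eta : 'rV[R]_D) :
    'M[R[i]]_(p.1 + r.1) :=
  \matrix_(i, k)
    if (i : nat) == 0
    then - a_sym r p s c ((p.1)%:Z - 1 - (k : nat)%:Z) z eta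
           / a_sym r p s c (p.1)%:Z z eta
    else ((i : nat) == k.+1)%:R.

(* The eigenvalues of M, repeated with multiplicity. *)
Definition eigenvalues (R : realType) N (M : 'M[R[i]]_N) : seq R[i] :=
  sval (closed_field_poly_normal (char_poly M)).

(* Projector, acting on column vectors, onto the sum of the generalized
   eigenspaces for the eigenvalues in the unit disk, parallel to the sum of
   those for the eigenvalues outside of the closed disk.  The transpositions are
   there because geigenspace and proj_mx act on row vectors. *)
Definition stable_projector (R : realType) N (M : 'M[R[i]]_N) : 'M[R[i]]_N :=
  (proj_mx
     (\sum_(x <- eigenvalues M | (normc x < 1)%R) geigenspace M^T x)%MS
     (\sum_(x <- eigenvalues M | (1 < normc x)%R) geigenspace M^T x)%MS)^T.

(* P n eta is the coefficient of z^-n in the expansion of Pi^s(z, eta). *)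
Definition projector_expansion (R : realType) D (r p : Nd D) (s : nat)
    (c : nat -> Zd D -> R[i])
    (P : nat -> 'rV[R]_D -> 'M[R[i]]_(p.1 + r.1)) : Prop :=
  forall (z : R[i]) (eta : 'rV[R]_D), 1 < normc z -> forall i k,
    series (fun n => z ^- n * P n eta i k : R[i]^o) @ \oo -->
      (stable_projector (companion r p s c z eta) i k : R[i]^o).

Arguments projector_expansion {R D} r p s c P.

(* For nonnegative measurable functions this is, by Tonelli, the integral over
   [0, 2 pi]^D; for D = 0 it is the value at the only point. *)
Fixpoint torus_integral (R : realType) D {struct D} :
    ('rV[R]_D -> \bar R) -> \bar R :=
  match D with
  | 0 => fun f => f 0
  | D'.+1 => fun f =>
      (\int[lebesgue_measure]_(x in `[0%R, (2 * pi)%R])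
         torus_integral (fun y : 'rV[R]_D' => f (row_mx (x%:M : 'rV_1) y)))%E
  end.

Definition fourier_sum (R : realType) D N (K : nat)
    (v : 'rV[int]_D -> 'cV[R[i]]_N) (eta : 'rV[R]_D) : 'cV[R[i]]_N :=
  \sum_(j \in tbox (const_mx K) (const_mx K)) expi (- dotZ j eta) *: v j.

(* T is the bounded operator on l^2(Z^D; C^N) with symbol P.  For v in l^2 the
   identity  \sum_j (T v)_j e^(-i j.eta) = P(eta) \sum_j v_j e^(-i j.eta)  is one
   between L^2 sums of Fourier series: the partial sums of both sides over the
   cubes [-K, K]^D differ by a quantity that goes to 0 in L^2([0, 2 pi]^D). *)
Definition fourier_multiplier (R : realType) D N
    (P : 'rV[R]_D -> 'M[R[i]]_N)
    (T : ('rV[int]_D -> 'cV[R[i]]_N) -> ('rV[int]_D -> 'cV[R[i]]_N)) : Prop :=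
  (exists K : R, forall v, vl2 v -> (vsqnorm (T v) <= K%:E * vsqnorm v)%E) /\
  (forall v, vl2 v ->
     (fun K => torus_integral (fun eta =>
        (vsq (fourier_sum K (T v) eta - P eta *m fourier_sum K v eta))%:E))
       @ \oo --> 0%E).

(* The expansion determines P, hence Pi on l^2 sequences; the values of Pi on
   other sequences are irrelevant. *)
Definition boundary_operators (R : realType) D (r p : Nd D) (s : nat)
    (c : nat -> Zd D -> R[i])
    (Pi : nat -> ('rV[int]_D -> 'cV[R[i]]_(p.1 + r.1)) ->
                 ('rV[int]_D -> 'cV[R[i]]_(p.1 + r.1))) : Prop :=
  exists P, projector_expansion r p s c P /\
            forall n, fourier_multiplier (P n) (Pi n).

Arguments boundary_operators {R D} r p s c Pi.

Definition trace_col (R : realType) D (r p : Nd D) (u : Zd D -> R[i]) :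
    'rV[int]_D -> 'cV[R[i]]_(p.1 + r.1) :=
  fun j' => \col_i u ((p.1)%:Z - (i : nat)%:Z, j').

Definition ibvp_solution (R : realType) D (r p : Nd D) (s : nat)
    (c : nat -> Zd D -> R[i]) (dt : R)
    (Pi : nat -> ('rV[int]_D -> 'cV[R[i]]_(p.1 + r.1)) ->
                 ('rV[int]_D -> 'cV[R[i]]_(p.1 + r.1)))
    (F : nat -> Zd D -> R[i])
    (g : nat -> 'rV[int]_D -> 'cV[R[i]]_(p.1 + r.1))
    (f u : nat -> Zd D -> R[i]) : Prop :=
  [/\ forall n, l2 (half_space r) (u n),
      forall n j, j \in @interior_cells D ->
        \sum_(sg < s.+2) Qop r p (c sg) (u (n + sg)%N) j
          = dt%:C%C * F (n + s.+1)%N j,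
      forall n j',
        \sum_(m < (n + s.+1).+1) Pi (n + s.+1 - m)%N (trace_col r p (u m)) j'
          = g (n + s.+1)%N j' &
      forall n j, (n <= s)%N -> j \in half_space r -> u n j = f n j].

Arguments ibvp_solution {R D} r p s c dt Pi F g f u.

(* Main.v *)
Require Import Defs.
From HB Require Import structures.
From mathcomp Require Import all_boot all_order all_algebra.
From mathcomp Require Import all_classical all_reals all_analysis.
From mathcomp Require Import complex ring lra zify.
Set Implicit Arguments.
Unset Strict Implicit.
Unset Printing Implicit Defensive.
Import Order.TTheory GRing.Theory Num.Theory.
Import numFieldNormedType.Exports Normc.

Local Open Scope classical_set_scope.
Local Open Scope ring_scope.

(** Put Q = Q_(s+1) and let [scheme] be the multistep operator read backwards in
    time, with zero data at negative times. It is a convolution in time with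
    leading coefficient Q, an isomorphism of l^2(Z^d), so [scheme U = b] has a
    unique solution in l^2 for every source b ([scheme_solvable],
    [scheme_unique]). The whole proof rests on the discrete Calderon projector of
    this convolution operator: given boundary data w^n, extend them by 0 outside
    of the strip 1 - r_1 <= j_1 <= p_1, apply the scheme, keep only the cells
    j_1 <= 0, and solve the scheme on Z^d with this source. The solution is
    [response w], and the projector maps w to the trace of [response w].

    If u^n is a sequence of l^2 functions on the half-space with no source on
    j_1 >= 1, its extension by 0 leaves on j_1 <= 0 a defect that depends only on
    its trace, hence it is the response to its own trace
    ([response_extension_by_zero]). So the Calderon projector is idempotent
    ([trace_response_idem]) and reproduces the traces of such sequences.

    The central point is that the trace of [response w] at time n is
    \sum_(m <= n) Pi_(n-m) w^m ([boundary_operator_response] for data concentrated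
    at time 0, [boundary_convolution] in general). It rests on a computation for finitely
    supported data. There the responses decay exponentially in space, because
    slowly varying exponential weights almost commute with Q ([weighted_inverse],
    [scheme_growth]). Fourier transform along the boundary and summation of z^-n
    over time, for z real and large, turn the response into a sequence U in j_1
    that obeys the recurrence of the companion matrix M(z, eta) for j_1 >= 1 and
    tends to 0 as j_1 -> +oo; the data minus U obey it for j_1 <= 0 and tend to 0
    as j_1 -> -oo. So the data split into a stable and an unstable vector, and the
    stable one is the image of the data by Pi^s(z, eta)
    ([stable_projector_split], [transform_response]). Comparing the power series in
    1/z gives the symbols ([fourier_trace_response]). For general data the Fourier
    multiplier identity is tested on truncations: a Bessel inequality for the
    torus integral ([torus_bessel]) bounds each value of the difference of
    the two sequences by the mean square error, which tends to 0.

    Once this is known the theorem is algebra. Existence: solve the scheme on Z^d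
    with the given source, and add the response to the error made on the boundary
    data; the compatibility condition says that this error is reproduced by the
    projector ([half_space_solvable]). Uniqueness: the difference of two solutions
    has a trace that is both reproduced and annihilated by the projector
    ([half_space_unique]). *)

(** * Modulus of complex numbers *)

Section Modulus.
Variable R : realType.
Implicit Types x y z : R[i].

Lemma normc_ge0 x : 0 <= normc x.
Proof. by case: x => a b; exact: sqrtr_ge0. Qed.

Lemma normcD x y : normc (x + y) <= normc x + normc y.
Proof. exact: le_normcD. Qed.

Lemma normcB x y : normc (x - y) <= normc x + normc y.
Proof. by rewrite (le_trans (normcD _ _))// normcN. Qed.

Lemma normc_distC x y : normc (x - y) = normc (y - x).
Proof. by rewrite -normcN opprB. Qed.

Lemma normc_dist x y : normc x - normc y <= normc (x - y).
Proof. by rewrite lerBlDr (le_trans _ (normcD _ _))// subrK. Qed.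

Lemma normcX x n : normc (x ^+ n) = normc x ^+ n.
Proof.
by elim: n => [|n IH]; rewrite ?expr0 ?normc1// !exprS normcM IH.
Qed.

Lemma normc_sum (I : Type) (s : seq I) (P : pred I) (f : I -> R[i]) :
  normc (\sum_(i <- s | P i) f i) <= \sum_(i <- s | P i) normc (f i).
Proof.
elim/big_rec2: _ => [|i a x _ le_xa]; first by rewrite normc0.
by rewrite (le_trans (normcD _ _))// lerD2l.
Qed.

Lemma normc_real (a : R) : normc a%:C%C = `|a|.
Proof. by rewrite /= expr0n/= addr0 sqrtr_sqr. Qed.

Lemma normr_normc x : `|x| = (normc x)%:C%C.
Proof. by case: x => a b; rewrite normc_def. Qed.

Lemma normc_Re x : `|complex.Re x| <= normc x.
Proof. by have := normc_ge_Re x; rewrite normr_normc lecR. Qed.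

Lemma normc_Im x : `|complex.Im x| <= normc x.
Proof.
case: x => a b /=; rewrite -sqrtr_sqr ler_sqrt ?addr_ge0 ?sqr_ge0//.
by rewrite lerDr sqr_ge0.
Qed.

Lemma sqr_sum_le (I : Type) (s : seq I) (f : I -> R) :
  (\sum_(i <- s) f i) ^+ 2 <= (size s)%:R * \sum_(i <- s) f i ^+ 2.
Proof.
elim: s => [|i s IH]; first by rewrite !big_nil mul0r expr0n.
have cross : f i * (\sum_(j <- s) f j) *+ 2 <=
    (size s)%:R * f i ^+ 2 + \sum_(j <- s) f j ^+ 2.
  elim: {IH} s => [|j s]; first by rewrite !big_nil mulr0 mul0r mul0rn addr0.
  rewrite !big_cons /= -natr1 !mulr2n.
  have : 0 <= (f i - f j) ^+ 2 by exact: sqr_ge0.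
  by move: (\sum_(_ <- _) _) (\sum_(_ <- _) _) => S T; nra.
rewrite !big_cons /= -natr1; move: IH cross; rewrite mulr2n.
by move: (\sum_(_ <- _) _) (\sum_(_ <- _) _) => S T; nra.
Qed.

Lemma normc_sumM_sq (I : Type) (s : seq I) (c x : I -> R[i]) :
  normc (\sum_(i <- s) c i * x i) ^+ 2 <=
  (size s)%:R * \sum_(i <- s) normc (c i) ^+ 2 * normc (x i) ^+ 2.
Proof.
suff : (\sum_(i <- s) normc (c i * x i)) ^+ 2 <=
    (size s)%:R * \sum_(i <- s) normc (c i * x i) ^+ 2.
  have -> : \sum_(i <- s) normc (c i * x i) ^+ 2 =
      \sum_(i <- s) normc (c i) ^+ 2 * normc (x i) ^+ 2.
    by apply: eq_bigr => i _; rewrite normcM exprMn.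
  apply: le_trans; rewrite ler_pXn2r// ?nnegrE ?normc_ge0 ?normc_sum//.
  by apply: sumr_ge0 => *; exact: normc_ge0.
exact: sqr_sum_le.
Qed.

End Modulus.

(** * Unconditional sums *)

Lemma big_uniq_sub (V : zmodType) (T : eqType) (s0 s : seq T) (f : T -> V) :
  uniq s0 -> uniq s -> {subset s0 <= s} ->
  \sum_(j <- s) f j = \sum_(j <- s0) f j + \sum_(j <- s | j \notin s0) f j.
Proof.
move=> us0 us sub; rewrite (bigID (mem s0)) /= -big_filter; congr (_ + _).
apply: perm_big; apply: uniq_perm => //; first exact: filter_uniq.
by move=> j; rewrite mem_filter; have [/sub ->|] := boolP (j \in s0).
Qed.

Section BoundedSums.
Variable R : realType.

(** Upper bounds for the sum of a nonnegative family, expressed on finite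
    duplicate-free lists so that no extended real is involved. *)
Definition sum_le (T : eqType) (f : T -> R) (M : R) : Prop :=
  forall s : seq T, uniq s -> \sum_(j <- s) f j <= M.

Section OneType.
Variable T : eqType.
Implicit Types (f g : T -> R) (M : R).

Lemma sum_le_ge0 f M : sum_le f M -> 0 <= M.
Proof. by move=> /(_ [::] isT); rewrite big_nil. Qed.

Lemma sum_le_pt f M j : sum_le f M -> f j <= M.
Proof. by move=> /(_ [:: j] isT); rewrite big_seq1. Qed.

Lemma sum_leW f g M : (forall j, f j <= g j) -> sum_le g M -> sum_le f M.
Proof. by move=> fg gM s us; rewrite (le_trans _ (gM s us))// ler_sum. Qed.

Lemma sum_le_trans f M M' : M <= M' -> sum_le f M -> sum_le f M'.
Proof. by move=> MM' fM s us; rewrite (le_trans (fM s us)). Qed.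

Lemma sum_leD f g M M' : sum_le f M -> sum_le g M' ->
  sum_le (fun j => f j + g j) (M + M').
Proof. by move=> fM gM s us; rewrite big_split lerD ?fM ?gM. Qed.

Lemma sum_leZ c f M : 0 <= c -> sum_le f M ->
  sum_le (fun j => c * f j) (c * M).
Proof. by move=> c0 fM s us; rewrite -mulr_sumr ler_wpM2l// fM. Qed.

Lemma sum_le0 : sum_le (fun _ : T => 0) 0.
Proof. by move=> s _; rewrite big1. Qed.

Lemma sum_le_sum (I : Type) (r : seq I) (f : I -> T -> R) (M : I -> R) :
  (forall i, sum_le (f i) (M i)) ->
  sum_le (fun j => \sum_(i <- r) f i j) (\sum_(i <- r) M i).
Proof. by move=> fM s us; rewrite exchange_big ler_sum// => i _; apply: fM. Qed.

(** A finite set that almost realizes the supremum leaves almost nothing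
    outside. *)
Lemma sum_le_tail f M e : (forall j, 0 <= f j) -> sum_le f M -> 0 < e ->
  exists2 s0 : seq T, uniq s0 & forall s, uniq s ->
    {in s, forall j, j \notin s0} -> \sum_(j <- s) f j <= e.
Proof.
move=> f0 fM e0.
pose A : set R := [set \sum_(j <- s) f j | s in [set s : seq T | uniq s]].
have hA : has_sup A.
  split; first by exists (\sum_(j <- [::]) f j); exists [::].
  by exists M => _ [s us <-]; exact: fM.
have [_ [s0 us0 <-] hs0] := sup_adherent e0 hA.
exists s0 => // s us dis.
have us' : uniq (s0 ++ s).
  by rewrite cat_uniq us0 us andbT; apply/hasPn => j /dis.
have : \sum_(j <- s0 ++ s) f j <= sup A.
  by apply: ub_le_sup; [exact: hA.2|exists (s0 ++ s)].
by rewrite big_cat /=; lra.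
Qed.

End OneType.

(** Injectivity on P alone is what sequences supported on a slice of the lattice
    provide. *)
Lemma sum_le_pinj (T U : eqType) (h : U -> T) (P : pred U) (f : T -> R)
    (g : U -> R) M :
  {in P &, injective h} -> (forall u, g u = if P u then f (h u) else 0) ->
  sum_le f M -> sum_le g M.
Proof.
move=> hinj gE fM s us.
rewrite (eq_bigr _ (fun u _ => gE u)) -big_mkcond -big_filter.
rewrite -(big_map h xpredT f); apply: fM; rewrite map_inj_in_uniq ?filter_uniq//.
by move=> x y; rewrite !mem_filter => /andP[Px _] /andP[Py _]; exact: hinj.
Qed.

Lemma sum_le_inj (T U : eqType) (h : U -> T) (f : T -> R) M :
  injective h -> sum_le f M -> sum_le (f \o h) M.
Proof.
move=> hinj; apply: (@sum_le_pinj _ _ h predT) => // x y _ _; exact: hinj.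
Qed.

End BoundedSums.

Section HasSum.
Variable R : realType.

(** Convergence along the net of finite subsets: unlike ordered partial sums it
    can be reindexed by arbitrary injections. *)
Definition has_sum (T : eqType) (f : T -> R[i]) (S : R[i]) : Prop :=
  forall e : R, 0 < e -> exists s0 : seq T, forall s, uniq s ->
    {subset s0 <= s} -> normc (\sum_(j <- s) f j - S) <= e.

Definition abs_sum_le (T : eqType) (f : T -> R[i]) (M : R) : Prop :=
  sum_le (fun j => normc (f j)) M.

Definition hsum (T : eqType) (f : T -> R[i]) : R[i] := xget 0 (has_sum f).

Section OneType.
Variable T : eqType.
Implicit Types (f g : T -> R[i]).

Lemma has_sum_unique f S S' : has_sum f S -> has_sum f S' -> S = S'.
Proof.
move=> fS fS'; apply/eqP; rewrite -subr_eq0; apply/eqP/eq0_normc/eqP.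
rewrite eq_le normc_ge0 andbT; apply/ler_addgt0Pl => e e0; rewrite addr0.
have e20 : 0 < e / 2 by rewrite divr_gt0.
have [s hs] := fS _ e20; have [s' hs'] := fS' _ e20.
pose t := undup (s ++ s').
have ut : uniq t by exact: undup_uniq.
have /(hs t ut) h1 : {subset s <= t}.
  by move=> j js; rewrite mem_undup mem_cat js.
have /(hs' t ut) h2 : {subset s' <= t}.
  by move=> j js; rewrite mem_undup mem_cat js orbT.
have -> : S - S' = (\sum_(j <- t) f j - S') - (\sum_(j <- t) f j - S) by ring.
by rewrite (le_trans (normcB _ _))//; move: h1 h2; lra.
Qed.

Lemma has_sumD f g S S' : has_sum f S -> has_sum g S' ->
  has_sum (fun j => f j + g j) (S + S').
Proof.
move=> fS gS e e0; have e20 : 0 < e / 2 by rewrite divr_gt0.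
have [s hs] := fS _ e20; have [s' hs'] := gS _ e20.
exists (s ++ s') => t ut sub.
have /(hs t ut) h1 : {subset s <= t}.
  by move=> j js; apply: sub; rewrite mem_cat js.
have /(hs' t ut) h2 : {subset s' <= t}.
  by move=> j js; apply: sub; rewrite mem_cat js orbT.
rewrite big_split /=.
have -> : forall a b : R[i], a + b - (S + S') = (a - S) + (b - S') by move=> *; ring.
by rewrite (le_trans (normcD _ _))//; move: h1 h2; lra.
Qed.

Lemma has_sumZ c f S : has_sum f S -> has_sum (fun j => c * f j) (c * S).
Proof.
move=> fS e e0; have c0 := normc_ge0 c.
have [|s hs] := fS (e / (1 + normc c)); first by rewrite divr_gt0//; lra.
exists s => t ut /(hs t ut) h; rewrite -mulr_sumr -mulrBr normcM.
have : (1 + normc c) * normc (\sum_(j <- t) f j - S) <= e.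
  by rewrite mulrC -ler_pdivlMr//; lra.
have := normc_ge0 (\sum_(j <- t) f j - S); nra.
Qed.

Lemma has_sum0 : has_sum (fun _ : T => 0) 0.
Proof. by move=> e e0; exists [::] => s _ _; rewrite big1// subr0 normc0 ltW. Qed.

Lemma has_sum_sum (I : Type) (r : seq I) (f : I -> T -> R[i]) (S : I -> R[i]) :
  (forall i, has_sum (f i) (S i)) ->
  has_sum (fun j => \sum_(i <- r) f i j) (\sum_(i <- r) S i).
Proof.
move=> fS; elim: r => [|i r IH].
  by under eq_fun do rewrite big_nil; rewrite big_nil; exact: has_sum0.
under eq_fun do rewrite big_cons; rewrite big_cons; exact: has_sumD.
Qed.

Lemma has_sum_nonneg (f : T -> R) M : (forall j, 0 <= f j) -> sum_le f M ->
  exists S, has_sum (fun j => (f j)%:C%C) S.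
Proof.
move=> f0 fM.
pose A : set R := [set \sum_(j <- s) f j | s in [set s : seq T | uniq s]].
have hA : has_sup A.
  split; first by exists (\sum_(j <- [::]) f j); exists [::].
  by exists M => _ [s us <-]; exact: fM.
exists (sup A)%:C%C => e e0.
have [_ [s0 us0 <-] hs0] := sup_adherent e0 hA.
exists s0 => s us sub; rewrite -rmorph_sum -rmorphB normc_real.
have le_sup : \sum_(j <- s) f j <= sup A.
  by apply: ub_le_sup; [exact: hA.2|exists s].
have ge_s0 : \sum_(j <- s0) f j <= \sum_(j <- s) f j.
  by rewrite (big_uniq_sub _ us0 us sub) lerDl sumr_ge0.
by rewrite ler_norml; move: hs0; lra.
Qed.

(** The real and imaginary parts are differences of nonnegative bounded families,
    namely (|g| + g) - |g|. *)
Lemma hsumP f M : abs_sum_le f M -> has_sum f (hsum f).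
Proof.
move=> fM.
suff [S fS] : exists S, has_sum f S by exact: (xgetPex 0 (ex_intro _ S fS)).
have part (g : T -> R) : (forall j, `|g j| <= normc (f j)) ->
    exists S, has_sum (fun j => (g j)%:C%C) S.
  move=> gf; have [] := @has_sum_nonneg (fun j => `|g j| + g j) (M + M).
  - by move=> j; have := ler_norm (- g j); rewrite normrN; lra.
  - apply: sum_leW (sum_leD fM fM) => j /=.
    by have := ler_norm (g j); have := gf j; lra.
  move=> S hS; have [] := @has_sum_nonneg (fun j => `|g j|) M.
  - by move=> j.
  - exact: sum_leW fM.
  move=> S' hS'; exists (S + (-1) * S').
  have := has_sumD hS (has_sumZ (-1) hS'); congr has_sum.
  by apply/funext => j; rewrite rmorphD /=; ring.
have [S hS] := part _ (fun j => normc_Re (f j)).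
have [S' hS'] := part _ (fun j => normc_Im (f j)).
exists (S + 'i%C * S'); have := has_sumD hS (has_sumZ 'i%C hS').
by congr has_sum; apply/funext => j; rewrite -complexE.
Qed.

Lemma hsum_eq f S : has_sum f S -> hsum f = S.
Proof.
by move=> fS; apply: (has_sum_unique _ fS); exact: (xgetPex 0 (ex_intro _ S fS)).
Qed.

Lemma has_sum_tail f S s0 e : has_sum f S -> uniq s0 ->
  (forall s, uniq s -> {in s, forall j, j \notin s0} ->
     \sum_(j <- s) normc (f j) <= e) ->
  normc (S - \sum_(j <- s0) f j) <= e.
Proof.
move=> fS us0 tail; apply/ler_addgt0Pl => e' e'0.
have [s1 hs1] := fS _ e'0.
pose s2 := [seq j <- undup s1 | j \notin s0].
have us2 : uniq s2 by rewrite filter_uniq// undup_uniq.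
have d2 : {in s2, forall j, j \notin s0} by move=> j; rewrite mem_filter => /andP[].
have us : uniq (s0 ++ s2) by rewrite cat_uniq us0 us2 andbT; apply/hasPn => j /d2.
have /(hs1 _ us) : {subset s1 <= s0 ++ s2}.
  by move=> j js; rewrite mem_cat mem_filter mem_undup js andbT orbN.
rewrite big_cat /= (normc_distC _ S) => h.
have -> : S - \sum_(j <- s0) f j =
    (S - (\sum_(j <- s0) f j + \sum_(j <- s2) f j)) + \sum_(j <- s2) f j by ring.
rewrite (le_trans (normcD _ _))// lerD//.
exact: le_trans (normc_sum _ _ _) (tail _ us2 d2).
Qed.

Lemma has_sum_le f S M : has_sum f S -> abs_sum_le f M -> normc S <= M.
Proof.
move=> fS fM; have := has_sum_tail (s0 := [::]) (e := M) fS isT.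
by rewrite big_nil subr0; apply => s us _; exact: fM.
Qed.

Lemma has_sum_finite f s0 : uniq s0 -> (forall j, j \notin s0 -> f j = 0) ->
  has_sum f (\sum_(j <- s0) f j).
Proof.
move=> us0 f0 e e0; exists s0 => s us sub.
rewrite (big_uniq_sub _ us0 us sub) addrAC subrr add0r big1 ?normc0 ?ltW//.
Qed.

End OneType.

(** Here k is the inverse of h on its range P; taking for h a translation in space
    or in time gives the shift rules of the Fourier and generating transforms. *)
Lemma has_sum_reindex (I J : eqType) (h : I -> J) (k : J -> I) (P : pred J)
    (f : I -> R[i]) (g : J -> R[i]) S :
  (forall i, P (h i)) -> cancel h k -> (forall j, P j -> h (k j) = j) ->
  (forall i, g (h i) = f i) -> (forall j, ~~ P j -> g j = 0) ->
  has_sum f S -> has_sum g S.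
Proof.
move=> Ph hK kK gf g0 fS e e0; have [s0 hs0] := fS e e0.
exists (map h s0) => t ut sub.
rewrite (bigID P) /= [X in _ + X - _]big1 ?addr0; last by move=> j; exact: g0.
rewrite -big_filter.
have -> : \sum_(j <- [seq j <- t | P j]) g j =
    \sum_(i <- map k [seq j <- t | P j]) f i.
  rewrite big_map; apply: eq_big_seq => j.
  by rewrite mem_filter => /andP[Pj _]; rewrite -gf kK.
apply: hs0.
  rewrite map_inj_in_uniq ?filter_uniq// => x y.
  rewrite !mem_filter => /andP[Px _] /andP[Py _] /(congr1 h).
  by rewrite !kK.
move=> i is0; rewrite -(hK i) map_f// mem_filter Ph sub//.
exact: map_f.
Qed.

End HasSum.

(** * Stable and unstable subspaces of a matrix *)

Section SpectralSplitting.
Variable R : realType.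

Lemma char_poly_tr (F : comNzRingType) n (M : 'M[F]_n) :
  char_poly M^T = char_poly M.
Proof.
rewrite /char_poly -[RHS]det_tr; congr (\det _).
by apply/matrixP => i j; rewrite !mxE eq_sym.
Qed.

Definition vanishing n (v : nat -> 'rV[R[i]]_n) : Prop :=
  forall e : R, 0 < e -> exists K, forall k, (K <= k)%N ->
    forall i, normc (v k 0 i) <= e.

Lemma vanishing_mulmx n m (v : nat -> 'rV[R[i]]_n) (B : 'M[R[i]]_(n, m)) :
  vanishing v -> vanishing (fun k => v k *m B).
Proof.
move=> v0 e e0; pose b : R := 1 + \sum_j \sum_i normc (B i j).
have b0 : 0 < b.
  by rewrite ltr_pwDl// sumr_ge0// => j _; rewrite sumr_ge0// => *; exact: normc_ge0.
have [K hK] := v0 (e / b) (divr_gt0 e0 b0); exists K => k Kk j.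
rewrite mxE (le_trans (normc_sum _ _ _))//.
apply: (@le_trans _ _ (e / b * \sum_i normc (B i j))).
  rewrite mulr_sumr ler_sum// => i _.
  by rewrite normcM ler_wpM2r ?normc_ge0 ?hK.
have le_b : \sum_i normc (B i j) <= b.
  rewrite /b [X in 1 + X](bigD1 j)//=.
  have : 0 <= \sum_(k | k != j) \sum_i normc (B i k).
    by rewrite sumr_ge0// => *; rewrite sumr_ge0// => *; exact: normc_ge0.
  by lra.
by rewrite (le_trans (ler_wpM2l (ltW (divr_gt0 e0 b0)) le_b))// divfK ?gt_eqF.
Qed.

Lemma vanishing_eq0 n (v : nat -> 'rV[R[i]]_n) (w : 'rV[R[i]]_n) :
  vanishing v -> (forall k i, normc (w 0 i) <= normc (v k 0 i)) -> w = 0.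
Proof.
move=> v0 wv; apply/rowP => i; rewrite mxE; apply: eq0_normc; apply/eqP.
rewrite eq_le normc_ge0 andbT; apply/ler_addgt0Pl => e e0; rewrite addr0.
by have [K hK] := v0 e e0; rewrite (le_trans (wv K i))// hK.
Qed.

Section Annihilation.
Variables (n : nat) (g : 'M[R[i]]_n.+1).
Implicit Types (v : nat -> 'rV[R[i]]_n.+1) (l : seq R[i]).

Let XsubC_act (w : 'rV[R[i]]_n.+1) x :
  w *m horner_mx g ('X - x%:P) = w *m g - x *: w.
Proof. by rewrite rmorphB /= horner_mx_X horner_mx_C mulmxBr mul_mx_scalar. Qed.

(** On the kernel of (g - x) a forward orbit is multiplied by x at each step, so
    it cannot tend to 0 when |x| >= 1; the general case follows by induction on
    the number of linear factors. *)
Lemma forward_vanishing_eq0 l v :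
  (forall x, x \in l -> 1 <= normc x) ->
  (forall k, v k.+1 = v k *m g) -> vanishing v ->
  v 0%N *m horner_mx g (\prod_(x <- l) ('X - x%:P)) = 0 -> v 0%N = 0.
Proof.
elim: l v => [|x l IH] v l1 vS v0.
  by rewrite big_nil rmorph1 mulmx1.
rewrite big_cons rmorphM /= mulmxA => ann.
have /eqP : v 0%N *m horner_mx g ('X - x%:P) = 0.
  apply: (IH (fun k => v k *m horner_mx g ('X - x%:P))) => //.
  - by move=> y yl; rewrite l1// inE yl orbT.
  - by move=> k; rewrite !XsubC_act vS mulmxBl scalemxAl.
  - exact: vanishing_mulmx.
rewrite XsubC_act subr_eq0 => /eqP v1.
have vk k : v k = x ^+ k *: v 0%N.
  elim: k => [|k IHk]; first by rewrite scale1r.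
  by rewrite vS IHk -scalemxAl v1 scalerA exprSr.
apply: (vanishing_eq0 v0) => k i; rewrite (vk k) mxE normcM normcX.
by rewrite ler_peMl ?normc_ge0// exprn_ege1// l1// inE eqxx.
Qed.

(** The same argument backwards in time: now |x| <= 1 keeps the starting vector of
    the orbit bounded by its far terms. *)
Lemma backward_vanishing_eq0 l v :
  (forall x, x \in l -> normc x <= 1) ->
  (forall k, v k = v k.+1 *m g) -> vanishing v ->
  (forall k, v k *m horner_mx g (\prod_(x <- l) ('X - x%:P)) = 0) ->
  forall k, v k = 0.
Proof.
elim: l v => [|x l IH] v l1 vS v0.
  by move=> h k; move: (h k); rewrite big_nil rmorph1 mulmx1.
rewrite big_cons rmorphM /= => ann k.
have v1 j : v j.+1 *m g = x *: v j.+1.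
  apply/eqP; rewrite -subr_eq0 -XsubC_act; apply/eqP.
  apply: (IH (fun k => v k *m horner_mx g ('X - x%:P))) => //.
  - by move=> y yl; rewrite l1// inE yl orbT.
  - by move=> i; rewrite !XsubC_act [in LHS]vS mulmxBl -scalemxAl.
  - exact: vanishing_mulmx.
  - by move=> i; rewrite -mulmxA ann.
have vk m : v k = x ^+ m *: v (k + m)%N.
  elim: m => [|m IHm]; first by rewrite scale1r addn0.
  by rewrite {1}IHm vS addnS v1 scalerA exprSr.
have v0k : vanishing (fun m => v (k + m)%N).
  move=> e e0; have [K hK] := v0 e e0; exists K => m Km.
  by apply: hK; rewrite (leq_trans Km)// leq_addl.
apply: (vanishing_eq0 v0k) => m i; rewrite (vk m) mxE normcM normcX.
rewrite ler_piMl ?normc_ge0// exprn_ile1 ?normc_ge0// l1// inE eqxx//.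
Qed.

End Annihilation.

Section Geigenspaces.
Variables (n : nat) (g : 'M[R[i]]_n.+1) (l : seq R[i]).
Implicit Types (P Q : pred R[i]).

Let gpoly P := \prod_(x <- undup l | P x) (('X - x%:P) ^+ n.+1).

Let submx_kermxpoly_dvd (p q : {poly R[i]}) :
  (p %| q)%R -> (kermxpoly g p <= kermxpoly g q)%MS.
Proof.
move=> /dvdpP[h ->]; apply/sub_kermxP.
rewrite mulrC rmorphM /= mulmxA.
suff -> : kermxpoly g p *m horner_mx g p = 0 by rewrite mul0mx.
exact/sub_kermxP.
Qed.

Let gpoly_coprime P Q : (forall x, P x -> ~~ Q x) ->
  coprimep (gpoly P) (gpoly Q).
Proof.
move=> PQ; rewrite /gpoly.
apply: (big_ind (fun p => coprimep p _)); first exact: coprime1p.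
  by move=> p q; rewrite coprimepMl => -> ->.
move=> x Px; rewrite coprimep_sym.
apply: (big_ind (fun p => coprimep p _)); first exact: coprime1p.
  by move=> p q; rewrite coprimepMl => -> ->.
move=> y Qy; apply/coprimep_expl/coprimep_expr.
rewrite coprimep_XsubC root_XsubC; apply: contraTneq Qy => <-.
exact: PQ.
Qed.

Let sum_geigenspace_sub P :
  (\sum_(x <- l | P x) geigenspace g x <= kermxpoly g (gpoly P))%MS.
Proof.
rewrite big_seq_cond; apply: (big_ind (fun A => A <= _)%MS).
- exact: sub0mx.
- by move=> A B; rewrite addsmx_sub => -> ->.
- move=> x /andP[xl Px]; apply: submx_kermxpoly_dvd.
  rewrite /gpoly -big_filter (big_rem x) /=.
    exact: dvdp_mulr.
  by rewrite mem_filter Px mem_undup.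
Qed.

Lemma geigenspaces_capmx P Q : (forall x, P x -> ~~ Q x) ->
  (\sum_(x <- l | P x) geigenspace g x :&:
   \sum_(x <- l | Q x) geigenspace g x = 0)%MS.
Proof.
move=> PQ; apply/eqP; rewrite -submx0.
rewrite -[X in (_ <= X)%MS](mxdirect_kermxpoly g (gpoly_coprime PQ)).
by apply: capmxS; exact: sum_geigenspace_sub.
Qed.

Let kermxpoly_gpoly P :
  (kermxpoly g (gpoly P) <= \sum_(x <- l | P x) geigenspace g x)%MS.
Proof.
suff H (r : seq R[i]) : uniq r -> {subset r <= l} ->
    (kermxpoly g (\prod_(x <- r | P x) (('X - x%:P) ^+ n.+1)) <=
     \sum_(x <- l | P x) geigenspace g x)%MS.
  by apply: H; [exact: undup_uniq | move=> x; rewrite mem_undup].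
elim: r => [|x r IH] /=; first by rewrite big_nil kermxpoly1 sub0mx.
move=> /andP[xr ur] sub; rewrite big_cons.
have {}IH := IH ur (fun y yr => sub y (mem_behead (s := x :: r) yr)).
case: ifPn => [Px|_]; last exact: IH.
set q := \prod_(y <- r | P y) _.
have cop : coprimep (('X - x%:P) ^+ n.+1) q.
  rewrite /q big_seq_cond coprimep_sym.
  apply: (big_ind (fun p => coprimep p _)); first exact: coprime1p.
    by move=> p p'; rewrite coprimepMl => -> ->.
  move=> y /andP[yr _]; apply/coprimep_expl/coprimep_expr.
  by rewrite coprimep_XsubC root_XsubC; apply: contraNneq xr => ->.
rewrite (kermxpolyM g cop) addsmx_sub; apply/andP; split; last exact: IH.
have xl : x \in [seq x <- l | P x] by rewrite mem_filter Px sub ?mem_head.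
by rewrite -big_filter (big_rem x xl) /=; exact: addsmxSl.
Qed.

(** No root has multiplicity above the dimension, so each power of a linear factor
    divides the one that defines the generalized eigenspace. *)
Lemma annihilated_sub_geigenspaces P (w : 'rV[R[i]]_n.+1) :
  (size l <= n.+1)%N ->
  w *m horner_mx g (\prod_(x <- l | P x) ('X - x%:P)) = 0 ->
  (w <= \sum_(x <- l | P x) geigenspace g x)%MS.
Proof.
move=> size_l ann; apply: submx_trans (kermxpoly_gpoly P).
apply: (@submx_trans _ _ _ _ _ _
  (kermxpoly g (\prod_(x <- l | P x) ('X - x%:P)))); first exact/sub_kermxP.
apply: submx_kermxpoly_dvd; rewrite -prodr_undup_exp_count.
apply: (big_ind2 (fun p q => p %| q)%R) => // [p q p' q'|x _].
  exact: dvdp_mul.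
by rewrite dvdp_exp2l// (leq_trans (count_size _ _)).
Qed.

End Geigenspaces.

(** Multiply Y by the product of the linear factors of the characteristic
    polynomial with |x| < 1: by Cayley-Hamilton the other factors annihilate the
    result, so [forward_vanishing_eq0] makes it 0 and Y 0 lies in the stable
    subspace. In the same way X 0, the end of a backward orbit that tends to 0,
    lies in the unstable one. *)
Lemma stable_projector_split N (M : 'M[R[i]]_N) (Y X : nat -> 'cV[R[i]]_N) :
  (forall k, Y k.+1 = M *m Y k) -> vanishing (fun k => (Y k)^T) ->
  (forall k, X k = M *m X k.+1) -> vanishing (fun k => (X k)^T) ->
  stable_projector M *m (Y 0%N + X 0%N) = Y 0%N.
Proof.
case: N => [|n] in M Y X *; first by move=> *; rewrite [LHS]flatmx0 [RHS]flatmx0.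
move=> YS Y0 XS X0.
set l := eigenvalues M.
have charE : char_poly M^T = \prod_(x <- l) ('X - x%:P).
  rewrite char_poly_tr /l /eigenvalues; case: closed_field_poly_normal => r /=.
  by rewrite (monicP (char_poly_monic M)) scale1r.
have size_l : (size l <= n.+1)%N.
  by rewrite -ltnS -(size_prod_XsubC l id) -charE size_char_poly.
have ann (P : pred R[i]) : horner_mx M^T (\prod_(x <- l | P x) ('X - x%:P)) *m
    horner_mx M^T (\prod_(x <- [seq x <- l | ~~ P x]) ('X - x%:P)) = 0.
  rewrite big_filter -[LHS]/(_ * _) -rmorphM /=.
  have -> : (\prod_(x <- l | P x) ('X - x%:P)) *
      (\prod_(x <- l | ~~ P x) ('X - x%:P)) = char_poly M^T.
    by rewrite charE [RHS](bigID P).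
  exact: Cayley_Hamilton.
have stable : ((Y 0%N)^T <= \sum_(x <- l | (normc x < 1)%R) geigenspace M^T x)%MS.
  apply: annihilated_sub_geigenspaces => //.
  set q := \prod_(x <- l | _) _.
  apply: (@forward_vanishing_eq0 _ M^T [seq x <- l | ~~ (normc x < 1)]
    (fun k => (Y k)^T *m horner_mx M^T q)).
  - by move=> x; rewrite mem_filter -leNgt => /andP[].
  - move=> k; rewrite YS trmx_mul -!mulmxA; congr (_ *m _).
    by apply: comm_mx_horner.
  - exact: vanishing_mulmx.
  - by rewrite -mulmxA ann mulmx0.
have unstable : ((X 0%N)^T <= \sum_(x <- l | (1 < normc x)%R) geigenspace M^T x)%MS.
  apply: annihilated_sub_geigenspaces => //.
  set q := \prod_(x <- l | _) _.
  apply: (@backward_vanishing_eq0 _ M^T [seq x <- l | ~~ (1 < normc x)]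
    (fun k => (X k)^T *m horner_mx M^T q)).
  - by move=> x; rewrite mem_filter -leNgt => /andP[].
  - move=> k; rewrite XS trmx_mul -!mulmxA; congr (_ *m _).
    by apply: comm_mx_horner.
  - exact: vanishing_mulmx.
  - by move=> k; rewrite -mulmxA ann mulmx0.
apply: trmx_inj; rewrite trmx_mul /stable_projector trmxK linearD mulmxDl.
have cap : (\sum_(x <- l | (normc x < 1)%R) geigenspace M^T x :&:
    \sum_(x <- l | (1 < normc x)%R) geigenspace M^T x = 0)%MS.
  by apply: geigenspaces_capmx => x x1; rewrite -leNgt ltW.
by rewrite (proj_mx_id cap stable) (proj_mx_0 cap unstable) addr0.
Qed.

End SpectralSplitting.

(** * A lower bound for mean squares of trigonometric polynomials *)

Section Expi.
Variable R : realType.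

Lemma normc_expi (t : R) : normc (expi t) = 1.
Proof. by rewrite /expi /= cos2Dsin2 sqrtr1. Qed.

Lemma expiD (s t : R) : expi (s + t) = expi s * expi t.
Proof. by rewrite /expi cosD sinD; simpc; congr (_ +i* _)%C; ring. Qed.

Lemma expi0 : expi (0 : R) = 1.
Proof. by rewrite /expi cos0 sin0. Qed.

Lemma dotZD D (l m : 'rV[int]_D) (eta : 'rV[R]_D) :
  dotZ (l + m) eta = dotZ l eta + dotZ m eta.
Proof.
by rewrite /dotZ -big_split; apply: eq_bigr => k _; rewrite mxE intrD mulrDl.
Qed.

Lemma dotZN D (l : 'rV[int]_D) (eta : 'rV[R]_D) : dotZ (- l) eta = - dotZ l eta.
Proof. by rewrite /dotZ -sumrN; apply: eq_bigr => k _; rewrite mxE intrN mulNr. Qed.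

End Expi.

Section Bessel.
Variable R : realType.
Local Notation mu := (@lebesgue_measure R).

(** The integrands below involve symbols about which only pointwise information
    is available. Monotonicity holds because the integral of a nonnegative
    function is a supremum over the simple functions below it. *)
Lemma ge0_le_integral_any (A : set R) (f g : R -> \bar R) :
  (forall x, A x -> (0 <= f x)%E) -> (forall x, A x -> (f x <= g x)%E) ->
  (\int[mu]_(x in A) f x <= \int[mu]_(x in A) g x)%E.
Proof.
move=> f0 fg; have g0 x : A x -> (0 <= g x)%E.
  by move=> Ax; rewrite (le_trans (f0 x Ax))// fg.
rewrite !ge0_integralE//; apply: ereal_sup_le => _ [h /= hf <-].
exists h => //= x; rewrite (le_trans (hf x))// /patch.
by case: ifPn => // /set_mem; exact: fg.
Qed.

(** v is the integral of f over [0, 2 pi]; the primitive is kept so that integrals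
    of sums need no integrability argument. *)
Definition period_mean (f : R -> R) (v : R) : Prop :=
  exists G : R -> R, [/\ continuous f, forall x, is_derive x (1 : R) G (f x) &
    G (2 * pi) - G 0 = v].

Lemma period_meanD f g v w : period_mean f v -> period_mean g w ->
  period_mean (fun x => f x + g x) (v + w).
Proof.
move=> [F [cf dF vF]] [G [cg dG vG]]; exists (F + G); split.
- by move=> x; apply: cvgD; [exact: cf|exact: cg].
- by move=> x; exact: is_deriveD.
- by rewrite -vF -vG -[(F + G) _]/(F _ + G _) -[(F + G) 0]/(F _ + G _); ring.
Qed.

Lemma period_meanZ c f v : period_mean f v ->
  period_mean (fun x => c * f x) (c * v).
Proof.
move=> [F [cf dF vF]]; exists (c *: F); split.
- by move=> x; apply: cvgM; [exact: cvg_cst|exact: cf].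
- by move=> x; exact: is_deriveZ.
- by rewrite -vF -[(c *: F) _]/(c * F _) -[(c *: F) 0]/(c * F _); ring.
Qed.

Lemma period_mean_cst c : period_mean (fun=> c) (2 * pi * c).
Proof.
exists (c *: id); split.
- by move=> x; exact: cvg_cst.
- by move=> x; have := is_deriveZ c (is_derive_id x 1); rewrite scaler1.
- by rewrite -[(c *: id) _]/(c * _) -[(c *: id) 0]/(c * _); ring.
Qed.

Lemma expi_int2pi (n : int) : expi (n%:~R * (2 * pi) : R) = 1.
Proof.
have H (m : nat) : expi (m%:R * (2 * pi) : R) = 1.
  elim: m => [|m IH]; first by rewrite mul0r expi0.
  rewrite -natr1 mulrDl mul1r expiD IH mul1r /expi mulr_natl.
  by rewrite cos2pi sin2pi.
case: n => m; first exact: H.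
rewrite NegzE intrN mulNr; have := expi0 R.
by rewrite -(addNr (m.+1%:R * (2 * pi))) expiD H mulr1.
Qed.

Lemma cos_int2pi (n : int) : cos (n%:~R * (2 * pi)) = 1 :> R.
Proof. by have [->] := expi_int2pi n. Qed.

Lemma sin_int2pi (n : int) : sin (n%:~R * (2 * pi)) = 0 :> R.
Proof. by have [_ ->] := expi_int2pi n. Qed.

Lemma period_mean_cos (n : int) : n != 0 ->
  period_mean (fun x => cos (n%:~R * x)) 0.
Proof.
move=> n0; have n0' : (n%:~R : R) != 0 by rewrite intr_eq0.
exists (fun x => n%:~R^-1 * sin (n%:~R * x)); split.
- move=> x; apply: continuous_comp; last exact: continuous_cos.
  by apply: cvgM; [exact: cvg_cst|exact: cvg_id].
- by move=> x; apply: is_derive_eq; rewrite /GRing.scale /=; field.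
- by rewrite sin_int2pi !mulr0 sin0; ring.
Qed.

Lemma period_mean_sin (n : int) : period_mean (fun x => sin (n%:~R * x)) 0.
Proof.
have [->|n0] := eqVneq n 0.
  have := period_mean_cst 0; rewrite mulr0; congr period_mean.
  by apply/funext => x; rewrite mul0r sin0.
have n0' : (n%:~R : R) != 0 by rewrite intr_eq0.
exists (fun x => - n%:~R^-1 * cos (n%:~R * x)); split.
- move=> x; apply: continuous_comp; last exact: continuous_sin.
  by apply: cvgM; [exact: cvg_cst|exact: cvg_id].
- by move=> x; apply: is_derive_eq; rewrite /GRing.scale /=; field.
- by rewrite cos_int2pi mulr0 cos0; ring.
Qed.

Lemma le_integral_period_mean (f : R -> R) v (g : R -> \bar R) :
  period_mean f v -> (forall x, (0 <= g x)%E) -> (forall x, ((f x)%:E <= g x)%E) ->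
  (v%:E <= \int[mu]_(x in `[0%R, (2 * pi)%R]) g x)%E.
Proof.
move=> [G [cf dG <-]] g0 fg; have pi20 : (0 : R) < 2 * pi by rewrite mulr_gt0 ?pi_gt0.
have cG : continuous G.
  move=> x; apply: differentiable_continuous; apply/derivable1_diffP.
  exact: (@ex_derive _ _ _ _ _ _ _ (dG x)).
rewrite EFinB; have <- : (\int[mu]_(x in `[0%R, (2 * pi)%R]) (f x)%:E =
    (G (2 * pi))%:E - (G 0)%:E)%E.
  apply: continuous_FTC2 => //.
  - exact: continuous_subspaceT.
  - split.
    + by move=> x _; exact: (@ex_derive _ _ _ _ _ _ _ (dG x)).
    + exact/cvg_at_right_filter/cG.
    + exact/cvg_at_left_filter/cG.
  - by move=> x _; rewrite derive1E (@derive_val _ _ _ _ _ _ _ (dG x)).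
rewrite integralE.
apply: (@le_trans _ _ (\int[mu]_(x in `[0%R, (2 * pi)%R]) ((EFin \o f)^\+ x))%E).
  rewrite -[leRHS]sube0; apply: leeB => //.
  exact: integral_ge0.
apply: ge0_le_integral_any => // x _.
by rewrite funeposE /= ge_max fg g0.
Qed.

Lemma sqr_max_minorant (t c e : R) : 0 <= c ->
  2 * c * (t - e) - c ^+ 2 <= (Num.max 0 (t - e)) ^+ 2.
Proof.
move=> c0; set m := Num.max _ _.
have m0 : 0 <= m by rewrite /m le_max lexx.
have mt : t - e <= m by rewrite /m le_max lexx orbT.
have : 0 <= (m - c) ^+ 2 by exact: sqr_ge0.
by nra.
Qed.

(** For every phase u of modulus 1 and every c >= 0, the square of (|phi| - e)_+
    is at least 2 c (Re (phi u) - e) - c ^ 2, which is affine in phi: its mean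
    over a period only sees the coefficient of the frequency of u. *)
Lemma circle_bessel (T : eqType) (s : seq T) (m : T -> int) (b : T -> R[i])
    (j0 : T) (e : R) (g : R -> \bar R) :
  uniq s -> j0 \in s -> (forall j, j \in s -> m j = m j0 -> j = j0) ->
  (forall x, (((Num.max 0 (normc (\sum_(j <- s) b j * expi (- ((m j)%:~R * x)))
     - e)) ^+ 2)%:E <= g x)%E) ->
  (((Num.max 0 (normc (b j0) - e)) ^+ 2)%:E <=
     \int[mu]_(x in `[0%R, (2 * pi)%R]) g x)%E.
Proof.
move=> us j0s minj fg.
have g0 x : (0 <= g x)%E by rewrite (le_trans _ (fg x))// lee_fin sqr_ge0.
have [be|be] := leP (normc (b j0) - e) 0.
  by rewrite expr0n; apply: integral_ge0.
set c := normc (b j0) - e in be *.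
have pi1 : (1 : R) <= 2 * pi by have := pi_ge2 R; lra.
(* u rotates the coefficient of j0 onto the positive real axis *)
pose u := if b j0 == 0 then 1 else (normc (b j0))%:C%C / b j0.
have normu : normc u = 1.
  rewrite /u; case: ifPn => b0; first by rewrite normc1.
  have nb0 : normc (b j0) != 0 by apply: contraNneq b0 => /eq0_normc ->.
  by rewrite normcM normcV normc_real ger0_norm ?normc_ge0// divff.
have bu : b j0 * u = (normc (b j0))%:C%C.
  rewrite /u; case: ifPn => [/eqP ->|b0]; first by rewrite normc0 mul0r.
  by rewrite mulrC divfK.
pose h j x := complex.Re (b j * u * expi ((m j0 - m j)%:~R * x)).
have hE j x : h j x = complex.Re (b j * u) * cos ((m j0 - m j)%:~R * x) +
    (- complex.Im (b j * u)) * sin ((m j0 - m j)%:~R * x).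
  by rewrite /h; case: (b j * u) => p q /=; rewrite mulNr.
have mean_h j : j \in s ->
    period_mean (h j) (if j == j0 then 2 * pi * normc (b j0) else 0).
  move=> js; case: eqVneq => [->|jj0].
    have := period_mean_cst (normc (b j0)); congr period_mean.
    apply/funext => x; rewrite /h bu subrr mul0r expi0 mulr1 //.
  have nj0 : m j0 - m j != 0.
    by rewrite subr_eq0; apply: contraNneq jj0 => mj; rewrite (minj j js).
  have := period_meanD
    (period_meanZ (complex.Re (b j * u)) (period_mean_cos nj0))
    (period_meanZ (- complex.Im (b j * u)) (period_mean_sin (m j0 - m j))).
  by rewrite !mulr0 addr0; congr period_mean; apply/funext => x; rewrite hE.
have mean_sum : period_mean (fun x => \sum_(j <- s) h j x) (2 * pi * normc (b j0)).
  have -> : 2 * pi * normc (b j0) =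
      \sum_(j <- s) (if j == j0 then 2 * pi * normc (b j0) else 0).
    by rewrite (bigD1_seq j0)//= eqxx big1 ?addr0// => j /negPf ->.
  elim: (s) mean_h => [_|j r IH mean_h].
    rewrite big_nil; under eq_fun do rewrite big_nil.
    by have := period_mean_cst 0; rewrite mulr0.
  rewrite big_cons; under eq_fun do rewrite big_cons.
  apply: period_meanD; first by apply: mean_h; rewrite mem_head.
  by apply: IH => i ir; apply: mean_h; rewrite inE ir orbT.
have mean : period_mean
    (fun x => 2 * c * (\sum_(j <- s) h j x) + (- (2 * c * e) - c ^+ 2))
    (2 * c * (2 * pi * normc (b j0)) + 2 * pi * (- (2 * c * e) - c ^+ 2)).
  by apply: period_meanD; [exact: period_meanZ|exact: period_mean_cst].
apply: le_trans (le_integral_period_mean mean g0 _).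
  rewrite lee_fin.
  have -> : 2 * c * (2 * pi * normc (b j0)) + 2 * pi * (- (2 * c * e) - c ^+ 2) =
      2 * pi * c ^+ 2 by rewrite /c; ring.
  by rewrite ler_peMl ?sqr_ge0.
move=> x; rewrite (le_trans _ (fg x))// lee_fin.
set phi := \sum_(j <- s) b j * _.
have -> : \sum_(j <- s) h j x = complex.Re (phi * (u * expi ((m j0)%:~R * x))).
  rewrite /phi mulr_suml raddf_sum /=; apply: eq_bigr => j _; rewrite /h; congr complex.Re.
  rewrite intrB mulrBl expiD; ring.
apply: le_trans (sqr_max_minorant _ _ (ltW be)).
have : complex.Re (phi * (u * expi ((m j0)%:~R * x))) <= normc phi.
  rewrite (le_trans (ler_norm _))// (le_trans (normc_Re _))//.
  by rewrite !normcM normu normc_expi !mulr1.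
by move: (complex.Re _) (normc phi) be => p q; nra.
Qed.

Definition row_tail (T : Type) n (j : 'rV[T]_n.+1) : 'rV[T]_n :=
  \row_k j 0 (lift ord0 k).

Lemma dotZ_row_mx D (j : 'rV[int]_D.+1) (x : R) (y : 'rV[R]_D) :
  dotZ j (row_mx (x%:M : 'rV_1) y) = (j 0 ord0)%:~R * x + dotZ (row_tail j) y.
Proof.
rewrite /dotZ big_ord_recl; congr (_ * _ + _).
  by rewrite mxE; case: splitP => // k _; rewrite mxE !ord1 eqxx mulr1n.
apply: eq_bigr => k _; rewrite !mxE; congr (_ * _).
by case: splitP => [i /= ik|i /= [ik]]; [case: i ik => -[]|congr (y _ _); exact: val_inj].
Qed.

(** Bessel's inequality for one coefficient. The uniform error e absorbs the tails
    of absolutely convergent Fourier series, so that only finite sums are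
    integrated. In the induction, the polynomial is grouped by its frequencies in
    the last variables: the inner integral sees one group, which is a polynomial
    in the first variable. *)
Lemma torus_bessel D (s : seq 'rV[int]_D) (b : 'rV[int]_D -> R[i])
    (j0 : 'rV[int]_D) (e : R) (g : 'rV[R]_D -> \bar R) :
  uniq s -> j0 \in s ->
  (forall eta, (((Num.max 0 (normc (\sum_(j <- s) b j * expi (- dotZ j eta))
     - e)) ^+ 2)%:E <= g eta)%E) ->
  (((Num.max 0 (normc (b j0) - e)) ^+ 2)%:E <= torus_integral g)%E.
Proof.
elim: D => [|D IH] in s b j0 g *.
  move=> us j0s fg /=; apply: le_trans (fg 0); rewrite lee_fin.
  suff -> : \sum_(j <- s) b j * expi (- dotZ j 0) = b j0 by [].
  rewrite (bigD1_seq j0)//= big1 ?addr0.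
    by rewrite /dotZ big_ord0 oppr0 expi0 mulr1.
  by move=> j; rewrite (thinmx0 j) (thinmx0 j0) eqxx.
move=> us j0s fg /=.
pose s' := undup (map (@row_tail int D) s).
pose b' x j' := \sum_(j <- s | row_tail j == j') b j * expi (- ((j 0 ord0)%:~R * x)).
pose s0 := [seq j <- s | row_tail j == row_tail j0].
apply: (@circle_bessel _ s0 (fun j => j 0 ord0) b j0 e).
- exact: filter_uniq.
- by rewrite mem_filter eqxx.
- move=> j; rewrite mem_filter => /andP[/eqP tj js] j00; apply/rowP => k.
  have [->//|[k' ->]] : k = ord0 \/ exists k', k = lift ord0 k'.
    by case: (unliftP ord0 k) => [k' ->|->]; [right; exists k'|left].
  by have /rowP/(_ k') := tj; rewrite !mxE.
- move=> x; rewrite big_filter -/(b' x (row_tail j0)).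
  apply: (IH s') => [||y]; first exact: undup_uniq.
    by rewrite mem_undup map_f.
  apply: le_trans (fg _); rewrite lee_fin.
  suff -> : \sum_(j <- s) b j * expi (- dotZ j (row_mx (x%:M : 'rV_1) y)) =
      \sum_(j' <- s') b' x j' * expi (- dotZ j' y) by [].
  rewrite /b'; under [RHS]eq_bigr do rewrite mulr_suml.
  rewrite (exchange_big_dep xpredT) //=; apply: eq_big_seq => j js.
  rewrite big_mkcond (bigD1_seq (row_tail j)) ?undup_uniq ?mem_undup ?map_f//=.
  rewrite eqxx big1 ?addr0 => [|i]; last by rewrite eq_sym => /negPf ->.
  by rewrite dotZ_row_mx opprD expiD mulrA.
Qed.

End Bessel.

(** * Square-summable sequences and finite-difference operators *)

Section SquareSums.
Variable R : realType.

Definition sq_le (T : eqType) (u : T -> R[i]) (M : R) : Prop :=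
  sum_le (fun j => normc (u j) ^+ 2) M.

Lemma sum_le_esum (T : choiceType) (A : set T) (f : T -> R) M :
  (forall j, 0 <= f j) ->
  (\esum_(j in A) (f j)%:E <= M%:E)%E <->
  sum_le (fun j => if j \in A then f j else 0) M.
Proof.
move=> f0; split=> [fM s us|fM].
  rewrite -big_mkcond -big_filter -lee_fin -sumEFin.
  apply: le_trans fM; apply: esum_ge.
  exists [set` [seq j <- s | j \in A]].
    split; first exact: finite_seq.
    by move=> j /=; rewrite mem_filter => /andP[/set_mem].
  by rewrite -fsbig_seq ?filter_uniq.
apply: ge_ereal_sup => _ [F [finF FA] <-].
rewrite (fsbig_finite _ _ finF) /= sumEFin lee_fin.
rewrite (le_trans _ (fM _ (finmap.fset_uniq (fset_set F))))//.
rewrite le_eqVlt; apply/orP; left; apply/eqP; apply: eq_big_seq => j.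
by rewrite in_fset_set// => /set_mem/FA/mem_set ->.
Qed.

Lemma esum_lty (T : choiceType) (A : set T) (f : T -> R) :
  (forall j, 0 <= f j) ->
  (\esum_(j in A) (f j)%:E < +oo)%E <->
  exists M, sum_le (fun j => if j \in A then f j else 0) M.
Proof.
move=> f0; have g0 : (0 <= \esum_(j in A) (f j)%:E)%E.
  by apply: esum_ge0 => j _; rewrite lee_fin.
split=> [foo|[M fM]].
  exists (fine (\esum_(j in A) (f j)%:E)); apply/sum_le_esum => //.
  by rewrite fineK// ge0_fin_numE.
by apply: (@le_lt_trans _ _ M%:E); [exact/sum_le_esum|exact: ltry].
Qed.

Section OneType.
Variable T : eqType.
Implicit Types (u v : T -> R[i]).

Lemma sq_leW u v M : (forall j, normc (u j) <= normc (v j)) -> sq_le v M ->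
  sq_le u M.
Proof. by move=> uv; apply: sum_leW => j; rewrite ler_pXn2r// nnegrE normc_ge0. Qed.

Lemma sq_le_sum (I : Type) (r : seq I) (f : I -> T -> R[i]) (M : I -> R) :
  (forall i, sq_le (f i) (M i)) ->
  sq_le (fun j => \sum_(i <- r) f i j) ((size r)%:R * \sum_(i <- r) M i).
Proof.
move=> fM; apply: sum_leW (sum_leZ (ler0n _ _) (sum_le_sum r fM)) => j /=.
have := normc_sumM_sq r (fun=> 1) (fun i => f i j).
have -> : \sum_(i <- r) 1 * f i j = \sum_(i <- r) f i j.
  by apply: eq_bigr => i _; rewrite mul1r.
suff -> : \sum_(i <- r) normc 1%C ^+ 2 * normc (f i j) ^+ 2 =
    \sum_(i <- r) normc (f i j) ^+ 2 by [].
by apply: eq_bigr => i _; rewrite normc1 expr1n mul1r.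
Qed.

Lemma sq_leD u v M M' : sq_le u M -> sq_le v M' ->
  sq_le (fun j => u j + v j) (2 * (M + M')).
Proof.
move=> uM vM; have := @sq_le_sum _ [:: true; false]
  (fun b => if b then u else v) (fun b => if b then M else M').
rewrite /= !big_cons big_nil addr0.
have -> : (fun j => \sum_(i <- [:: true; false]) (if i then u else v) j) =
   (fun j => u j + v j).
  by apply/funext => j; rewrite !big_cons big_nil addr0.
by apply; case.
Qed.

Lemma sq_leZ c u M : sq_le u M ->
  sq_le (fun j => c * u j) (normc c ^+ 2 * M).
Proof.
move=> uM; apply: sum_leW (sum_leZ (sqr_ge0 _) uM) => j /=.
by rewrite normcM exprMn.
Qed.

Lemma sq_le0 : sq_le (fun _ : T => 0) 0.
Proof. by apply: sum_leW (@sum_le0 R T) => j; rewrite normc0 expr0n. Qed.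

Lemma sq_le_pt u M j : sq_le u M -> normc (u j) ^+ 2 <= M.
Proof. by move=> /(sum_le_pt j). Qed.

Lemma sq_le_eq0 u : sq_le u 0 -> u = fun=> 0.
Proof.
move=> u0; apply/funext => j; apply: eq0_normc; apply/eqP.
rewrite eq_le normc_ge0 andbT -(@ler_pXn2r _ 2)// ?nnegrE ?normc_ge0//.
by rewrite expr0n (sq_le_pt j u0).
Qed.

End OneType.

Lemma sq_le_inj (T U : eqType) (h : U -> T) (u : T -> R[i]) M :
  injective h -> sq_le u M -> sq_le (u \o h) M.
Proof. by move=> hinj uM; exact: (sum_le_inj hinj uM). Qed.

(** A least bound X lets an estimate X <= a + X / 2 be solved for X. *)
Lemma sum_le_least (T : eqType) (f : T -> R) M : sum_le f M ->
  exists m, sum_le f m /\ forall M', sum_le f M' -> m <= M'.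
Proof.
move=> fM.
pose A : set R := [set \sum_(j <- s) f j | s in [set s : seq T | uniq s]].
have A0 : A !=set0 by exists (\sum_(j <- [::]) f j); exists [::].
have hA : has_sup A by split=> //; exists M => _ [s us <-]; exact: fM.
exists (sup A); split.
  by move=> s us; apply: ub_le_sup; [exact: hA.2|exists s].
by move=> M' fM'; apply: ge_sup => // _ [s us <-]; exact: fM'.
Qed.

End SquareSums.

Section Stencils.
Variables (R : realType) (D : nat).

(** Parametrizes the cube [-K, K]^D by a finite type of functions: cubes are finite
    and sums of products over them factor. *)
Definition cube_row (K : nat) (f : {ffun 'I_D -> 'I_K.*2.+1}) : 'rV[int]_D :=
  \row_k ((f k)%:Z - K%:Z).

Lemma cube_rowP K (j : 'rV[int]_D) :
  (forall k, (absz (j 0%R k) <= K)%N) -> exists f, @cube_row K f = j.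
Proof.
move=> jK; exists [ffun k => inord (absz (j 0%R k + K%:Z)%R) : 'I_K.*2.+1].
apply/rowP => k; rewrite mxE ffunE inordK; have := jK k; lia.
Qed.

Lemma finite_tbox (r p : 'rV[nat]_D) : finite_set (tbox r p).
Proof.
pose K := (\sum_k (r 0%R k + p 0%R k))%N.
apply: (@sub_finite_set _ _ (range (@cube_row K))).
  move=> l lb; have [k|f <-] := @cube_rowP K l; last by exists f.
  have : (r 0%R k + p 0%R k <= K)%N by rewrite /K (bigD1 k)//= leq_addr.
  by have := lb k; lia.
exact/finite_image/finite_finset.
Qed.

Definition tbox_seq (r p : 'rV[nat]_D) : seq 'rV[int]_D :=
  finmap.enum_fset (fset_set (tbox r p)).

Lemma tbox_seq_uniq r p : uniq (tbox_seq r p).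
Proof. exact: finmap.fset_uniq. Qed.

Lemma mem_tbox_seq r p l : l \in tbox_seq r p <-> tbox r p l.
Proof.
rewrite /tbox_seq in_fset_set; last exact: finite_tbox.
by split=> [/set_mem|/mem_set].
Qed.

Variables (r p : Nd D).
Local Notation N := (p.1 + r.1)%N.

(** The first index runs downwards from p, in the order of the entries of a
    trace vector. *)
Definition stencil : seq (Zd D) :=
  allpairs (fun (i : 'I_N.+1) l' => ((p.1)%:Z - (i : nat)%:Z, l'))
    (enum 'I_N.+1) (tbox_seq r.2 p.2).

Lemma mem_stencil l : l \in stencil <-> box r p l.
Proof.
case: l => l1 l'; split=> [/allpairsP[[i m'] /= [_ /mem_tbox_seq lb [-> ->]]]|].
  by split=> //=; case: i => m /= mN; lia.
move=> [/= l1b l'b]; apply/allpairsP.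
have iN : (absz ((p.1)%:Z - l1)%R < N.+1)%N by lia.
exists (Ordinal iN, l'); split => //=; first exact: mem_enum.
  exact/mem_tbox_seq.
by congr (_, _); lia.
Qed.

Lemma stencil_uniq : uniq stencil.
Proof.
apply: allpairs_uniq; [exact: enum_uniq|exact: tbox_seq_uniq|].
move=> [i l] [i' l'] _ _ /= [] ii' ->; congr (_, _); apply: val_inj => /=.
by move: ii'; lia.
Qed.

Lemma finite_box : finite_set (box r p).
Proof.
by apply: (sub_finite_set _ (finite_seq stencil)) => l /mem_stencil.
Qed.

Lemma fsbig_box (f : Zd D -> R[i]) :
  \sum_(l \in box r p) f l = \sum_(l <- stencil) f l.
Proof.
rewrite (fsbig_finite _ _ finite_box) /=; apply: perm_big; apply: uniq_perm.
- exact: finmap.fset_uniq.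
- exact: stencil_uniq.
move=> l; rewrite in_fset_set; last exact: finite_box.
by apply/idP/idP => [/set_mem/mem_stencil|/mem_stencil/mem_set].
Qed.

Lemma QopE (c u : Zd D -> R[i]) j :
  Qop r p c u j = \sum_(l <- stencil) c l * u (j + l).
Proof. exact: fsbig_box. Qed.

Lemma Qop_rows (c u : Zd D -> R[i]) j : Qop r p c u j =
  \sum_(i < N.+1) \sum_(l' <- tbox_seq r.2 p.2)
    c ((p.1)%:Z - (i : nat)%:Z, l') * u (j.1 + ((p.1)%:Z - (i : nat)%:Z), j.2 + l').
Proof. by rewrite QopE /stencil big_allpairs_dep /= big_enum. Qed.

Lemma partial_symbolE (c : Zd D -> R[i]) l1 (eta : 'rV[R]_D) :
  partial_symbol r p c l1 eta =
  \sum_(l' <- tbox_seq r.2 p.2) c (l1, l') * expi (dotZ l' eta).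
Proof. exact/fsbig_finite/finite_tbox. Qed.

Lemma QopD (c u v : Zd D -> R[i]) a j :
  Qop r p c (fun j => a * u j + v j) j = a * Qop r p c u j + Qop r p c v j.
Proof.
rewrite !QopE mulr_sumr -big_split; apply: eq_bigr => l _ /=; ring.
Qed.

Lemma Qop_sum (I : Type) (t : seq I) (P : pred I) (c : Zd D -> R[i])
    (u : I -> Zd D -> R[i]) j :
  Qop r p c (fun j => \sum_(i <- t | P i) u i j) j = \sum_(i <- t | P i) Qop r p c (u i) j.
Proof.
rewrite QopE; under eq_bigr do rewrite mulr_sumr.
by rewrite exchange_big; apply: eq_bigr => i _; rewrite QopE.
Qed.

Lemma Qop0 (c : Zd D -> R[i]) j : Qop r p c (fun=> 0) j = 0.
Proof. by rewrite QopE big1// => l _; rewrite mulr0. Qed.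

Lemma eq_Qop (c u v : Zd D -> R[i]) j :
  (forall l, box r p l -> u (j + l) = v (j + l)) -> Qop r p c u j = Qop r p c v j.
Proof.
move=> uv; rewrite !QopE; apply: eq_big_seq => l /mem_stencil lb.
by rewrite uv.
Qed.

End Stencils.

(** * Weighted estimates for the inverse of an isomorphism *)

Section WeightedEstimates.
Variables (R : realType) (D : nat) (r p : Nd D).
Local Notation st := (stencil r p).
Implicit Types (c u : Zd D -> R[i]) (W : Zd D -> R) (M d : R).

Definition weighted W u : Zd D -> R[i] := fun j => (W j)%:C%C * u j.

(** Such weights almost commute with finite-difference operators; the constant
    weight 1 is one of them, so that weighted and plain estimates are treated
    together. *)
Definition slow_weight d W : Prop :=
  (forall j, 1 <= W j) /\
  forall j l, box r p l -> W (j + l) <= (1 + d) * W j /\ W j <= (1 + d) * W (j + l).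

Definition bounded_inverse c K : Prop :=
  0 < K /\ forall u M, l2 setT u -> sq_le (Qop r p c u) M -> sq_le u (K * M).

Definition stencil_norm c : R := (size st)%:R * \sum_(l <- st) normc (c l) ^+ 2.

Lemma stencil_norm_ge0 c : 0 <= stencil_norm c.
Proof. by rewrite mulr_ge0// sumr_ge0// => l _; rewrite sqr_ge0. Qed.

Lemma l2P (A : set (Zd D)) u :
  l2 A u <-> exists M, sq_le (fun j => if j \in A then u j else 0) M.
Proof.
rewrite /l2 /sqnorm esum_lty; last by move=> j; rewrite sqr_ge0.
by split=> -[M uM]; exists M; apply: sum_leW uM => j;
  case: ifP => // _; rewrite normc0 expr0n.
Qed.

Lemma l2TP u : l2 setT u <-> exists M, sq_le u M.
Proof.
rewrite l2P; split=> -[M uM]; exists M; apply: sum_leW uM => j.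
  by rewrite in_setT.
by rewrite in_setT.
Qed.

Lemma sqnorm_sq_le u M : (sqnorm setT u <= M%:E)%E <-> sq_le u M.
Proof.
rewrite /sqnorm sum_le_esum; last by move=> j; rewrite sqr_ge0.
by split=> uM; apply: sum_leW uM => j; rewrite in_setT.
Qed.

Lemma isomorphism_bounded_inverse c :
  l2_isomorphism (Qop r p c) -> exists K, bounded_inverse c K.
Proof.
move=> [Ql2 _ [K hK]]; exists (Num.max K 1); split.
  by rewrite lt_max ltr01 orbT.
move=> u M ul2 /sqnorm_sq_le QuM; apply/sqnorm_sq_le.
rewrite (le_trans (hK u ul2))//.
have Q0 : (0 <= sqnorm setT (Qop r p c u))%E.
  by apply: esum_ge0 => j _; rewrite lee_fin sqr_ge0.
have [x xE] : exists x : R, sqnorm setT (Qop r p c u) = x%:E.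
  exists (fine (sqnorm setT (Qop r p c u))).
  by rewrite fineK// ge0_fin_numE// (le_lt_trans QuM)// ltry.
move: QuM Q0; rewrite xE -EFinM !lee_fin => xM x0.
have Kmax : K <= Num.max K 1 by rewrite le_max lexx.
have max0 : 0 <= Num.max K 1 by rewrite le_max ler01 orbT.
by apply: (@le_trans _ _ (Num.max K 1 * x)); [rewrite ler_wpM2r|rewrite ler_wpM2l].
Qed.

Lemma sq_le_weighted_Qop c u W X : slow_weight 1 W ->
  sq_le (weighted W u) X ->
  sq_le (weighted W (Qop r p c u)) (4 * stencil_norm c * X).
Proof.
move=> [W1 Wslow] uX.
have W0 j : 0 <= W j by rewrite (le_trans _ (W1 j)).
have shifted : forall l, sum_le (fun j => normc (c l) ^+ 2 * normc (weighted W u (j + l)) ^+ 2)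
   (normc (c l) ^+ 2 * X).
  by move=> l; apply: sum_leZ; [exact: sqr_ge0|exact: (sq_le_inj (@addIr _ l) uX)].
have := sum_leZ _ (sum_le_sum st shifted); move/(_ (4 * (size st)%:R)).
rewrite mulr_ge0// => /(_ isT).
rewrite /stencil_norm -mulr_suml !mulrA; apply: sum_leW => j.
rewrite /weighted normcM exprMn QopE normc_real ger0_norm//.
apply: (@le_trans _ _ (W j ^+ 2 * ((size st)%:R *
    \sum_(l <- st) normc (c l) ^+ 2 * normc (u (j + l)) ^+ 2))).
  by rewrite ler_wpM2l ?sqr_ge0// normc_sumM_sq.
rewrite mulrCA [4 * _]mulrC -[leRHS]mulrA ler_wpM2l// mulr_sumr mulr_sumr.
rewrite big_seq [leRHS]big_seq ler_sum// => l /mem_stencil lb.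
rewrite normcM normc_real ger0_norm// exprMn.
have [_ h] := Wslow j l lb.
have : W j ^+ 2 <= 4 * W (j + l) ^+ 2.
  have -> : 4 * W (j + l) ^+ 2 = ((1 + 1) * W (j + l)) ^+ 2 :> R by ring.
  by rewrite ler_pXn2r// nnegrE ?mulr_ge0.
have n0 := sqr_ge0 (normc (c l)); have n1 := sqr_ge0 (normc (u (j + l))).
by move: (mulr_ge0 n0 n1); nra.
Qed.

(** Only the differences W(j + l) - W(j) occur in Q (W u) - W (Q u), and they are
    at most d W(j + l). *)
Lemma sq_le_commutator c u W d X : 0 <= d -> slow_weight d W ->
  sq_le (weighted W u) X ->
  sq_le (fun j => Qop r p c (weighted W u) j - weighted W (Qop r p c u) j)
    (d ^+ 2 * stencil_norm c * X).
Proof.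
move=> d0 [W1 Wslow] uX.
have W0 j : 0 <= W j by rewrite (le_trans _ (W1 j)).
have shifted : forall l, sum_le (fun j => normc (c l) ^+ 2 * normc (weighted W u (j + l)) ^+ 2)
   (normc (c l) ^+ 2 * X).
  by move=> l; apply: sum_leZ; [exact: sqr_ge0|exact: (sq_le_inj (@addIr _ l) uX)].
have := sum_leZ _ (sum_le_sum st shifted); move/(_ (d ^+ 2 * (size st)%:R)).
rewrite mulr_ge0 ?sqr_ge0// => /(_ isT).
rewrite /stencil_norm -mulr_suml !mulrA; apply: sum_leW => j.
rewrite /weighted !QopE mulr_sumr -sumrB.
have -> : \sum_(l <- st) (c l * ((W (j + l))%:C%C * u (j + l)) -
    (W j)%:C%C * (c l * u (j + l))) =
  \sum_(l <- st) c l * (((W (j + l) - W j)%:C)%C * u (j + l)).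
  by apply: eq_bigr => l _; rewrite rmorphB /=; ring.
rewrite (le_trans (normc_sumM_sq _ _ _))// [d ^+ 2 * _]mulrC -[leRHS]mulrA.
rewrite ler_wpM2l// mulr_sumr.
rewrite big_seq [leRHS]big_seq ler_sum// => l /mem_stencil lb.
have [h1 h2] := Wslow j l lb.
have dW : `|W (j + l) - W j| <= d * W (j + l).
  have := W0 j; have := W0 (j + l).
  by have [?|?] := leP (W j) (W (j + l));
    [rewrite ger0_norm|rewrite ltr0_norm]; nra.
have : normc ((W (j + l) - W j)%:C%C * u (j + l)) ^+ 2 <=
    d ^+ 2 * normc ((W (j + l))%:C%C * u (j + l)) ^+ 2.
  rewrite !normcM !exprMn [leRHS]mulrA ler_wpM2r ?sqr_ge0//.
  rewrite -exprMn ler_pXn2r ?nnegrE ?mulr_ge0 ?normc_ge0//.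
  by rewrite !normc_real [`|W (j + l)|]ger0_norm.
by have := sqr_ge0 (normc (c l)); nra.
Qed.

Lemma slow_weight_min d W B : 0 <= d -> 1 <= B -> slow_weight d W ->
  slow_weight d (fun j => Num.min (W j) B).
Proof.
move=> d0 B1 [W1 Wslow]; split=> [j|j l lb]; first by rewrite le_min W1.
have [h1 h2] := Wslow j l lb; have := W1 j; have := W1 (j + l).
have [?|?] := leP (W j) B; have [?|?] := leP (W (j + l)) B; nra.
Qed.

Section OneOperator.
Variables (c : Zd D -> R[i]) (K d : R).
Hypotheses (cK : bounded_inverse c K) (d0 : 0 <= d).
Hypothesis small : 4 * K * (d ^+ 2 * stencil_norm c) <= 1.

Let weighted_inverse_bounded W B u M :
  slow_weight d W -> (forall j, W j <= B) ->
  l2 setT u -> sq_le (weighted W (Qop r p c u)) M ->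
  sq_le (weighted W u) (4 * K * M).
Proof.
move=> Wslow WB ul2 QuM; have [K0 invK] := cK.
have W1 := Wslow.1.
have [Mu uM] : exists M', sq_le (weighted W u) M'.
  have [M' uM'] := (l2TP u).1 ul2; exists (B ^+ 2 * M').
  apply: sum_leW (sum_leZ (sqr_ge0 _) uM') => j /=.
  rewrite normcM exprMn ler_wpM2r ?sqr_ge0// normc_real.
  have := W1 j; have := WB j => ? ?.
  by rewrite ger0_norm ?ler_pXn2r ?nnegrE//; lra.
have [X [uX leastX]] := sum_le_least uM.
have X0 := sum_le_ge0 uX; have M0 := sum_le_ge0 QuM.
(* the commutator costs at most half of X, which is absorbed on the left *)
apply: (sum_le_trans _ uX).
suff : X <= K * (2 * (d ^+ 2 * stencil_norm c * X + M)).
  by move: small; move: (d ^+ 2 * _) => t; nra.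
apply: leastX; apply: invK; first by apply/l2TP; exists Mu.
have := sq_leD (sq_le_commutator c d0 Wslow uX) QuM.
by congr sq_le; apply/funext => j; rewrite subrK.
Qed.

(** Weighted sequences need not be square summable a priori: the estimate is
    first proved for the truncated weights min(W, B), uniformly in B. *)
Lemma weighted_inverse W u M :
  slow_weight d W -> l2 setT u -> sq_le (weighted W (Qop r p c u)) M ->
  sq_le (weighted W u) (4 * K * M).
Proof.
move=> Wslow ul2 QuM s us.
have W1 := Wslow.1.
pose B := \sum_(j <- s) W j + 1.
have B1 : 1 <= B.
  by rewrite lerDr sumr_ge0// => j _; rewrite (le_trans _ (W1 j)).
have WB j : j \in s -> W j <= B.
  move=> js; rewrite /B (big_rem j)//=.
  have : 0 <= \sum_(y <- rem j s) W y.
    by rewrite sumr_ge0// => i _; rewrite (le_trans _ (W1 i)).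
  by lra.
have := @weighted_inverse_bounded (fun j => Num.min (W j) B) B u M.
move=> /(_ (slow_weight_min d0 B1 Wslow)) /(_ _ ul2).
have minB j : Num.min (W j) B <= B by rewrite ge_min lexx orbT.
move=> /(_ minB) => {}H.
rewrite (eq_big_seq (fun j => normc (weighted (fun j => Num.min (W j) B) u j) ^+ 2)).
  apply: H => //; apply: sq_leW QuM => j.
  rewrite !normcM ler_wpM2r ?normc_ge0// !normc_real.
  have := W1 j => ?; have m0 : 0 <= Num.min (W j) B by rewrite le_min; lra.
  by rewrite !ger0_norm ?ge_min ?lexx//; lra.
by move=> j js; rewrite /weighted (_ : Num.min _ _ = W j)//; exact/min_idPl/WB.
Qed.

End OneOperator.

End WeightedEstimates.

(** * Exponential weights *)

Section ExponentialWeights.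
Variables (R : realType) (D : nat).

Definition norm1 (j : 'rV[int]_D) : nat := (\sum_k absz (j 0%R k))%N.

Definition exp_weight (theta : R) (j : Zd D) : R :=
  theta ^+ (absz j.1 + norm1 j.2)%N.

Lemma norm1D (j l : 'rV[int]_D) : (norm1 (j + l)%R <= norm1 j + norm1 l)%N.
Proof.
rewrite /norm1 -big_split /= leq_sum// => k _; rewrite mxE.
by move: (j _ _) (l _ _) => a b; lia.
Qed.

Lemma exprD1_le (x : R) n : 0 <= x <= 1 -> (1 + x) ^+ n <= 1 + 3 ^+ n * x.
Proof.
move=> /andP[x0 x1]; elim: n => [|n IH]; first by rewrite !expr0; lra.
have b1 : (1 : R) <= 3 ^+ n by rewrite exprn_ege1// ler1n.
rewrite !exprSr (le_trans (ler_wpM2r _ IH))//; first lra.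
move: b1; move: (3 ^+ n) => b b1.
have bx : 0 <= b * x by rewrite mulr_ge0//; lra.
have : b * x * x <= b * x by rewrite ler_piMr.
have : x <= b * x by rewrite ler_peMl.
lra.
Qed.

(** For a fixed stencil, theta ^ |l| is as close to 1 as needed when theta is close
    to 1. *)
Lemma exp_weight_slow (r p : Nd D) (d : R) : 0 < d ->
  exists2 theta, 1 < theta & slow_weight r p d (exp_weight theta).
Proof.
move=> d0.
have [L hL] : exists L : nat, forall l, l \in stencil r p ->
    (absz l.1 + norm1 l.2 <= L)%N.
  exists (\sum_(l <- stencil r p) (absz l.1 + norm1 l.2))%N => l lst.
  by rewrite (big_rem l)//= leq_addr.
have [b b1 bL] : exists2 b : R, 0 < b &
    forall x, 0 <= x <= 1 -> (1 + x) ^+ L <= 1 + b * x.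
  by exists (3 ^+ L) => [|x]; [rewrite exprn_gt0|exact: exprD1_le].
have [x [x0 x1 xd]] : exists x, [/\ 0 < x, x <= 1 & b * x <= d].
  exists (Num.min 1 (d / b)); split.
  - by rewrite lt_min ltr01 divr_gt0.
  - by rewrite ge_min lexx.
  - by rewrite mulrC -ler_pdivlMr// ge_min lexx orbT.
have th1 : 1 < 1 + x by rewrite ltrDl.
have thL l : box r p l -> (1 + x) ^+ (absz l.1 + norm1 l.2) <= 1 + d.
  move=> /mem_stencil lst; apply: (@le_trans _ _ ((1 + x) ^+ L)).
    by rewrite ler_weXn2l ?ltW// hL.
  by rewrite (le_trans (bL x _)) ?lerD2l// (ltW x0) x1.
have step (m n : nat) l : box r p l -> (m <= n + (absz l.1 + norm1 l.2))%N ->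
    (1 + x) ^+ m <= (1 + d) * (1 + x) ^+ n.
  move=> lb mn; apply: (@le_trans _ _ ((1 + x) ^+ (n + (absz l.1 + norm1 l.2)))).
    by rewrite ler_weXn2l ?ltW.
  by rewrite exprD mulrC ler_wpM2r ?exprn_ge0 ?thL// ltW// (lt_trans ltr01).
exists (1 + x) => //; split=> [j|j l lb]; first by rewrite exprn_ege1// ltW.
split; apply: (step _ _ l lb) => /=.
  by have := norm1D j.2 l.2; case: j l {lb} => [j1 j'] [l1 l'] /=; lia.
have := norm1D (j.2 + l.2) (- l.2); rewrite addrK.
have -> : norm1 (- l.2) = norm1 l.2.
  by apply: eq_bigr => k _; rewrite mxE abszN.
by case: j l {lb} => [j1 j'] [l1 l'] /=; lia.
Qed.

Lemma sum_le_geometric (q : R) : 0 <= q < 1 ->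
  sum_le (fun t : nat => q ^+ t) (1 - q)^-1.
Proof.
move=> /andP[q0 q1] s us; have q10 : 0 < 1 - q by lra.
pose n := (\sum_(t <- s) t.+1)%N.
have sub : {subset s <= iota 0 n}.
  by move=> t ts; rewrite mem_iota /= add0n /n (big_rem t)//= leq_addr.
apply: (@le_trans _ _ (\sum_(t <- iota 0 n) q ^+ t)).
  rewrite (big_uniq_sub _ us (iota_uniq _ _) sub) lerDl sumr_ge0// => t _.
  exact: exprn_ge0.
rewrite -[n]subn0 -/(index_iota 0 n) big_mkord.
rewrite -(ler_pM2l q10) divff ?gt_eqF// -opprB mulNr -subrX1 opprB.
by rewrite gerBl exprn_ge0.
Qed.

Lemma sum_le_geometric_int (q : R) : 0 <= q < 1 ->
  sum_le (fun t : int => q ^+ absz t) ((1 - q)^-1 + (1 - q)^-1).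
Proof.
move=> q01; have geo := sum_le_geometric q01.
have pos : sum_le (fun t : int => if 0 <= t then q ^+ absz t else 0) (1 - q)^-1.
  apply: (@sum_le_pinj _ _ _ absz (fun t => 0 <= t) _ _ _ _ _ geo) => //.
  by move=> x y; rewrite -!topredE /=; lia.
have neg : sum_le (fun t : int => if t < 0 then q ^+ absz t else 0) (1 - q)^-1.
  apply: (@sum_le_pinj _ _ _ absz (fun t => t < 0) _ _ _ _ _ geo) => //.
  by move=> x y; rewrite -!topredE /=; lia.
apply: sum_leW (sum_leD pos neg) => t.
by case: ltP; rewrite ?addr0 ?add0r.
Qed.

(** The sum over a cube factors into one-dimensional geometric sums. *)
Lemma sum_le_norm1 (theta : R) : 1 < theta ->
  exists S : R, sum_le (fun j : 'rV[int]_D => theta ^- norm1 j) S.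
Proof.
move=> th1; pose q := theta^-1.
have q01 : 0 <= q < 1 by rewrite invr_ge0 invf_lt1; lra.
pose S1 := (1 - q)^-1 + (1 - q)^-1.
exists (S1 ^+ D) => s us.
pose K := (\sum_(j <- s) norm1 j)%N.
have sK j : j \in s -> exists f, @cube_row D K f = j.
  move=> js; apply: cube_rowP => k.
  apply: (@leq_trans (norm1 j)); first by rewrite /norm1 (bigD1 k)//= leq_addr.
  by rewrite /K (big_rem j)//= leq_addr.
have one : \sum_(t < K.*2.+1) q ^+ (absz ((t : nat)%:Z - K%:Z)%R) <= S1.
  rewrite -(big_map (fun t : 'I_K.*2.+1 => (t : nat)%:Z - K%:Z) xpredT
    (fun t => q ^+ absz t)).
  apply: (sum_le_geometric_int q01); rewrite map_inj_uniq ?enum_uniq//.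
    by rewrite /index_enum -enumT enum_uniq.
  by move=> x y /= xy; apply: val_inj => /=; lia.
have -> : S1 ^+ D = \prod_(k < D) S1 by rewrite GRing.prodr_const card_ord.
apply: (@le_trans _ _ (\prod_(k < D)
    \sum_(t < K.*2.+1) q ^+ (absz ((t : nat)%:Z - K%:Z)%R))); last first.
  apply: ler_prod => k _; rewrite one andbT sumr_ge0// => t _.
  by rewrite exprn_ge0//; case/andP: q01.
rewrite bigA_distr_bigA /=.
pose F (f : {ffun 'I_D -> 'I_K.*2.+1}) := theta ^- norm1 (cube_row f).
have FE (f : {ffun 'I_D -> 'I_K.*2.+1}) :
    \prod_k q ^+ (absz ((f k : nat)%:Z - K%:Z)%R) = F f.
  rewrite /F /norm1 -exprVn -/q prodrXr; congr (_ ^+ _).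
  by apply: eq_bigr => k _; rewrite mxE.
rewrite (eq_bigr F) => [|f _]; last exact: FE.
have cube_inj : injective (@cube_row D K).
  move=> f g /rowP fg; apply/ffunP => k; apply: val_inj => /=.
  by have := fg k; rewrite !mxE; lia.
have : \sum_(j <- map (@cube_row D K) (enum {ffun 'I_D -> 'I_K.*2.+1}))
    theta ^- norm1 j = \sum_f F f by rewrite big_map big_enum.
move=> <-; set t := map _ _.
have ut : uniq t by rewrite map_inj_uniq ?enum_uniq.
have sub : {subset s <= t} by move=> j /sK[f <-]; rewrite map_f ?mem_enum.
rewrite (big_uniq_sub _ us ut sub) lerDl sumr_ge0// => j _.
by rewrite invr_ge0 exprn_ge0//; lra.
Qed.

End ExponentialWeights.

(** * Time-dependent problems on the whole lattice *)

Section WholeSpace.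
Variables (R : realType) (D : nat) (r p : Nd D) (s : nat).
Variable c : nat -> Zd D -> R[i].
Local Notation N := (p.1 + r.1)%N.
Local Notation seqs := (nat -> Zd D -> R[i]).
Implicit Types (u v b : seqs) (w : nat -> 'rV[int]_D -> 'cV[R[i]]_N).

Definition delay k u n : Zd D -> R[i] := if (k <= n)%N then u (n - k)%N else fun=> 0.

(** The multistep scheme read backwards in time, with value 0 at negative times:
    a convolution operator in time whose leading coefficient is Q_(s+1). *)
Definition scheme u n j : R[i] :=
  \sum_(k < s.+2) Qop r p (c (s.+1 - k)) (delay k u n) j.

Lemma scheme_shift u n j :
  \sum_(sg < s.+2) Qop r p (c sg) (u (n + sg)%N) j = scheme u (n + s.+1)%N j.
Proof.
rewrite /scheme (reindex_inj rev_ord_inj) /=; apply: eq_bigr => k _.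
have ks := ltn_ord k; rewrite /delay ifT; last by lia.
by rewrite subSS; do 2 f_equal; lia.
Qed.

Lemma schemeS u n j : scheme u n j = Qop r p (c s.+1) (u n) j +
  \sum_(k < s.+1) Qop r p (c (s - k)) (delay k.+1 u n) j.
Proof. by rewrite /scheme big_ord_recl /delay leq0n !subn0. Qed.

Lemma eq_scheme u v n j : (forall m, (m <= n)%N -> u m = v m) ->
  scheme u n j = scheme v n j.
Proof.
move=> uv; apply: eq_bigr => k _; rewrite /delay.
by case: ifP => // kn; rewrite uv// leq_subr.
Qed.

Lemma scheme_linear a u v n j :
  scheme (fun n j => a * u n j + v n j) n j = a * scheme u n j + scheme v n j.
Proof.
rewrite /scheme mulr_sumr -big_split; apply: eq_bigr => k _ /=.
rewrite -QopD; apply: eq_Qop => l _; rewrite /delay.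
by case: ifP => //; rewrite mulr0 addr0.
Qed.

Lemma schemeB u v n j :
  scheme (fun n j => u n j - v n j) n j = scheme u n j - scheme v n j.
Proof.
have := scheme_linear (-1) v u n j; rewrite mulN1r addrC => <-.
apply: eq_bigr => k _; apply: eq_Qop => l _; rewrite /delay.
by case: ifP => // _; ring.
Qed.

Lemma schemeD u v n j :
  scheme (fun n j => u n j + v n j) n j = scheme u n j + scheme v n j.
Proof.
have := scheme_linear 1 u v n j; rewrite mul1r => <-.
apply: eq_bigr => k _; apply: eq_Qop => l _; rewrite /delay.
by case: ifP => // _; ring.
Qed.

(** Convolution in time commutes with the scheme; this reduces general boundary
    data to data concentrated at time 0. *)
Lemma scheme_conv (u : nat -> seqs) n j :
  scheme (fun n j => \sum_(m < n.+1) u m (n - m)%N j) n j =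
  \sum_(m < n.+1) scheme (u m) (n - m)%N j.
Proof.
rewrite /scheme exchange_big /=; apply: eq_bigr => k _.
have -> : delay k (fun n j => \sum_(m < n.+1) u m (n - m)%N j) n =
    fun j => \sum_(m < n.+1) delay k (u m) (n - m)%N j.
  apply/funext => i; rewrite /delay; case: leqP => kn; last first.
    rewrite big1// => m _; rewrite ifF//; have := ltn_ord m; lia.
  rewrite (big_ord_widen n.+1 (fun m => u m (n - k - m)%N i)) ?ltnS ?leq_subr//.
  rewrite [RHS](bigID (fun m : 'I_n.+1 => (m < (n - k).+1)%N)) /=.
  rewrite [X in _ + X]big1 ?addr0 => [|m mk].
    apply: eq_bigr => m mk; rewrite ifT; last by lia.
    by congr (u _ _ _); lia.
  by rewrite ifF//; have := ltn_ord m; lia.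
by rewrite Qop_sum.
Qed.

Lemma slow_weight1 d : 0 <= d -> slow_weight r p d (fun=> 1 : R).
Proof. by move=> d0; split=> // j l _; rewrite mulr1; split; lra. Qed.

Lemma weighted1 (u : Zd D -> R[i]) : weighted (fun=> 1) u = u.
Proof. by apply/funext => j; rewrite /weighted mul1r. Qed.

Lemma l2_Qop (a f : Zd D -> R[i]) : l2 setT f -> l2 setT (Qop r p a f).
Proof.
move=> /l2TP[M fM]; apply/l2TP; exists (4 * stencil_norm r p a * M).
have := @sq_le_weighted_Qop R D r p a f (fun=> 1) M (slow_weight1 ler01).
by rewrite !weighted1; apply.
Qed.

Lemma l2_0 : l2 setT (fun _ : Zd D => 0 : R[i]).
Proof. by apply/l2TP; exists 0; exact: sq_le0. Qed.

Lemma l2_sum (I : Type) (t : seq I) (f : I -> Zd D -> R[i]) :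
  (forall i, l2 setT (f i)) -> l2 setT (fun j => \sum_(i <- t) f i j).
Proof.
move=> fl2; elim: t => [|i t /l2TP[M IH]].
  by under eq_fun do rewrite big_nil; exact: l2_0.
have [M' fM] := (l2TP _).1 (fl2 i).
by apply/l2TP; eexists; under eq_fun do rewrite big_cons; exact: sq_leD fM IH.
Qed.

Lemma l2_linear a (f g : Zd D -> R[i]) : l2 setT f -> l2 setT g ->
  l2 setT (fun j => a * f j + g j).
Proof.
move=> /l2TP[M fM] /l2TP[M' gM]; apply/l2TP; eexists.
exact: sq_leD (sq_leZ a fM) gM.
Qed.

Lemma l2_delay k u n : (forall n, l2 setT (u n)) -> l2 setT (delay k u n).
Proof. by move=> ul2; rewrite /delay; case: ifP => // _; exact: l2_0. Qed.

Lemma l2_scheme u n : (forall n, l2 setT (u n)) -> l2 setT (scheme u n).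
Proof. by move=> ul2; apply: l2_sum => k; apply/l2_Qop/l2_delay. Qed.

Hypothesis iso : l2_isomorphism (Qop r p (c s.+1)).

(** At each time, Q_(s+1) u^n is prescribed by the source and the earlier u^m. *)
Lemma scheme_solvable b : (forall n, l2 setT (b n)) ->
  exists u, (forall n, l2 setT (u n)) /\ forall n j, scheme u n j = b n j.
Proof.
move=> bl2.
have [S hS] : exists S : (Zd D -> R[i]) -> Zd D -> R[i], forall f, l2 setT f ->
    l2 setT (S f) /\ Qop r p (c s.+1) (S f) = f.
  suff H : forall f, exists g : Zd D -> R[i], l2 setT f ->
      l2 setT g /\ Qop r p (c s.+1) g = f by have [S hS] := choice H; exists S.
  move=> f; have [fl2|nfl2] := pselect (l2 setT f); last by exists f.
  by have [_ /(_ f fl2)[g gl2 gf] _] := iso; exists g.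
pose rhs u n j := b n j - \sum_(k < s.+1) Qop r p (c (s - k)) (delay k.+1 u n) j.
(* hist n holds the values at times below n; the recursion on n makes them
   available to the next step *)
pose hist := fix hist n : seqs := if n is m.+1 then
  fun k => if (k < m)%N then hist m k else S (rhs (hist m) m) else fun=> fun=> 0.
pose u n := hist n.+1 n.
have histE n k : (k < n)%N -> hist n k = u k.
  elim: n => // n IH; rewrite ltnS => kn /=.
  case: ltnP => [/IH //|nk]; have -> : k = n by apply/eqP; rewrite eqn_leq kn nk.
  by rewrite /u /= ltnn.
have uE n : u n = S (rhs u n).
  rewrite {1}/u /= ltnn; congr S; apply/funext => j; rewrite /rhs.
  congr (_ - _); apply: eq_bigr => k _; apply: eq_Qop => l _.
  by rewrite /delay; case: ifP => // kn; rewrite histE//; lia.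
have rhs_l2 n : (forall m, (m < n)%N -> l2 setT (u m)) -> l2 setT (rhs u n).
  move=> ul2; rewrite (_ : rhs u n = fun j => (-1) *
    (\sum_(k < s.+1) Qop r p (c (s - k)) (delay k.+1 u n) j) + b n j).
    apply: l2_linear => //; apply: l2_sum => k; apply: l2_Qop.
    rewrite /delay; case: ifP => [kn|_]; last exact: l2_0.
    by apply: ul2; lia.
  by apply/funext => j; rewrite /rhs; ring.
have ul2 n : l2 setT (u n).
  elim/ltn_ind: n => n IH; rewrite uE.
  by have [] := hS _ (rhs_l2 n IH).
exists u; split=> // n j; rewrite schemeS {1}uE.
by have [_ ->] := hS _ (rhs_l2 n (fun m _ => ul2 m)); rewrite /rhs subrK.
Qed.

(** By induction on time, from [weighted_inverse]. The constants do not depend on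
    the weight: the weight 1 gives uniqueness and continuity in l2, exponential
    weights give decay in space. *)
Lemma scheme_growth : exists d C A : R, [/\ 0 < d, 0 <= C, 1 <= A &
  forall W u M m, slow_weight r p d W -> (forall n, l2 setT (u n)) ->
    (forall n, (n <= m)%N -> sq_le (weighted W (scheme u n)) M) ->
    forall n, (n <= m)%N -> sq_le (weighted W (u n)) (C * A ^+ n * M)].
Proof.
have [K cK] := isomorphism_bounded_inverse iso.
have K0 := cK.1.
pose B := stencil_norm r p (c s.+1).
have B0 : 0 <= B by exact: stencil_norm_ge0.
have [d [d0 d1 small]] : exists d, [/\ 0 < d, d <= 1 & 4 * K * (d ^+ 2 * B) <= 1].
  have KB0 : 0 <= 4 * K * B by rewrite mulr_ge0// mulr_ge0// ltW.
  have KB : 0 < 1 + 4 * K * B by lra.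
  exists (1 + 4 * K * B)^-1; split.
  - by rewrite invr_gt0.
  - by rewrite invf_le1// lerDl.
  - set t := _^-1; have t0 : 0 < t by rewrite invr_gt0.
    have tE : t * (1 + 4 * K * B) = 1 by rewrite mulVf ?gt_eqF.
    have t1 : t <= 1 by rewrite invf_le1// lerDl.
    have -> : 4 * K * (t ^+ 2 * B) = t * (t * (1 + 4 * K * B) - t) by ring.
    by rewrite tE; nra.
pose C1 := \sum_(k < s.+1) 4 * stencil_norm r p (c (s - k)).
have C10 : 0 <= C1.
  by rewrite sumr_ge0// => k _; rewrite mulr_ge0// stencil_norm_ge0.
(* C makes the source, and A the earlier times, contribute half of the bound *)
pose C := 16 * K; pose A := 1 + 16 * K * s.+1%:R * C1.
have sC1 : 0 <= 16 * K * s.+1%:R * C1 by rewrite !mulr_ge0 ?(ltW K0).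
have A1 : 1 <= A by rewrite lerDl.
have C0 : 0 <= C by rewrite mulr_ge0// ltW.
exists d, C, A; split=> // W u M m Wslow ul2 uM n.
have M0 := sum_le_ge0 (uM 0%N isT).
have W1 : slow_weight r p 1 W.
  split; first exact: Wslow.1.
  move=> j l lb; have [] := Wslow.2 j l lb; have := Wslow.1 j.
  by have := Wslow.1 (j + l); nra.
elim/ltn_ind: n => n IH nm.
have Adiv : 0 <= A ^+ n * A^-1.
  by rewrite mulr_ge0 ?invr_ge0 ?exprn_ge0//; lra.
have past (k : 'I_s.+1) : sq_le (weighted W (delay k.+1 u n)) (C * (A ^+ n * A^-1) * M).
  rewrite /delay; case: ifP => kn; last first.
    apply: (@sum_le_trans R _ _ 0); first by rewrite mulr_ge0// mulr_ge0.
    by apply: (sum_leW _ (@sq_le0 R _)) => j; rewrite /weighted mulr0.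
  apply: sum_le_trans (IH _ _ _); first last.
  - exact: leq_trans (leq_subr _ _) nm.
  - by rewrite ltn_subrL (leq_ltn_trans _ kn).
  rewrite ler_wpM2r// ler_wpM2l//.
  have -> : A ^+ n * A^-1 = A ^+ n.-1.
    have nE := esym (ltn_predK kn).
    rewrite {1}nE exprSr mulfK// gt_eqF//; lra.
  by rewrite ler_weXn2l// -subn1 leq_sub2l.
have lead : sq_le (weighted W (Qop r p (c s.+1) (u n)))
    (2 * (M + s.+1%:R * (C1 * (C * (A ^+ n * A^-1) * M)))).
  have := sq_leD (uM n nm) (sq_leZ (-1) (@sq_le_sum R _ _ (index_enum 'I_s.+1) _ _
    (fun k => sq_le_weighted_Qop (c (s - k)) W1 (past k)))).
  rewrite normcN normc1 expr1n mul1r -mulr_suml -/C1.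
  rewrite [size _](_ : _ = s.+1); last by rewrite /index_enum -enumT size_enum_ord.
  congr sq_le; apply/funext => j.
  by rewrite /weighted schemeS mulrDr mulN1r [_ * \sum_(k < s.+1) _]mulr_sumr addrK.
have := weighted_inverse cK (ltW d0) small Wslow (ul2 n) lead.
apply: sum_le_trans.
have -> : 4 * K * (2 * (M + s.+1%:R * (C1 * (C * (A ^+ n * A^-1) * M)))) =
    8 * K * M + (8 * K * s.+1%:R * C1) * A^-1 * (C * A ^+ n * M) by ring.
have An1 : 1 <= A ^+ n by rewrite exprn_ege1.
have half : 8 * K * s.+1%:R * C1 * A^-1 <= 1 / 2.
  by rewrite ler_pdivrMr; rewrite /A; lra.
have h1 : 8 * K * M <= C * A ^+ n * M / 2.
  have : C * M <= C * A ^+ n * M.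
    by rewrite ler_wpM2r// ler_peMr.
  by rewrite /C; lra.
have : 0 <= C * A ^+ n * M by rewrite mulr_ge0// mulr_ge0//; lra.
by move: half h1; move: (C * A ^+ n * M) (8 * K * _ * _ * _) => x y; nra.
Qed.

Lemma scheme_unique u v m : (forall n, l2 setT (u n)) ->
  (forall n, l2 setT (v n)) ->
  (forall n j, (n <= m)%N -> scheme u n j = scheme v n j) -> u m = v m.
Proof.
move=> ul2 vl2 uv.
have [d [C [A [d0 C0 A1 growth]]]] := scheme_growth.
have el2 n : l2 setT (fun j => u n j - v n j).
  rewrite (_ : (fun j => _) = fun j => (-1) * v n j + u n j); first exact: l2_linear.
  by apply/funext => j; ring.
have := growth (fun=> 1) (fun n j => u n j - v n j) 0 m (slow_weight1 (ltW d0)) el2.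
have e0 n : (n <= m)%N ->
    sq_le (weighted (fun=> 1) (scheme (fun n j => u n j - v n j) n)) 0.
  move=> nm; rewrite weighted1; apply: (sum_leW _ (@sq_le0 R _)) => j.
  by rewrite schemeB uv// subrr.
move=> /(_ e0 m (leqnn m)); rewrite weighted1 mulr0 => /sq_le_eq0 /funeqP uv0.
by apply/funext => j; apply/eqP; rewrite -subr_eq0 uv0.
Qed.

End WholeSpace.

(** * Discrete Calderon operators *)

Section VectorSequences.
Variables (R : realType) (D : nat).

Lemma vsq_ge0 N (v : 'cV[R[i]]_N) : 0 <= vsq v.
Proof. by rewrite sumr_ge0// => i _; rewrite sqr_ge0. Qed.

Lemma normc_le_vsq N (v : 'cV[R[i]]_N) i : normc (v i 0) ^+ 2 <= vsq v.
Proof.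
by rewrite /vsq (bigD1 i)//= lerDl sumr_ge0// => k _; rewrite sqr_ge0.
Qed.

Lemma vl2P N (v : 'rV[int]_D -> 'cV[R[i]]_N) :
  vl2 v <-> exists M, forall i, sq_le (fun j => v j i 0) M.
Proof.
rewrite /vl2 /vsqnorm esum_lty; last by move=> j; exact: vsq_ge0.
split=> -[M vM].
  by exists M => i; apply: sum_leW vM => j; rewrite in_setT normc_le_vsq.
exists (\sum_(i < N) M); apply: sum_leW (sum_le_sum (index_enum _) vM) => j.
by rewrite in_setT.
Qed.

Lemma vl2_linear N a (v w : 'rV[int]_D -> 'cV[R[i]]_N) :
  vl2 v -> vl2 w -> vl2 (fun j => a *: v j + w j).
Proof.
move=> /vl2P[M vM] /vl2P[M' wM]; apply/vl2P; eexists => i.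
by under eq_fun do rewrite mxE mxE; exact: sq_leD (sq_leZ a (vM i)) (wM i).
Qed.

Lemma vl2_0 N : vl2 (fun _ : 'rV[int]_D => 0 : 'cV[R[i]]_N).
Proof.
apply/vl2P; exists 0 => i; apply: (sum_leW _ (@sq_le0 R _)) => j.
by rewrite mxE.
Qed.

End VectorSequences.

Section Calderon.
Variables (R : realType) (D : nat) (r p : Nd D) (s : nat).
Variable c : nat -> Zd D -> R[i].
Local Notation N := (p.1 + r.1)%N.
Local Notation seqs := (nat -> Zd D -> R[i]).
Local Notation traces := (nat -> 'rV[int]_D -> 'cV[R[i]]_N).
Local Notation scheme := (@scheme R D r p s c).
Local Notation tr := (@trace_col R D r p).
Implicit Types (u v b : seqs) (w : traces)
  (x y : 'rV[int]_D -> 'cV[R[i]]_N).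

Definition extend (w : 'rV[int]_D -> 'cV[R[i]]_N) : Zd D -> R[i] :=
  fun j => \sum_(i < N) if j.1 == (p.1)%:Z - (i : nat)%:Z then w j.2 i 0 else 0.

Lemma extend_row x (i : 'I_N) j' : extend x ((p.1)%:Z - (i : nat)%:Z, j') = x j' i 0.
Proof.
rewrite /extend (bigD1 i)//= eqxx big1 ?addr0// => k ki.
by rewrite ifF//; apply: contra_neqF ki => /eqP ?; apply: val_inj => /=; lia.
Qed.

Lemma extend_out x j : (j.1 < 1 - (r.1)%:Z) || ((p.1)%:Z < j.1) -> extend x j = 0.
Proof.
move=> jout; rewrite /extend big1// => i _; rewrite ifF//.
by apply/negP => /eqP ji; have := ltn_ord i; move: jout; rewrite ji; lia.
Qed.

Lemma extend_trace (u : Zd D -> R[i]) j : 1 - (r.1)%:Z <= j.1 <= (p.1)%:Z ->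
  extend (tr u) j = u j.
Proof.
case: j => j1 j' /= j1b.
have iN : (absz ((p.1)%:Z - j1)%R < N)%N by lia.
have -> : j1 = (p.1)%:Z - (Ordinal iN : nat)%:Z by move=> /=; lia.
by rewrite extend_row mxE.
Qed.

Lemma extend_linear a x y j :
  extend (fun j' => a *: x j' + y j') j = a * extend x j + extend y j.
Proof.
rewrite /extend mulr_sumr -big_split; apply: eq_bigr => i _ /=.
by case: ifP => _; rewrite ?mulr0 ?addr0// !mxE.
Qed.

Lemma extend0 j : extend (fun=> 0) j = 0.
Proof. by rewrite /extend big1// => i _; rewrite mxE if_same. Qed.

Lemma sq_le_extend x M : (forall i, sq_le (fun j => x j i 0) M) ->
  sq_le (extend x) (N%:R * (\sum_(i < N) M)).
Proof.
move=> wM; have -> : N%:R = (size (index_enum 'I_N))%:R :> R.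
  by rewrite /index_enum -enumT size_enum_ord.
apply: sq_le_sum => i.
apply: (@sum_le_pinj _ _ _ (fun j : Zd D => j.2)
  (fun j => j.1 == (p.1)%:Z - (i : nat)%:Z) _ _ _ _ _ (wM i)).
  by move=> [j1 j'] [k1 k']; rewrite -!topredE /= => /eqP -> /eqP -> ->.
by move=> j; case: ifP => // _; rewrite normc0 expr0n.
Qed.

Lemma l2_extend x : vl2 x -> l2 setT (extend x).
Proof. by move=> /vl2P[M wM]; apply/l2TP; eexists; exact: sq_le_extend wM. Qed.

Lemma vl2_trace (u : Zd D -> R[i]) : l2 (half_space r) u -> vl2 (tr u).
Proof.
move=> /l2P[M uM]; apply/vl2P; exists M => i.
have inj : injective (fun j' : 'rV[int]_D => ((p.1)%:Z - (i : nat)%:Z, j')).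
  by move=> x y [].
apply: sum_leW (sum_le_inj inj uM) => j' /=; rewrite mxE ifT//.
by apply/mem_set; rewrite /half_space /=; have := ltn_ord i; lia.
Qed.

Definition restrict_half (u : Zd D -> R[i]) : Zd D -> R[i] :=
  fun j => if j \in half_space r then u j else 0.

Lemma restrict_halfE (u : Zd D -> R[i]) j :
  restrict_half u j = if 1 - (r.1)%:Z <= j.1 then u j else 0.
Proof.
rewrite /restrict_half; congr (if _ then _ else _).
by apply/idP/idP => [/set_mem|/mem_set].
Qed.

Lemma l2_restrict_half (u : Zd D -> R[i]) :
  l2 (half_space r) u -> l2 setT (restrict_half u).
Proof. by move=> /l2P[M uM]; apply/l2TP; exists M. Qed.

Lemma l2_half (u : Zd D -> R[i]) : l2 setT u -> l2 (half_space r) u.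
Proof.
move=> /l2TP[M uM]; apply/l2P; exists M; apply: sq_leW uM => j.
by case: ifP => // _; rewrite normc0 normc_ge0.
Qed.

Lemma trace_restrict_half (u : Zd D -> R[i]) : tr (restrict_half u) = tr u.
Proof.
apply/funext => j'; apply/colP => i; rewrite !mxE restrict_halfE ifT//=.
by have := ltn_ord i; lia.
Qed.

Lemma scheme_restrict_half u n j : 1 <= j.1 ->
  scheme (fun n => restrict_half (u n)) n j = scheme u n j.
Proof.
move=> j1; apply: eq_bigr => k _; apply: eq_Qop => l [lb _].
rewrite /delay; case: ifP => // _; rewrite restrict_halfE ifT//.
by case: j l j1 lb => [j1 j'] [l1 l'] /=; lia.
Qed.

(** What the scheme leaves on the cells j_1 <= 0 when a half-space sequence of
    given trace is extended by 0: the stencil reaches these cells only through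
    the trace. *)
Definition calderon_source w : seqs := fun n j =>
  if j.1 <= 0 then scheme (fun m => extend (w m)) n j else 0.

Lemma scheme_extension_by_zero u m : 
  (forall n (j : Zd D), (n <= m)%N -> j.1 < 1 - (r.1)%:Z -> u n j = 0) ->
  (forall n (j : Zd D), (n <= m)%N -> 1 <= j.1 -> scheme u n j = 0) ->
  forall n (j : Zd D), (n <= m)%N -> scheme u n j = calderon_source (fun n => tr (u n)) n j.
Proof.
move=> u0 su0 n j nm; rewrite /calderon_source; case: ifP => j1; last first.
  by rewrite su0//; move: j1; case: (j) => ? ? /=; lia.
apply: eq_bigr => k _; apply: eq_Qop => l [lb _]; rewrite /delay.
case: ifP => // _.
have lp : (j + l).1 <= (p.1)%:Z by move: j1 lb; case: (j) (l) => ? ? [? ?] /=; lia.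
have nkm : (n - k <= m)%N by rewrite (leq_trans (leq_subr _ _)).
have [low|high] := ltP (j + l).1 (1 - (r.1)%:Z).
  by rewrite u0// extend_out// low.
by rewrite extend_trace// high.
Qed.

Lemma l2_calderon_source w : (forall n, vl2 (w n)) ->
  forall n, l2 setT (calderon_source w n).
Proof.
move=> wl2 n; have : l2 setT (scheme (fun m => extend (w m)) n).
  by apply: l2_scheme => k; exact: l2_extend.
move=> /l2TP[M sM]; apply/l2TP; exists M; apply: sq_leW sM => j.
by rewrite /calderon_source; case: ifP => // _; rewrite normc0 normc_ge0.
Qed.

Hypothesis iso : l2_isomorphism (Qop r p (c s.+1)).

Definition resolve b : seqs := xget (fun=> fun=> 0)
  [set u | (forall n, l2 setT (u n)) /\ forall n j, scheme u n j = b n j].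

Lemma resolveP b : (forall n, l2 setT (b n)) ->
  (forall n, l2 setT (resolve b n)) /\ forall n j, scheme (resolve b) n j = b n j.
Proof. by move=> bl2; exact: (xgetPex _ (scheme_solvable iso bl2)). Qed.

(** The trace of [response w] is the image of w under the Calderon projector of
    the time-dependent problem, which will turn out to be the convolution with
    the operators of the boundary condition. *)
Definition response w : seqs := resolve (calderon_source w).

Section Response.
Variable w : traces.
Hypothesis wl2 : forall n, vl2 (w n).

Lemma l2_response n : l2 setT (response w n).
Proof. exact: (resolveP (l2_calderon_source wl2)).1. Qed.

Lemma scheme_response n j : scheme (response w) n j = calderon_source w n j.
Proof. exact: (resolveP (l2_calderon_source wl2)).2. Qed.

Lemma vl2_trace_response n : vl2 (tr (response w n)).
Proof. exact/vl2_trace/l2_half/l2_response. Qed.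

Lemma response_unique u m : (forall n, l2 setT (u n)) ->
  (forall n (j : Zd D), (n <= m)%N -> scheme u n j = calderon_source w n j) ->
  response w m = u m.
Proof.
move=> ul2 su; apply: (scheme_unique iso l2_response ul2) => n j nm.
by rewrite scheme_response su.
Qed.

End Response.

(** By [scheme_extension_by_zero], u and the response to its trace solve the scheme
    on the whole lattice with the same source. *)
Lemma response_extension_by_zero u m : (forall n, l2 setT (u n)) ->
  (forall n (j : Zd D), (n <= m)%N -> j.1 < 1 - (r.1)%:Z -> u n j = 0) ->
  (forall n (j : Zd D), (n <= m)%N -> 1 <= j.1 -> scheme u n j = 0) ->
  response (fun n => tr (u n)) m = u m.
Proof.
move=> ul2 u0 su0; apply: response_unique => //.
  by move=> n; exact/vl2_trace/l2_half.
exact: scheme_extension_by_zero.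
Qed.

(** The restriction of a response to the half-space has no interior source, so it
    is the response to its trace. *)
Lemma trace_response_idem w m : (forall n, vl2 (w n)) ->
  tr (response (fun n => tr (response w n)) m) = tr (response w m).
Proof.
move=> wl2; rewrite -[RHS]trace_restrict_half; congr tr.
rewrite -(@response_extension_by_zero (fun n => restrict_half (response w n)) m).
- by congr response; apply/funext => n; rewrite trace_restrict_half.
- by move=> n; exact/l2_restrict_half/l2_half/l2_response.
- by move=> n [j1 j'] _ /= jr; rewrite restrict_halfE /= ifF//; lia.
- move=> n j _ j1; rewrite scheme_restrict_half// scheme_response//.
  by rewrite /calderon_source ifF//; move: j1; case: (j) => ? ? /=; lia.
Qed.

Lemma calderon_source_linear a w1 w2 n j :
  calderon_source (fun n j' => a *: w1 n j' + w2 n j') n j =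
  a * calderon_source w1 n j + calderon_source w2 n j.
Proof.
rewrite /calderon_source; case: ifP => _; last by rewrite mulr0 addr0.
rewrite -scheme_linear; apply: eq_scheme => m _; apply/funext => i.
exact: extend_linear.
Qed.

Lemma response_linear a w1 w2 n j :
  (forall n, vl2 (w1 n)) -> (forall n, vl2 (w2 n)) ->
  response (fun n j' => a *: w1 n j' + w2 n j') n j =
  a * response w1 n j + response w2 n j.
Proof.
move=> w1l2 w2l2.
rewrite (@response_unique _ _ (fun n j => a * response w1 n j + response w2 n j))//.
- by move=> k; exact: vl2_linear.
- by move=> k; apply: l2_linear; exact: l2_response.
- move=> k i _; rewrite calderon_source_linear -!scheme_response//.
  exact: scheme_linear.
Qed.

Definition impulse (x : 'rV[int]_D -> 'cV[R[i]]_N) : traces :=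
  fun n => if n == 0%N then x else fun=> 0.

Lemma vl2_impulse x : vl2 x -> forall n, vl2 (impulse x n).
Proof. by move=> xl2 n; rewrite /impulse; case: ifP => // _; exact: vl2_0. Qed.

Lemma response_conv w n j : (forall n, vl2 (w n)) ->
  response w n j = \sum_(m < n.+1) response (impulse (w m)) (n - m)%N j.
Proof.
move=> wl2.
rewrite (@response_unique _ _
  (fun n j => \sum_(m < n.+1) response (impulse (w m)) (n - m)%N j))//.
  by move=> k; apply: l2_sum => m; exact/l2_response/vl2_impulse.
move=> k i _; rewrite (@scheme_conv R D r p s c (fun m => response (impulse (w m)))).
rewrite (eq_bigr (fun m : 'I_k.+1 => calderon_source (impulse (w m)) (k - m)%N i));
  last by move=> m _; rewrite scheme_response//; exact: vl2_impulse.
rewrite /calderon_source; case: ifP => _; last by rewrite big1.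
rewrite -(@scheme_conv R D r p s c (fun m n => extend (impulse (w m) n))).
apply: eq_scheme => m _; apply/funext => l.
rewrite big_ord_recr /= subnn /impulse eqxx big1 ?add0r// => q _.
rewrite ifF ?extend0//; have := ltn_ord q; lia.
Qed.

(** Uniqueness for the half-space problem: the two conditions say that the trace
    is both reproduced and annihilated by the Calderon projector. *)
Lemma half_space_unique u m : (forall n, l2 setT (u n)) ->
  (forall n (j : Zd D), (n <= m)%N -> j.1 < 1 - (r.1)%:Z -> u n j = 0) ->
  (forall n (j : Zd D), (n <= m)%N -> 1 <= j.1 -> scheme u n j = 0) ->
  (forall n j', (n <= m)%N -> tr (response (fun n => tr (u n)) n) j' = 0) ->
  forall j, u m j = 0.
Proof.
move=> ul2 u0 su0 tru0 j.
have tr0 n : (n <= m)%N -> tr (u n) = fun=> 0.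
  move=> nm; apply/funext => j'; rewrite -[RHS](tru0 n j' nm).
  rewrite response_extension_by_zero// => k i kn; [apply: u0|apply: su0];
    exact: leq_trans kn nm.
have l20 (n : nat) : l2 setT ((fun (_ : nat) (_ : Zd D) => 0 : R[i]) n).
  exact: l2_0.
suff uE : u m = (fun (_ : nat) (_ : Zd D) => 0 : R[i]) m by rewrite uE.
apply: (scheme_unique iso ul2 l20) => n i nm.
rewrite (scheme_extension_by_zero u0 su0)// /calderon_source.
have s0 : scheme (fun _ _ => 0) n i = 0.
  rewrite /scheme big1// => k _; rewrite (@eq_Qop R D r p _ _ (fun=> 0)) ?Qop0//.
  by move=> l _; rewrite /delay if_same.
rewrite s0; case: ifP => // _; rewrite -[RHS]s0; apply: eq_scheme => k kn.
by apply/funext => l; rewrite tr0 ?extend0// (leq_trans kn).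
Qed.

End Calderon.

(** * Power series in 1/z *)

Section PowerSeries.
Variable R : realType.

Definition seq_lim (f : nat -> R[i]) (l : R[i]) : Prop :=
  forall e : R, 0 < e -> exists m, forall n, (m <= n)%N -> normc (f n - l) <= e.

Lemma cvg_seq_lim (f : nat -> R[i]^o) (l : R[i]^o) : f @ \oo --> l -> seq_lim f l.
Proof.
move=> /cvgrPdist_le fl e e0.
have e0' : (0 : R[i]) < e%:C%C by rewrite ltcR.
have [m _ hm] := fl _ e0'; exists m => n mn.
by have := hm n mn; rewrite /= normr_normc lecR normc_distC.
Qed.

Lemma seq_limB f g l m : seq_lim f l -> seq_lim g m ->
  seq_lim (fun n => f n - g n) (l - m).
Proof.
move=> fl gm e e0; have e20 : 0 < e / 2 by rewrite divr_gt0.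
have [a ha] := fl _ e20; have [b hb] := gm _ e20.
exists (maxn a b) => n; rewrite geq_max => /andP[an bn].
have -> : f n - g n - (l - m) = (f n - l) - (g n - m) by ring.
by rewrite (le_trans (normcB _ _))//; have := ha n an; have := hb n bn; lra.
Qed.

Lemma seq_limZ c f l : seq_lim f l -> seq_lim (fun n => c * f n) (c * l).
Proof.
move=> fl e e0; have c0 := normc_ge0 c.
have [|m hm] := fl (e / (1 + normc c)); first by rewrite divr_gt0//; lra.
exists m => n mn; rewrite -mulrBr normcM.
have : (1 + normc c) * normc (f n - l) <= e.
  by rewrite mulrC -ler_pdivlMr ?hm//; lra.
have := normc_ge0 (f n - l); nra.
Qed.

Lemma seq_lim_sum (I : Type) (r : seq I) (f : I -> nat -> R[i]) (l : I -> R[i]) :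
  (forall i, seq_lim (f i) (l i)) ->
  seq_lim (fun n => \sum_(i <- r) f i n) (\sum_(i <- r) l i).
Proof.
move=> fl; elim: r => [|i r IH] e e0.
  by exists 0%N => n _; rewrite !big_nil subrr normc0 ltW.
have := seq_limB (fl i) (seq_limZ (-1) IH) e0.
case=> m hm; exists m => n mn; rewrite !big_cons; have := hm n mn.
by rewrite !mulN1r !opprK.
Qed.

Lemma has_sum_seq_lim (f : nat -> R[i]) S : has_sum f S ->
  seq_lim (fun m => \sum_(n < m) f n) S.
Proof.
move=> fS e e0; have [s0 hs0] := fS e e0.
exists (\sum_(t <- s0) t.+1)%N => m sm.
have := hs0 (iota 0 m) (iota_uniq _ _).
rewrite -[m in iota 0 m]subn0 -/(index_iota 0 m) big_mkord; apply.
move=> t ts; rewrite mem_index_iota /= (leq_trans _ sm)// (big_rem t)//=.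
exact: leq_addr.
Qed.

Lemma sum_geometric_tail (q : R) n m : 0 <= q <= 1 / 2 ->
  \sum_(k < m) q ^+ (n + k) <= 2 * q ^+ n.
Proof.
move=> /andP[q0 q12]; under eq_bigr do rewrite exprD.
rewrite -mulr_sumr mulrC ler_wpM2r ?exprn_ge0//.
have q01 : 0 <= q < 1 by lra.
rewrite -(big_mkord xpredT (fun k => q ^+ k)).
rewrite (le_trans (sum_le_geometric q01 (iota_uniq 0 (m - 0))))//.
rewrite -[leRHS]invrK lef_pV2 ?posrE ?invr_gt0//; lra.
Qed.

(** Identity theorem: the first nonzero coefficient would dominate the sum for
    large real z. *)
Lemma power_series_eq0 (d : nat -> R[i]) (z0 : R) : 0 < z0 ->
  (forall x : R, z0 <= x ->
     seq_lim (fun m => \sum_(n < m) (x%:C)%C ^- n * d n) 0) ->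
  forall n, d n = 0.
Proof.
move=> z00 dlim n; elim/ltn_ind: n => n IH.
have [B [B0 dB]] : exists B : R, 0 <= B /\ forall k, normc (d k) <= B * z0 ^+ k.
  have [m hm] := dlim z0 (lexx _) 1 ltr01.
  pose B := 2 + \sum_(k < m.+1) normc ((z0%:C)%C ^- k * d k).
  have sum0 : 0 <= \sum_(k < m.+1) normc ((z0%:C)%C ^- k * d k).
    by rewrite sumr_ge0// => k _; exact: normc_ge0.
  exists B; split; first by rewrite /B; lra.
  move=> k; rewrite -ler_pdivrMr ?exprn_gt0// mulrC.
  have -> : (z0 ^+ k)^-1 * normc (d k) = normc ((z0%:C)%C ^- k * d k).
    by rewrite normcM normcV normcX normc_real gtr0_norm.
  have [km|mk] := ltnP k m.+1.
    rewrite /B (bigD1 (Ordinal km))//=.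
    have : 0 <= \sum_(i < m.+1 | i != Ordinal km) normc ((z0%:C)%C ^- i * d i).
      by rewrite sumr_ge0// => i _; exact: normc_ge0.
    by have := normc_ge0 ((z0%:C)%C ^- k * d k); lra.
  have h1 := hm k (ltnW mk); have h2 := hm k.+1 (leqW (ltnW mk)).
  rewrite !subr0 in h1 h2.
  have -> : (z0%:C)%C ^- k * d k = \sum_(i < k.+1) (z0%:C)%C ^- i * d i -
      \sum_(i < k) (z0%:C)%C ^- i * d i by rewrite big_ord_recr /= addrC addrK.
  by rewrite (le_trans (normcB _ _))// /B; lra.
apply: eq0_normc; apply/eqP; rewrite eq_le normc_ge0 andbT.
pose E := 2 * B * z0 ^+ n.+1.
have E0 : 0 <= E by rewrite mulr_ge0 ?exprn_ge0 ?mulr_ge0// ltW.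
suff small x : 2 * z0 <= x -> normc (d n) <= E / x.
  apply/ler_addgt0Pl => e e0; rewrite addr0.
  have x0 : 0 < 2 * z0 + E / e by rewrite ltr_pwDl ?mulr_gt0// divr_ge0// ltW.
  apply: le_trans (small (2 * z0 + E / e) _) _.
    by rewrite lerDl divr_ge0// ltW.
  rewrite ler_pdivrMr// mulrDr [e * (E / e)]mulrC divfK ?gt_eqF//.
  by rewrite lerDr !mulr_ge0// ltW.
move=> xz; have x0 : 0 < x by lra.
apply/ler_addgt0Pr => e e0.
have xe0 : 0 < e / x ^+ n by rewrite divr_gt0 ?exprn_gt0.
have [|m hm] := dlim x _ _ xe0; first by lra.
have := hm (n.+1 + m)%N (leq_addl _ _); rewrite subr0 => {hm}.
rewrite big_split_ord big_ord_recr /= big1 ?add0r => [|k _]; last first.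
  by rewrite IH ?mulr0 ?ltn_ord.
set T := \sum_(i < m) _ => hT.
have TB : normc T <= B * (2 * (z0 / x) ^+ n.+1).
  rewrite (le_trans (normc_sum _ _ _))//.
  apply: (@le_trans _ _ (\sum_(k < m) B * (z0 / x) ^+ (n.+1 + k))).
    apply: ler_sum => k _; rewrite normcM normcV normcX normc_real gtr0_norm//.
    rewrite expr_div_n mulrA mulrC ler_wpM2r// invr_ge0 exprn_ge0//; lra.
  have q12 : 0 <= z0 / x <= 1 / 2.
    apply/andP; split; first by rewrite divr_ge0 ?ltW.
    by rewrite ler_pdivrMr//; lra.
  by rewrite -mulr_sumr ler_wpM2l// sum_geometric_tail.
have dn : x ^- n * normc (d n) <= e / x ^+ n + B * (2 * (z0 / x) ^+ n.+1).
  have -> : x ^- n * normc (d n) = normc ((x%:C)%C ^- n * d n).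
    by rewrite normcM normcV normcX normc_real gtr0_norm.
  have -> : (x%:C)%C ^- n * d n = ((x%:C)%C ^- n * d n + T) - T by rewrite addrK.
  by rewrite (le_trans (normcB _ _))// lerD.
have xn0 : 0 < x ^+ n by rewrite exprn_gt0.
have := ler_wpM2l (ltW xn0) dn; rewrite mulVKf ?gt_eqF//.
move/le_trans; apply; rewrite le_eqVlt; apply/orP; left; apply/eqP.
rewrite /E expr_div_n exprSr [x ^+ n.+1]exprSr; field.
by rewrite !gt_eqF.
Qed.

End PowerSeries.

(** * Symbols of the Calderon operators *)

Section FourierSymbols.
Variables (R : realType) (D : nat) (r p : Nd D) (s : nat).
Variable c : nat -> Zd D -> R[i].
Variable eta : 'rV[R]_D.
Local Notation N := (p.1 + r.1)%N.
Local Notation seqs := (nat -> Zd D -> R[i]).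
Local Notation scheme := (@scheme R D r p s c).
Implicit Types (f : 'rV[int]_D -> R[i]) (u : Zd D -> R[i]) (X : seqs).

Definition fourier f : R[i] := hsum (fun j => expi (- dotZ j eta) * f j).

Lemma abs_sum_phase f M : abs_sum_le f M ->
  abs_sum_le (fun j => expi (- dotZ j eta) * f j) M.
Proof. by apply: sum_leW => j; rewrite normcM normc_expi mul1r. Qed.

Lemma has_sum_fourier f M : abs_sum_le f M ->
  has_sum (fun j => expi (- dotZ j eta) * f j) (fourier f).
Proof. by move=> /abs_sum_phase; exact: hsumP. Qed.

Lemma normc_fourier f M : abs_sum_le f M -> normc (fourier f) <= M.
Proof. by move=> fM; exact: has_sum_le (has_sum_fourier fM) (abs_sum_phase fM). Qed.

Lemma fourier0 : fourier (fun=> 0) = 0.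
Proof.
apply: hsum_eq; under eq_fun do rewrite mulr0; exact: has_sum0.
Qed.

Lemma has_sum_fourier_shift f M l : abs_sum_le f M ->
  has_sum (fun j => expi (- dotZ j eta) * f (j + l))
    (expi (dotZ l eta) * fourier f).
Proof.
move=> fM; have := has_sumZ (expi (dotZ l eta)) (has_sum_fourier fM).
apply: (@has_sum_reindex R _ _ (fun j => j - l) (fun j => j + l) predT) => //.
- by move=> j; rewrite subrK.
- by move=> j _; rewrite addrK.
- by move=> j; rewrite subrK dotZD dotZN opprD opprK expiD; ring.
Qed.

Definition slice u (j1 : int) : 'rV[int]_D -> R[i] := fun j' => u (j1, j').

Lemma has_sum_fourier_Qop (a : Zd D -> R[i]) u (M : int -> R) j1 :
  (forall j1, abs_sum_le (slice u j1) (M j1)) ->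
  has_sum (fun j' => expi (- dotZ j' eta) * slice (Qop r p a u) j1 j')
    (\sum_(i < N.+1) partial_symbol r p a ((p.1)%:Z - (i : nat)%:Z) eta *
      fourier (slice u (j1 + ((p.1)%:Z - (i : nat)%:Z)))).
Proof.
move=> uM.
have H (i : 'I_N.+1) : has_sum (fun j' => \sum_(l' <- tbox_seq r.2 p.2)
    a ((p.1)%:Z - (i : nat)%:Z, l') * (expi (- dotZ j' eta) *
      slice u (j1 + ((p.1)%:Z - (i : nat)%:Z)) (j' + l')))
    (\sum_(l' <- tbox_seq r.2 p.2) a ((p.1)%:Z - (i : nat)%:Z, l') *
      (expi (dotZ l' eta) * fourier (slice u (j1 + ((p.1)%:Z - (i : nat)%:Z))))).
  by apply: has_sum_sum => l'; apply/has_sumZ/has_sum_fourier_shift/uM.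
have := has_sum_sum (index_enum 'I_N.+1) H; congr has_sum.
  apply/funext => j'; rewrite /slice Qop_rows mulr_sumr; apply: eq_bigr => i _.
  by rewrite mulr_sumr; apply: eq_bigr => l' _; rewrite mulrCA.
apply: eq_bigr => i _; rewrite partial_symbolE mulr_suml.
by apply: eq_bigr => l' _; rewrite mulrA.
Qed.

Definition decays (theta A B : R) X : Prop := forall n j,
  normc (X n j) <= B * A ^+ n * theta ^- (absz j.1 + norm1 j.2).

Section Generating.
Variables (theta A S : R) (t : R[i]).
Hypotheses (th1 : 1 < theta) (A1 : 1 <= A)
  (thS : sum_le (fun j : 'rV[int]_D => theta ^- norm1 j) S)
  (tA : normc t * A <= 1 / 2).

Lemma decays_row B X n j1 : 0 <= B -> decays theta A B X ->
  abs_sum_le (slice (X n) j1) (B * A ^+ n * theta ^- absz j1 * S).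
Proof.
move=> B0 XB; have th0 := lt_trans ltr01 th1.
have A0 := lt_le_trans ltr01 A1.
have B1 : 0 <= B * A ^+ n * theta ^- absz j1.
  by rewrite !mulr_ge0 ?invr_ge0 ?exprn_ge0// ltW.
apply: sum_leW (sum_leZ B1 thS) => j' /=.
by rewrite (le_trans (XB n (j1, j')))//= exprD invfM mulrA.
Qed.

Definition generating (y : nat -> R[i]) : R[i] := hsum (fun n => t ^+ n * y n).

(** The condition |t| A <= 1/2 beats the growth in time. *)
Lemma abs_sum_generating y M : 0 <= M -> (forall n, normc (y n) <= M * A ^+ n) ->
  abs_sum_le (fun n => t ^+ n * y n) (2 * M).
Proof.
move=> M0 yM; have q01 : 0 <= (1 / 2 : R) < 1 by lra.
have -> : 2 * M = M * (1 - 1 / 2)^-1 by field.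
apply: sum_leW (sum_leZ M0 (sum_le_geometric q01)) => n /=.
rewrite normcM normcX.
apply: (@le_trans _ _ (normc t ^+ n * (M * A ^+ n))).
  by rewrite ler_wpM2l// exprn_ge0// normc_ge0.
rewrite mulrCA -exprMn ler_wpM2l// lerXn2r ?nnegrE//.
by rewrite mulr_ge0 ?normc_ge0// (le_trans ler01).
Qed.

Lemma has_sum_generating y M : 0 <= M -> (forall n, normc (y n) <= M * A ^+ n) ->
  has_sum (fun n => t ^+ n * y n) (generating y).
Proof. by move=> M0 yM; exact: hsumP (abs_sum_generating M0 yM). Qed.

Lemma normc_generating y M : 0 <= M -> (forall n, normc (y n) <= M * A ^+ n) ->
  normc (generating y) <= 2 * M.
Proof.
by move=> M0 yM; exact: has_sum_le (has_sum_generating M0 yM)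
  (abs_sum_generating M0 yM).
Qed.

Lemma has_sum_generating_delay y M k : 0 <= M ->
  (forall n, normc (y n) <= M * A ^+ n) ->
  has_sum (fun n => t ^+ n * (if (k <= n)%N then y (n - k)%N else 0))
    (t ^+ k * generating y).
Proof.
move=> M0 yM; have := has_sumZ (t ^+ k) (has_sum_generating M0 yM).
apply: (@has_sum_reindex R _ _ (addn^~ k) (subn^~ k) (leq k)).
- by move=> n /=; rewrite leq_addl.
- by move=> n; rewrite addnK.
- by move=> n kn; rewrite subnK.
- by move=> n; rewrite leq_addl addnK mulrA -exprD addnC.
- by move=> n /negPf ->; rewrite mulr0.
Qed.

Definition transform X j1 : R[i] := generating (fun n => fourier (slice (X n) j1)).

Lemma S_ge0 : 0 <= S.
Proof. exact: sum_le_ge0 thS. Qed.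

Lemma normc_fourier_decays B X n j1 : 0 <= B -> decays theta A B X ->
  normc (fourier (slice (X n) j1)) <= (B * S * theta ^- absz j1) * A ^+ n.
Proof.
move=> B0 XB; rewrite (le_trans (normc_fourier (decays_row n j1 B0 XB)))//.
by rewrite le_eqVlt; apply/orP; left; apply/eqP; ring.
Qed.

Lemma decay_const_ge0 B j1 : 0 <= B -> 0 <= B * S * theta ^- absz j1.
Proof.
move=> B0; by rewrite !mulr_ge0 ?S_ge0// invr_ge0 exprn_ge0// ltW// (lt_trans ltr01).
Qed.

Lemma normc_transform B X j1 : 0 <= B -> decays theta A B X ->
  normc (transform X j1) <= 2 * (B * S * theta ^- absz j1).
Proof.
move=> B0 XB; apply: normc_generating; first exact: decay_const_ge0.
by move=> n; exact: normc_fourier_decays.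
Qed.

Definition scheme_symbol (i : nat) : R[i] :=
  \sum_(k < s.+2) t ^+ k * partial_symbol r p (c (s.+1 - k)) ((p.1)%:Z - i%:Z) eta.

(** Translations become multiplications by exp(i l.eta) along the boundary and by
    t in time; only the shifts in the first variable remain. *)
Lemma transform_scheme B X j1 : 0 <= B -> decays theta A B X ->
  transform (scheme X) j1 = \sum_(i < N.+1)
    scheme_symbol i * transform X (j1 + ((p.1)%:Z - (i : nat)%:Z)).
Proof.
move=> B0 XB.
have fE n : fourier (slice (scheme X n) j1) = \sum_(k < s.+2) \sum_(i < N.+1)
    partial_symbol r p (c (s.+1 - k)) ((p.1)%:Z - (i : nat)%:Z) eta *
    (if (k <= n)%N then fourier (slice (X (n - k)%N) (j1 + ((p.1)%:Z - (i : nat)%:Z)))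
     else 0).
  have delayM k j1' : abs_sum_le (slice (delay k X n) j1')
      (if (k <= n)%N then B * A ^+ (n - k) * theta ^- absz j1' * S else 0).
    rewrite /delay; case: ifP => kn; first exact: decays_row.
    by apply: (sum_leW _ (@sum_le0 R _)) => j'; rewrite /slice normc0.
  transitivity (\sum_(k < s.+2) \sum_(i < N.+1)
      partial_symbol r p (c (s.+1 - k)) ((p.1)%:Z - (i : nat)%:Z) eta *
      fourier (slice (delay k X n) (j1 + ((p.1)%:Z - (i : nat)%:Z)))).
    apply: hsum_eq; have := has_sum_sum (index_enum 'I_s.+2)
      (fun k : 'I_s.+2 => has_sum_fourier_Qop (c (s.+1 - k)) j1 (delayM k)).
    congr has_sum; apply/funext => j'.
    by rewrite /slice /scheme mulr_sumr.
  apply: eq_bigr => k _.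
  apply: eq_bigr => i _; congr (_ * _); rewrite /delay.
  by case: ifP => // _; exact: fourier0.
apply: hsum_eq.
have H (k : 'I_s.+2) : has_sum (fun n => \sum_(i < N.+1)
    partial_symbol r p (c (s.+1 - k)) ((p.1)%:Z - (i : nat)%:Z) eta * (t ^+ n *
    (if (k <= n)%N then fourier (slice (X (n - k)%N) (j1 + ((p.1)%:Z - (i : nat)%:Z)))
     else 0)))
   (\sum_(i < N.+1) partial_symbol r p (c (s.+1 - k)) ((p.1)%:Z - (i : nat)%:Z) eta *
     (t ^+ k * transform X (j1 + ((p.1)%:Z - (i : nat)%:Z)))).
  apply: has_sum_sum => i; apply: has_sumZ.
  exact: (has_sum_generating_delay k (decay_const_ge0 _ B0)
    (fun n => normc_fourier_decays n _ B0 XB)).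
have := has_sum_sum (index_enum 'I_s.+2) H; congr has_sum.
  apply/funext => n; rewrite fE mulr_sumr; apply: eq_bigr => k _.
  by rewrite mulr_sumr; apply: eq_bigr => i _; rewrite mulrCA.
rewrite exchange_big; apply: eq_bigr => i _; rewrite /scheme_symbol mulr_suml.
by apply: eq_bigr => k _ /=; ring.
Qed.

End Generating.

End FourierSymbols.

Section ResponseDecay.
Variables (R : realType) (D : nat) (r p : Nd D) (s : nat).
Variable c : nat -> Zd D -> R[i].
Local Notation N := (p.1 + r.1)%N.
Local Notation scheme := (@scheme R D r p s c).
Local Notation tr := (@trace_col R D r p).
Local Notation impulse := (@impulse R D r p).
Local Notation extend := (@extend R D r p).
Local Notation response := (@response R D r p s c).
Implicit Types (x : 'rV[int]_D -> 'cV[R[i]]_N).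
Hypothesis iso : l2_isomorphism (Qop r p (c s.+1)).

Lemma sq_le_finite (T : eqType) (u : T -> R[i]) (s0 : seq T) :
  (forall j, j \notin s0 -> u j = 0) -> exists M, sq_le u M.
Proof.
move=> u0; exists (\sum_(j <- undup s0) normc (u j) ^+ 2) => q uq.
rewrite (bigID (mem s0)) /= [X in _ + X]big1 ?addr0 => [|j /u0 ->]; last first.
  by rewrite normc0 expr0n.
rewrite -big_filter.
have sub : {subset [seq j <- q | j \in s0] <= undup s0}.
  by move=> j; rewrite mem_filter mem_undup => /andP[].
rewrite (big_uniq_sub _ (filter_uniq _ uq) (undup_uniq s0) sub) lerDl.
by rewrite sumr_ge0// => j _; rewrite sqr_ge0.
Qed.

(** Only one of the delays meets data concentrated at time 0. *)
Lemma sq_le_calderon_source (W : Zd D -> R) x M : slow_weight r p 1 W ->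
  sq_le (weighted W (extend x)) M -> forall n,
  sq_le (weighted W (calderon_source s c (impulse x) n))
    (s.+2%:R * \sum_(k < s.+2) 4 * stencil_norm r p (c (s.+1 - k)) * M).
Proof.
move=> W1 xM n; have M0 := sum_le_ge0 xM.
have Edelay k : sq_le (weighted W (delay k (fun m => extend (impulse x m)) n)) M.
  have [->|nk] := eqVneq n k; first by rewrite /delay leqnn subnn.
  apply: (sum_le_trans M0); apply: (sum_leW _ (@sq_le0 R _)) => j.
  rewrite /weighted /delay; case: ifP => kn; last by rewrite mulr0.
  by rewrite /impulse ifF ?extend0 ?mulr0// subn_eq0 leqNgt ltn_neqAle kn eq_sym nk.
have := @sq_le_sum R _ _ (index_enum 'I_s.+2) _ _
  (fun k : 'I_s.+2 => sq_le_weighted_Qop (c (s.+1 - k)) W1 (Edelay k)).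
rewrite [size _](_ : _ = s.+2); last by rewrite /index_enum -enumT size_enum_ord.
apply: sq_leW => j; rewrite /weighted /calderon_source.
case: ifP => _; last by rewrite mulr0 normc0 normc_ge0.
by rewrite /scheme [_ * \sum_(k < s.+2) _]mulr_sumr.
Qed.

Lemma response_growth : exists d C A : R, [/\ 0 < d, 0 <= C, 1 <= A &
  forall W x M, slow_weight r p d W -> slow_weight r p 1 W -> vl2 x ->
    sq_le (weighted W (extend x)) M ->
    forall n, sq_le (weighted W (response (impulse x) n)) (C * A ^+ n * M)].
Proof.
have [d [C [A [d0 C0 A1 growth]]]] := scheme_growth iso.
pose Cs := s.+2%:R * \sum_(k < s.+2) 4 * stencil_norm r p (c (s.+1 - k)).
exists d, (C * Cs), A; split=> //.
  rewrite mulr_ge0// mulr_ge0// sumr_ge0// => k _.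
  by rewrite mulr_ge0// stencil_norm_ge0.
move=> W x M Wd W1 xl2 xM n.
have il2 := vl2_impulse xl2.
have -> : C * Cs * A ^+ n * M = C * A ^+ n * (Cs * M) by ring.
apply: (growth W (response (impulse x)) (Cs * M) n Wd (l2_response iso il2) _ n (leqnn n)).
move=> k _; have := sq_le_calderon_source W1 xM k.
rewrite -mulr_suml mulrA -/Cs; congr sq_le; apply/funext => j.
by rewrite /weighted scheme_response.
Qed.

Lemma slow_weightW (d d' : R) (W : Zd D -> R) : d <= d' ->
  slow_weight r p d W -> slow_weight r p d' W.
Proof.
move=> dd' [W1 Wslow]; split=> // j l lb; have [h1 h2] := Wslow j l lb.
have := W1 j; have := W1 (j + l); split; nra.
Qed.

Definition cube_supported (K : nat) x : Prop :=
  forall j, j \notin tbox_seq (const_mx K) (const_mx K) -> x j = 0.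

Lemma vl2_cube_supported K x : cube_supported K x -> vl2 x.
Proof.
move=> xK; have H (i : 'I_N) : exists M, sq_le (fun j => x j i 0) M.
  by apply: sq_le_finite => j /xK ->; rewrite mxE.
have [M hM] := choice H; apply/vl2P; exists (\sum_i M i) => i.
apply: sum_le_trans (hM i); rewrite (bigD1 i)//= lerDl sumr_ge0// => k _.
exact: sum_le_ge0 (hM k).
Qed.

Lemma cube_supported_extend K x : cube_supported K x ->
  exists s0 : seq (Zd D), forall j, j \notin s0 -> extend x j = 0.
Proof.
move=> xK; exists (allpairs (fun (i : 'I_N) l' => ((p.1)%:Z - (i : nat)%:Z, l'))
    (enum 'I_N) (tbox_seq (const_mx K) (const_mx K))) => -[j1 j'] /= js.
rewrite /extend big1// => i _; case: ifP => // /eqP /= ji.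
rewrite xK ?mxE//; apply: contra js => j'K; apply/allpairsP.
by exists (i, j'); rewrite mem_enum j'K ji.
Qed.

Lemma mul_le_sqr (a b : R) : 1 <= a -> 0 <= b -> b * a <= ((1 + b) * a) ^+ 2.
Proof.
move=> a1 b0; rewrite exprMn.
have h1 : b * a <= (1 + b) ^+ 2 * a by rewrite ler_wpM2r//; [lra|nra].
by rewrite (le_trans h1)// ler_wpM2l ?sqr_ge0//; nra.
Qed.

Lemma decays_of_sq_le theta C A M (X : nat -> Zd D -> R[i]) :
  1 < theta -> 0 <= C -> 1 <= A -> 0 <= M ->
  (forall n, sq_le (weighted (exp_weight theta) (X n)) (C * A ^+ n * M)) ->
  decays theta A (1 + C * M) X.
Proof.
move=> th1 C0 A1 M0 XM n j; have th0 := lt_trans ltr01 th1.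
have CM0 : 0 <= C * M by rewrite mulr_ge0.
have w0 : 0 < theta ^+ (absz j.1 + norm1 j.2) by rewrite exprn_gt0.
rewrite ler_pdivlMr// mulrC.
have := sq_le_pt j (XM n).
rewrite /weighted /exp_weight normcM normc_real ger0_norm ?(ltW w0)// => h.
have An1 : 1 <= A ^+ n by rewrite exprn_ege1.
have CMA0 : 0 <= (1 + C * M) * A ^+ n.
  by rewrite mulr_ge0 ?addr_ge0// (le_trans ler01).
rewrite -(@ler_pXn2r _ 2)// ?nnegrE ?mulr_ge0 ?normc_ge0 ?(ltW w0)//.
by rewrite (le_trans h)// mulrAC mul_le_sqr.
Qed.

Lemma response_decays K x : cube_supported K x ->
  exists theta A B : R, [/\ 1 < theta, 1 <= A, 0 <= B,
    decays theta A B (response (impulse x)) &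
    decays theta A B (fun n => extend (impulse x n))].
Proof.
move=> xK; have [d [C [A [d0 C0 A1 growth]]]] := response_growth.
have [theta th1 Wslow] : exists2 theta : R, 1 < theta &
    slow_weight r p (Num.min d 1) (exp_weight theta).
  by apply: exp_weight_slow; rewrite lt_min d0 ltr01.
have Wd : slow_weight r p d (exp_weight theta).
  by apply: slow_weightW Wslow; rewrite ge_min lexx.
have W1 : slow_weight r p 1 (exp_weight theta).
  by apply: slow_weightW Wslow; rewrite ge_min lexx orbT.
have [s0 hs0] := cube_supported_extend xK.
have [M xM] : exists M, sq_le (weighted (exp_weight theta) (extend x)) M.
  by apply: (@sq_le_finite _ _ s0) => j /hs0 xj; rewrite /weighted xj mulr0.
have M0 := sum_le_ge0 xM.
have decW C1 C2 (X : nat -> Zd D -> R[i]) : C1 <= C2 -> decays theta A (1 + C1 * M) X ->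
    decays theta A (1 + C2 * M) X.
  move=> C12 XC n j; apply: le_trans (XC n j) _.
  rewrite ler_wpM2r ?invr_ge0 ?exprn_ge0//; first by lra.
  rewrite ler_wpM2r ?exprn_ge0//; first by lra.
  by rewrite lerD2l ler_wpM2r.
exists theta, A, (1 + (C + 1) * M); split => //.
- by rewrite addr_ge0// mulr_ge0// addr_ge0.
- apply: (decW C); first by rewrite lerDl.
  apply: decays_of_sq_le => // n.
  exact: (growth _ _ _ Wd W1 (vl2_cube_supported xK) xM).
- apply: (decW 1); first by rewrite lerDr.
  apply: decays_of_sq_le => // n; rewrite mul1r.
  have An1 : 1 <= A ^+ n by rewrite exprn_ege1.
  apply: (@sum_le_trans R _ _ M); first by rewrite ler_peMl.
  rewrite /impulse; case: ifP => // _.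
  apply: (sum_le_trans M0); apply: (sum_leW _ (@sq_le0 R _)) => j.
  by rewrite /weighted extend0 mulr0.
Qed.

End ResponseDecay.

Section CompanionRecurrence.
Variables (R : realType) (D : nat) (r p : Nd D) (s : nat).
Variable c : nat -> Zd D -> R[i].
Variables (z : R[i]) (eta : 'rV[R]_D).
Local Notation N := (p.1 + r.1)%N.
Local Notation asym := (fun l1 => a_sym r p s c l1 z eta).

Definition window (Z : int -> R[i]) (j1 : int) : 'cV[R[i]]_N :=
  \col_i Z (j1 + ((p.1)%:Z - (i : nat)%:Z)).

(** The first row of the companion matrix is the recurrence solved for its leading
    term, the other rows shift the window. *)
Lemma companion_window (Z : int -> R[i]) j1 : asym (p.1)%:Z != 0 ->
  \sum_(i < N.+1) asym ((p.1)%:Z - (i : nat)%:Z) *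
    Z (j1 + ((p.1)%:Z - (i : nat)%:Z)) = 0 ->
  window Z j1 = companion r p s c z eta *m window Z (j1 - 1).
Proof.
move=> ap0 rec; apply/colP => i; rewrite !mxE.
have [i0|i0] := eqVneq (i : nat) 0%N.
  under eq_bigr do rewrite !mxE i0 eqxx !mulNr.
  move: rec; rewrite big_ord_recl i0 subr0 => /eqP.
  rewrite addr_eq0 => /eqP /(congr1 (fun y => (asym (p.1)%:Z)^-1 * y)).
  rewrite mulKf// => ->; rewrite mulrN mulr_sumr sumrN; congr (- _).
  apply: eq_bigr => k _; rewrite !lift0.
  have -> : (p.1)%:Z - (k.+1)%:Z = (p.1)%:Z - 1 - (k : nat)%:Z by lia.
  have -> : j1 + ((p.1)%:Z - 1 - (k : nat)%:Z) = j1 - 1 + ((p.1)%:Z - (k : nat)%:Z) by lia.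
  ring.
have i1N : (i.-1 < N)%N by rewrite (leq_ltn_trans (leq_pred _))// ltn_ord.
rewrite (bigD1 (Ordinal i1N))//= !mxE (negPf i0) prednK ?lt0n// eqxx mul1r.
rewrite big1 ?addr0 => [|k ki]; last first.
  rewrite !mxE (negPf i0) (_ : (_ == _) = false) ?mul0r//.
  apply: contra_neqF ki => /eqP ik; apply: val_inj => /=; lia.
by congr (Z _); move: i0 => /=; move: (nat_of_ord i) => m; lia.
Qed.

End CompanionRecurrence.

Section ResponseSymbol.
Variables (R : realType) (D : nat) (r p : Nd D) (s : nat).
Variable c : nat -> Zd D -> R[i].
Local Notation N := (p.1 + r.1)%N.
Local Notation scheme := (@scheme R D r p s c).
Local Notation tr := (@trace_col R D r p).
Local Notation impulse := (@impulse R D r p).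
Local Notation extend := (@extend R D r p).
Local Notation response := (@response R D r p s c).
Hypothesis iso : l2_isomorphism (Qop r p (c s.+1)).
Hypothesis A2 : assumption_A2 r p s c.

Lemma expr_small (q e : R) : 0 <= q < 1 -> 0 < e ->
  exists L, forall n, (L <= n)%N -> q ^+ n <= e.
Proof.
move=> /andP[q0 q1] e0; have : `|q| < 1 by rewrite ger0_norm.
move=> /cvg_expr /cvgrPdist_le /(_ e e0) [L _ hL]; exists L => n Ln.
by have := hL n Ln; rewrite /= sub0r normrN ger0_norm ?exprn_ge0.
Qed.

Lemma scheme_symbolE (z : R[i]) (eta : 'rV[R]_D) i : z != 0 ->
  scheme_symbol r p s c eta z^-1 i = z ^- s.+1 * a_sym r p s c ((p.1)%:Z - i%:Z) z eta.
Proof.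
move=> z0; rewrite /scheme_symbol /a_sym (reindex_inj rev_ord_inj) mulr_sumr /=.
apply: eq_bigr => k _; have ks : (k <= s.+1)%N by rewrite -ltnS.
rewrite subSS subKn// mulrA; congr (_ * _); rewrite exprVn.
move: (nat_of_ord k) ks => m ms; rewrite -{2}(subnK ms) exprD invfM -mulrA mulVf ?mulr1//.
by rewrite expf_neq0.
Qed.

Section FixedFrequency.
Variables (x : 'rV[int]_D -> 'cV[R[i]]_N) (K : nat) (eta : 'rV[R]_D).
Hypothesis xK : cube_supported K x.
Variables (theta A B S : R).
Hypotheses (th1 : 1 < theta) (A1 : 1 <= A) (B0 : 0 <= B)
  (thS : sum_le (fun j : 'rV[int]_D => theta ^- norm1 j) S)
  (decU : decays theta A B (response (impulse x)))
  (decE : decays theta A B (fun n => extend (impulse x n))).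

Lemma fourier_cube_supported (i : 'I_N) :
  fourier eta (fun j => x j i 0) = fourier_sum K x eta i 0.
Proof.
rewrite /fourier_sum (fsbig_finite _ _ (finite_tbox _ _)) /= summxE.
rewrite -/(tbox_seq _ _).
under eq_bigr do rewrite mxE.
apply: hsum_eq; apply: has_sum_finite; first exact: tbox_seq_uniq.
by move=> j /xK ->; rewrite mxE mulr0.
Qed.

Section FixedTime.
Variable z : R.
Hypothesis zA : 2 * A <= z.
Local Notation zC := (z%:C)%C.
Local Notation U := (transform eta zC^-1 (response (impulse x))).
Local Notation V := (fun j1 =>
  transform eta zC^-1 (fun n => extend (impulse x n)) j1 - U j1).

Lemma z_gt1 : 1 < z.
Proof. by have := A1; have := zA; lra. Qed.

Let z0 : 0 < z. Proof. exact: lt_trans ltr01 z_gt1. Qed.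
Let zC0 : zC != 0.
Proof. by rewrite -(rmorph0 (real_complex R)) (inj_eq (@complexI R)) gt_eqF. Qed.

Let tA : normc zC^-1 * A <= 1 / 2.
Proof.
rewrite normcV normc_real gtr0_norm// mulrC ler_pdivrMr//.
by have := zA; lra.
Qed.

Let transform_small X : decays theta A B X -> forall e : R, 0 < e ->
  exists L : nat, forall j1, (L <= absz j1)%N -> normc (transform eta zC^-1 X j1) <= e.
Proof.
move=> XB e e0; have thV : 0 <= theta^-1 < 1.
  by rewrite invr_ge0 invf_lt1 ?(lt_trans ltr01 th1)// th1 andbT ltW// (lt_trans ltr01).
have S0 := sum_le_ge0 thS.
have BS0 : 0 < 2 * (B * S) + 1 by rewrite ltr_wpDl// mulr_ge0// mulr_ge0.
have [L hL] := expr_small thV (divr_gt0 e0 BS0).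
exists L => j1 Lj; rewrite (le_trans (normc_transform eta th1 A1 thS tA j1 B0 XB))//.
have := hL _ Lj; rewrite ler_pdivlMr// exprVn => h.
apply: le_trans h; rewrite mulrA [leRHS]mulrC ler_wpM2r ?invr_ge0 ?exprn_ge0 ?lerDl//.
by rewrite ltW// (lt_trans ltr01).
Qed.

(** For j_1 >= 1 the response U has no source; for j_1 <= 0 its source is the
    scheme applied to the extended data, so that V, the data minus U, has none. *)
Let equation j1 : \sum_(i < N.+1) a_sym r p s c ((p.1)%:Z - (i : nat)%:Z) zC eta *
    (if j1 <= 0 then V (j1 + ((p.1)%:Z - (i : nat)%:Z))
     else U (j1 + ((p.1)%:Z - (i : nat)%:Z))) = 0.
Proof.
have xl2 := vl2_cube_supported xK.
have EU := transform_scheme r p s c eta th1 A1 thS tA j1 B0 decU.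
have EE := transform_scheme r p s c eta th1 A1 thS tA j1 B0 decE.
have sliceE n : slice (scheme (response (impulse x)) n) j1 =
    if j1 <= 0 then slice (scheme (fun n => extend (impulse x n)) n) j1 else fun=> 0.
  apply/funext => j'; rewrite /slice scheme_response//; last exact: vl2_impulse.
  by rewrite /calderon_source /=; case: ifP.
have fold X : \sum_(i < N.+1) scheme_symbol r p s c eta zC^-1 i * X i =
    zC ^- s.+1 * \sum_(i < N.+1) a_sym r p s c ((p.1)%:Z - (i : nat)%:Z) zC eta * X i.
  rewrite mulr_sumr; apply: eq_bigr => i _; rewrite scheme_symbolE// mulrA //.
have zs0 : zC ^- s.+1 != 0 by rewrite invr_neq0 ?expf_neq0.
apply: (mulfI zs0); rewrite mulr0 -fold.
have [j10|j10] := boolP (j1 <= 0); last first.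
  rewrite -EU /transform; apply: hsum_eq.
  under eq_fun do rewrite sliceE (negPf j10) fourier0 mulr0.
  exact: has_sum0.
under eq_bigr do rewrite mulrBr.
rewrite sumrB -EU -EE /transform; apply/eqP; rewrite subr_eq0; apply/eqP.
by congr hsum; apply/funext => n; rewrite sliceE j10.
Qed.

Lemma window_small (X : int -> R[i]) (h : nat -> int) :
  (forall e : R, 0 < e -> exists L : nat, forall j1, (L <= absz j1)%N ->
     normc (X j1) <= e) ->
  (forall k, absz (h k) = k) -> vanishing (fun k => (window r p X (h k))^T).
Proof.
move=> Xsmall hk e e0; have [L hL] := Xsmall e e0.
exists (L + (p.1 + r.1))%N => k Lk i; rewrite !mxE; apply: hL.
have := hk k; have := ltn_ord i; move: (nat_of_ord i) => m.
by move: (h k) (p.1) (r.1) Lk => j a b; lia.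
Qed.

(** The windows of U to the right and of V to the left are orbits that tend to 0,
    and at j_1 = 0 they add up to the data. *)
Lemma transform_response :
  stable_projector (companion r p s c zC eta) *m fourier_sum K x eta =
  window r p U 0.
Proof.
have ap0 : a_sym r p s c (p.1)%:Z zC eta != 0.
  have [] // := A2 (z := zC) eta.
  by rewrite normc_real gtr0_norm// z_gt1.
have US k : window r p U (k.+1)%:Z =
    companion r p s c zC eta *m window r p U k%:Z.
  rewrite (companion_window (Z := U) (j1 := (k.+1)%:Z) ap0).
    by congr (_ *m window _ _ _ _); lia.
  by have := equation (k.+1)%:Z.
have VS k : window r p V (- k%:Z) =
    companion r p s c zC eta *m window r p V (- (k.+1)%:Z).
  rewrite (companion_window (Z := V) (j1 := - k%:Z) ap0).
    by congr (_ *m window _ _ _ _); lia.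
  have k0 : (- k%:Z <= 0) = true by lia.
  by have := equation (- k%:Z); rewrite k0.
have U0 := window_small (transform_small decU) (fun k => erefl : absz k%:Z = k).
have Vsmall e : 0 < e -> exists L : nat, forall j1, (L <= absz j1)%N -> normc (V j1) <= e.
  move=> e0; have e20 : 0 < e / 2 by rewrite divr_gt0.
  have [L hL] := transform_small decU e20.
  have [L' hL'] := transform_small decE e20.
  exists (maxn L L') => j1; rewrite geq_max => /andP[/hL h /hL' h'].
  by rewrite (le_trans (normcB _ _))//; lra.
have hN k : absz (- k%:Z) = k by rewrite abszN.
have V0 := window_small Vsmall hN.
have := @stable_projector_split R N _ (fun k => window r p U k%:Z)
  (fun k => window r p V (- k%:Z)) US U0 VS V0.
rewrite /= oppr0; congr (_ *m _ = _); apply/colP => i.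
rewrite !mxE addrC subrK add0r -fourier_cube_supported.
transitivity (\sum_(n <- [:: 0%N]) zC^-1 ^+ n *
    fourier eta (slice (extend (impulse x n)) ((p.1)%:Z - (i : nat)%:Z))).
  apply: hsum_eq; apply: has_sum_finite => // n; rewrite inE => n0.
  rewrite /impulse (negPf n0) (_ : slice _ _ = fun=> 0) ?fourier0 ?mulr0//.
  by apply/funext => j'; rewrite /slice extend0.
rewrite big_seq1 expr0 mul1r; congr fourier; apply/funext => j'.
by rewrite /slice /impulse eqxx extend_row.
Qed.

End FixedTime.

(** Both sides are the coefficients of z^-n in expansions of the same function, for
    real z >= 2 A. *)
Lemma power_series_response (P : nat -> 'rV[R]_D -> 'M[R[i]]_N) n i :
  projector_expansion r p s c P ->
  (P n eta *m fourier_sum K x eta) i 0 =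
  fourier eta (fun j' => tr (response (impulse x) n) j' i 0).
Proof.
move=> hP; pose y n := fourier eta (slice (response (impulse x) n)
  ((p.1)%:Z - (i : nat)%:Z)).
have -> : fourier eta (fun j' => tr (response (impulse x) n) j' i 0) = y n.
  by congr fourier; apply/funext => j'; rewrite mxE.
apply/eqP; rewrite -subr_eq0; apply/eqP.
apply: (@power_series_eq0 R (fun n => (P n eta *m fourier_sum K x eta) i 0 - y n)
  (2 * A)); first by rewrite mulr_gt0// (lt_le_trans ltr01).
move=> z zA; have z1 := z_gt1 zA.
have nz : 1 < normc (z%:C)%C by rewrite normc_real gtr0_norm// (lt_trans ltr01).
have limP k : seq_lim (fun m => fourier_sum K x eta k 0 *
    \sum_(0 <= n < m) (z%:C)%C ^- n * P n eta i k)
    (fourier_sum K x eta k 0 * stable_projector (companion r p s c (z%:C)%C eta) i k).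
  by apply: seq_limZ; exact: (cvg_seq_lim (hP (z%:C)%C eta nz i k)).
have limS := seq_lim_sum (index_enum 'I_N) limP.
have tA : normc (z%:C)%C^-1 * A <= 1 / 2.
  rewrite normcV normc_real gtr0_norm ?(lt_trans ltr01)//.
  by rewrite mulrC ler_pdivrMr ?(lt_trans ltr01)//; lra.
have limU := has_sum_seq_lim (has_sum_generating A1 tA
  (decay_const_ge0 th1 thS ((p.1)%:Z - (i : nat)%:Z) B0)
  (fun n => normc_fourier_decays eta th1 A1 thS n ((p.1)%:Z - (i : nat)%:Z) B0 decU)).
have := seq_limB limS limU.
have := congr1 (fun v : 'cV_N => v i 0) (transform_response zA).
rewrite /= !mxE add0r => eqT.
have -> : \sum_(k < N) fourier_sum K x eta k 0 *
    stable_projector (companion r p s c (z%:C)%C eta) i k -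
  generating (z%:C)%C^-1 (fun n => fourier eta (slice (response (impulse x) n)
     ((p.1)%:Z - (i : nat)%:Z))) = 0.
  rewrite -/(transform eta (z%:C)%C^-1 (response (impulse x)) _) -eqT.
  by apply/eqP; rewrite subr_eq0; apply/eqP; apply: eq_bigr => k _; rewrite mulrC.
congr seq_lim; apply/funext => m.
under [X in X - _]eq_bigr do rewrite mulr_sumr.
rewrite exchange_big /= big_mkord -sumrB; apply: eq_bigr => k _.
rewrite mulrBr exprVn; congr (_ - _); rewrite mxE mulr_sumr.
by apply: eq_bigr => l _; ring.
Qed.

End FixedFrequency.

(** The symbols of the Calderon operators are the coefficients of the stable
    projector: finite support makes responses decay exponentially, so that
    the previous lemmas apply at each frequency. *)
Lemma fourier_trace_response (P : nat -> 'rV[R]_D -> 'M[R[i]]_N) x K n eta i :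
  projector_expansion r p s c P -> cube_supported K x ->
  (P n eta *m fourier_sum K x eta) i 0 =
  fourier eta (fun j' => tr (response (impulse x) n) j' i 0).
Proof.
move=> hP xK.
have [theta [A [B [th1 A1 B0 decU decE]]]] := response_decays iso xK.
have [S thS] := sum_le_norm1 D th1.
exact (power_series_response eta xK th1 A1 B0 thS decU decE n i hP).
Qed.

Lemma abs_sum_trace_response x K n i : cube_supported K x ->
  exists M, abs_sum_le (fun j' => tr (response (impulse x) n) j' i 0) M.
Proof.
move=> xK.
have [theta [A [B [th1 A1 B0 decU decE]]]] := response_decays iso xK.
have [S thS] := sum_le_norm1 D th1.
exists (B * A ^+ n * theta ^- absz ((p.1)%:Z - (i : nat)%:Z)%R * S).
have := decays_row th1 A1 thS n ((p.1)%:Z - (i : nat)%:Z) B0 decU.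
by apply: sum_leW => j'; rewrite mxE.
Qed.

End ResponseSymbol.

(** * The boundary operators are the Calderon operators *)

Section Identification.
Variables (R : realType) (D : nat) (r p : Nd D) (s : nat).
Variable c : nat -> Zd D -> R[i].
Local Notation N := (p.1 + r.1)%N.
Local Notation tr := (@trace_col R D r p).
Local Notation impulse := (@impulse R D r p).
Local Notation extend := (@extend R D r p).
Local Notation response := (@response R D r p s c).
Local Notation vecs := ('rV[int]_D -> 'cV[R[i]]_N).
Implicit Types (x : vecs).
Hypothesis iso : l2_isomorphism (Qop r p (c s.+1)).
Hypothesis A2 : assumption_A2 r p s c.

Definition cube K : seq 'rV[int]_D := tbox_seq (const_mx K) (const_mx K).

Definition truncate K x : vecs := fun j => if j \in cube K then x j else 0.

Lemma truncate_supported K x : cube_supported K (truncate K x).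
Proof. by move=> j jK; rewrite /truncate (negPf jK). Qed.

Lemma fourier_sum_cube (K : nat) x (eta : 'rV[R]_D) :
  fourier_sum K x eta = \sum_(j <- cube K) expi (- dotZ j eta) *: x j.
Proof. exact/fsbig_finite/finite_tbox. Qed.

Lemma fourier_sum_truncate K x (eta : 'rV[R]_D) :
  fourier_sum K (truncate K x) eta = fourier_sum K x eta.
Proof.
by rewrite !fourier_sum_cube; apply: eq_big_seq => j jK; rewrite /truncate jK.
Qed.

Lemma mem_cube (K : nat) (j : 'rV[int]_D) : (norm1 j <= K)%N -> j \in cube K.
Proof.
move=> jK; apply/mem_tbox_seq => k; rewrite !mxE.
have : (absz (j 0%R k) <= norm1 j)%N by rewrite /norm1 (bigD1 k)//= leq_addr.
by move: (j _ _) (norm1 j) jK => a b; lia.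
Qed.

Lemma truncate_tail x (e : R) : vl2 x -> 0 < e -> exists K0, forall K,
  (K0 <= K)%N -> forall i, sq_le (fun j => (-1 *: truncate K x j + x j) i 0) e.
Proof.
rewrite /vl2 /vsqnorm esum_lty; last by move=> j; exact: vsq_ge0.
move=> [M xM] e0.
have {}xM : sum_le (fun j => vsq (x j)) M.
  by apply: sum_leW xM => j; rewrite in_setT.
have [s0 us0 tail] := sum_le_tail (fun j => vsq_ge0 (x j)) xM e0.
exists (\sum_(j <- s0) norm1 j)%N => K K0 i q uq.
apply: (@le_trans _ _ (\sum_(j <- q | j \notin cube K) vsq (x j))).
  rewrite [leRHS]big_mkcond; apply: ler_sum => j _; rewrite /truncate.
  case: ifPn => jK /=; first by rewrite scaleN1r addNr mxE normc0 expr0n.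
  by rewrite scaler0 add0r normc_le_vsq.
rewrite -big_filter; apply: tail; first exact: filter_uniq.
move=> j; rewrite mem_filter => /andP[+ _]; apply: contra => js0.
by apply: mem_cube; rewrite (leq_trans _ K0)// (big_rem j)//= leq_addr.
Qed.

(** Continuity of the response in l2, on the tails of the data. *)
Lemma response_truncate x n (e : R) : vl2 x -> 0 < e -> exists K0, forall K,
  (K0 <= K)%N -> forall j, normc (response (impulse (truncate K x)) n j -
    response (impulse x) n j) <= e.
Proof.
move=> xl2 e0; have [d [C [A [d0 C0 A1 growth]]]] := response_growth iso.
pose E := C * A ^+ n * (N%:R * (N%:R : R)).
have E0 : 0 <= E.
  by rewrite mulr_ge0 ?mulr_ge0 ?exprn_ge0 ?ler0n// (le_trans ler01).
have e1 : 0 < e ^+ 2 / (1 + E) by rewrite divr_gt0 ?exprn_gt0// ltr_pwDl.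
have [K0 hK0] := truncate_tail xl2 e1; exists K0 => K K0K j.
have tl2 := vl2_cube_supported (@truncate_supported K x).
have yl2 := vl2_linear (-1) tl2 xl2.
have := growth (fun=> 1) _ _ (slow_weight1 r p (ltW d0)) (slow_weight1 r p ler01) yl2.
move=> /(_ _ _ n); rewrite !weighted1 => /(_ _ (sq_le_extend (hK0 K K0K))).
rewrite sumr_const card_ord -[(_ / _) *+ N]mulr_natl => /(sq_le_pt j).
have -> : impulse (fun j => -1 *: truncate K x j + x j) =
    fun n j' => -1 *: impulse (truncate K x) n j' + impulse x n j'.
  apply/funext => m; apply/funext => j'; rewrite /impulse.
  by case: ifP => //; rewrite scaler0 addr0.
rewrite (response_linear iso (-1))//; [|exact: vl2_impulse|exact: vl2_impulse].
rewrite mulN1r => h; rewrite normc_distC addrC.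
rewrite -(@ler_pXn2r _ 2)// ?nnegrE ?normc_ge0 ?(ltW e0)//.
apply: (le_trans h).
have -> : C * A ^+ n * (N%:R * (N%:R * (e ^+ 2 / (1 + E)))) = E * (e ^+ 2 / (1 + E)).
  by rewrite /E; ring.
rewrite mulrA ler_pdivrMr ?ltr_pwDl// mulrC ler_wpM2l ?sqr_ge0// lerDr//.
Qed.

Lemma lee_cvg0 (f : nat -> \bar R) (e : R) : 0 < e -> f @ \oo --> 0%E ->
  exists K0, forall K, (K0 <= K)%N -> (f K <= e%:E)%E.
Proof.
move=> e0 f0; have : nbhs 0%E [set y : \bar R | (y <= e%:E)%E].
  suff : nbhs (0 : R) (fun y : R => (y%:E <= e%:E)%E) by [].
  apply/nbhs_ballP; exists e => //= y; rewrite /ball /= sub0r normrN lee_fin.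
  by move=> /ltW; exact: le_trans (ler_norm _).
by move=> /f0 [L _ hL]; exists L.
Qed.

Section Multiplier.
Variables (P : nat -> 'rV[R]_D -> 'M[R[i]]_N).
Hypothesis hP : projector_expansion r p s c P.

(** The difference of the two sides of the multiplier identity is the Fourier
    series of a summable sequence, so its mean square bounds each coefficient. *)
Lemma multiplier_bessel n (T : vecs -> vecs) x K j0 i (e : R) :
  0 < e -> j0 \in cube K ->
  (((Num.max 0 (normc (T x j0 i 0 -
      tr (response (impulse (truncate K x)) n) j0 i 0) - e)) ^+ 2)%:E <=
   torus_integral (fun eta =>
     (vsq (fourier_sum K (T x) eta - P n eta *m fourier_sum K x eta))%:E))%E.
Proof.
move=> e0 j0K; have xK := @truncate_supported K x.
set b := fun j => tr (response (impulse (truncate K x)) n) j i 0.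
have [M bM] := abs_sum_trace_response iso n i xK.
have [s0 us0 tail] := sum_le_tail (fun j => normc_ge0 (b j)) bM e0.
pose q := undup (cube K ++ s0).
have uq : uniq q by exact: undup_uniq.
pose b' j := (if j \in cube K then T x j i 0 else 0) - b j.
have -> : T x j0 i 0 - tr (response (impulse (truncate K x)) n) j0 i 0 = b' j0.
  by rewrite /b' j0K.
apply: (@torus_bessel R D q b' j0 e) => //.
  by rewrite mem_undup mem_cat j0K.
move=> eta; rewrite lee_fin; set h := fourier_sum K (T x) eta - _.
apply: le_trans (normc_le_vsq h i).
rewrite ler_pXn2r ?nnegrE ?normc_ge0 ?le_max ?lexx// ge_max normc_ge0 /=.
rewrite lerBlDr -lerBlDl (le_trans (normc_dist _ _))//.
have -> : h i 0 = \sum_(j <- cube K) expi (- dotZ j eta) * T x j i 0 -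
    fourier eta b.
  rewrite /h mxE [X in _ + X]mxE -[fourier_sum K x eta]fourier_sum_truncate.
  rewrite (fourier_trace_response iso A2 n eta i hP xK) fourier_sum_cube summxE.
  by congr (_ - _); apply: eq_bigr => j _; rewrite mxE.
have -> : \sum_(j <- q) b' j * expi (- dotZ j eta) =
    \sum_(j <- cube K) expi (- dotZ j eta) * T x j i 0 -
    \sum_(j <- q) expi (- dotZ j eta) * b j.
  rewrite /b'; under eq_bigr do rewrite mulrBl; rewrite sumrB; congr (_ - _); last first.
    by apply: eq_bigr => j _; rewrite mulrC.
  have sub : {subset cube K <= q} by move=> j jK; rewrite mem_undup mem_cat jK.
  rewrite (big_uniq_sub _ (tbox_seq_uniq _ _) uq sub) /= [X in _ + X]big1 ?addr0.
    by apply: eq_big_seq => j jK; rewrite -/(cube K) in jK; rewrite jK mulrC.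
  by move=> j jK; rewrite -/(cube K) in jK; rewrite (negPf jK) mul0r.
set u1 := \sum_(j <- cube K) _; set u2 := \sum_(j <- q) _.
have -> : u1 - u2 - (u1 - fourier eta b) = fourier eta b - u2 by ring.
apply: (has_sum_tail (has_sum_fourier eta bM) uq) => t ut dis.
apply: le_trans (tail t ut _).
  by apply: ler_sum => j _; rewrite normcM normc_expi mul1r.
by move=> j /dis; apply: contra => js0; rewrite mem_undup mem_cat js0 orbT.
Qed.

End Multiplier.

(** The mean square error of the multiplier identity tends to 0 with the size of
    the cube, while the responses to truncated data tend to the response. *)
Lemma boundary_operator_response Pi n x : boundary_operators r p s c Pi ->
  vl2 x -> Pi n x = tr (response (impulse x) n).
Proof.
move=> [P [hP multPi]] xl2; have [_ /(_ x xl2) cvgPi] := multPi n.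
apply/funext => j0; apply/colP => i; apply/eqP; rewrite -subr_eq0; apply/eqP.
apply: eq0_normc; apply/eqP; rewrite eq_le normc_ge0 andbT.
apply/ler_addgt0Pl => e e0; rewrite addr0.
have e30 : 0 < e / 3 by rewrite divr_gt0.
have e90 : 0 < (e / 3) ^+ 2 by rewrite exprn_gt0.
have [K1 hK1] := lee_cvg0 e90 cvgPi.
have [K2 hK2] := response_truncate n xl2 e30.
pose K := (K1 + K2 + norm1 j0)%N.
have K1K : (K1 <= K)%N by rewrite /K -addnA leq_addr.
have K2K : (K2 <= K)%N by rewrite /K addnAC leq_addl.
have j0K : j0 \in cube K by apply: mem_cube; rewrite /K leq_addl.
have := multiplier_bessel hP n (Pi n) x i e30 j0K.
move=> /le_trans /(_ (hK1 K K1K)); rewrite lee_fin.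
rewrite ler_pXn2r ?nnegrE ?le_max ?lexx ?(ltW e30)// ge_max (ltW e30) /= => h1.
have := hK2 K K2K ((p.1)%:Z - (i : nat)%:Z, j0).
move: h1; rewrite !mxE.
set b := response (impulse (truncate K x)) n _.
set b' := response (impulse x) n _ => h1 h2.
have -> : Pi n x j0 i 0 - b' = (Pi n x j0 i 0 - b) + (b - b') by ring.
by rewrite (le_trans (normcD _ _))//; move: h1 h2; lra.
Qed.

End Identification.

(** * The half-space problem *)

Section HalfSpaceProblem.
Variables (R : realType) (D : nat) (r p : Nd D) (s : nat).
Variable c : nat -> Zd D -> R[i].
Local Notation N := (p.1 + r.1)%N.
Local Notation scheme := (@scheme R D r p s c).
Local Notation tr := (@trace_col R D r p).
Local Notation response := (@response R D r p s c).
Local Notation vecs := ('rV[int]_D -> 'cV[R[i]]_N).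
Hypothesis iso : l2_isomorphism (Qop r p (c s.+1)).
Variable Pi : nat -> vecs -> vecs.
Hypothesis PiE : forall n x, vl2 x ->
  Pi n x = tr (response (impulse (r := r) (p := p) x) n).

Lemma boundary_convolution (w : nat -> vecs) n j' : (forall n, vl2 (w n)) ->
  \sum_(m < n.+1) Pi (n - m)%N (w m) j' = tr (response w n) j'.
Proof.
move=> wl2; apply/colP => i; rewrite summxE !mxE response_conv//.
by apply: eq_bigr => m _; rewrite PiE// mxE.
Qed.

Variables (f F : nat -> Zd D -> R[i]) (g : nat -> vecs) (dt : R).
Hypothesis hf : forall n, (n <= s)%N -> l2 (half_space r) (f n).
Hypothesis hg : forall n, (s < n)%N -> vl2 (g n).
Hypothesis hg0 : forall n j', (n <= s)%N ->
  g n j' = \sum_(m < n.+1) Pi (n - m)%N (tr (f m)) j'.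
Hypothesis hcompat : forall n j', g n j' = \sum_(m < n.+1) Pi (n - m)%N (g m) j'.
Hypothesis hF : forall n, (s < n)%N -> l2 (@interior_cells D) (F n).

Let f0 n : Zd D -> R[i] := if (n <= s)%N then restrict_half r (f n) else fun=> 0.

Let f0_l2 n : l2 setT (f0 n).
Proof.
by rewrite /f0; case: ifP => [/hf|_]; [exact: l2_restrict_half|exact: l2_0].
Qed.

Let trace_f0 n : (n <= s)%N -> tr (f0 n) = tr (f n).
Proof. by move=> ns; rewrite /f0 ns trace_restrict_half. Qed.

Let g_initial n : (n <= s)%N -> g n = tr (response (fun m => tr (f0 m)) n).
Proof.
move=> ns; apply/funext => j'; rewrite hg0// -boundary_convolution; last first.
  by move=> m; exact/vl2_trace/l2_half/f0_l2.
apply: eq_bigr => m _; rewrite trace_f0//.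
by rewrite (leq_trans _ ns)// -ltnS.
Qed.

Let g_l2 n : vl2 (g n).
Proof.
have [ns|/hg //] := leqP n s; rewrite g_initial//.
by apply: vl2_trace_response => // m; exact/vl2_trace/l2_half/f0_l2.
Qed.

(** The initial data are incorporated in the source term: they solve the scheme
    up to time s with this right-hand side. *)
Let source n : Zd D -> R[i] := fun j =>
  if 1 <= j.1 then if (n <= s)%N then scheme f0 n j else dt%:C%C * F n j else 0.

Let source_l2 n : l2 setT (source n).
Proof.
have [ns|sn] := leqP n s.
  have /l2TP[M sM] : l2 setT (scheme f0 n) by exact: l2_scheme.
  apply/l2TP; exists M; apply: sq_leW sM => j; rewrite /source ns.
  by case: ifP => // _; rewrite normc0 normc_ge0.
have /l2P[M FM] := hF sn; apply/l2TP; eexists; apply: sq_leW (sq_leZ dt%:C%C FM) => j.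
rewrite /source leqNgt sn /=; case: ifP => j1; last by rewrite normc0 normc_ge0.
by rewrite ifT//; exact/mem_set.
Qed.

(** A whole-space solution V with the given source misses the boundary data by
    h; since h is reproduced by the Calderon projector, adding the response to
    h corrects the trace without changing the equation. *)
Lemma half_space_solvable : exists u : nat -> Zd D -> R[i],
  ibvp_solution r p s c dt Pi F g f u.
Proof.
have [Vl2 Veq] := resolveP iso source_l2; set V := resolve _ _ _ _ _ in Vl2 Veq.
have trV_l2 n : vl2 (tr (V n)) by exact/vl2_trace/l2_half.
pose h n j' := -1 *: tr (response (fun m => tr (V m)) n) j' + g n j'.
have h_l2 n : vl2 (h n).
  by apply: vl2_linear => //; exact: vl2_trace_response.
pose u n j := V n j + response h n j.
have ul2 n : l2 setT (u n).
  have := l2_linear 1 (Vl2 n) (l2_response iso h_l2 n); congr l2.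
  by apply/funext => j; rewrite mul1r.
have tru_l2 n : vl2 (tr (u n)) by exact/vl2_trace/l2_half.
have trace_linear a (v1 v2 v : Zd D -> R[i]) : (forall j, v j = a * v1 j + v2 j) ->
    tr v = fun j' => a *: tr v1 j' + tr v2 j'.
  by move=> vE; apply/funext => j'; apply/colP => i; rewrite !mxE vE.
have tr_resp_g n : tr (response g n) = g n.
  by apply/funext => j'; rewrite [RHS]hcompat boundary_convolution.
have tr_resp_h n : tr (response h n) = h n.
  rewrite (trace_linear (-1) (response (fun m => tr (response (fun m => tr (V m)) m)) n)
    (response g n)).
    by rewrite trace_response_idem// tr_resp_g.
  by move=> j; rewrite -response_linear// => k; exact: vl2_trace_response.
have u_boundary n : tr (response (fun m => tr (u m)) n) = g n.
  have -> : (fun m => tr (u m)) = fun m j' => 1 *: tr (V m) j' + h m j'.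
    apply/funext => m; rewrite -[h m]tr_resp_h; apply: trace_linear => j.
    by rewrite mul1r.
  rewrite (trace_linear 1 (response (fun m => tr (V m)) n) (response h n)).
    rewrite tr_resp_h; apply/funext => j'.
    by rewrite /h addrA scaleN1r scale1r subrr add0r.
  by move=> j; rewrite -response_linear.
have u_scheme n j : 1 <= j.1 -> scheme u n j = source n j.
  move=> j1; rewrite schemeD Veq scheme_response// /calderon_source ifF ?addr0//.
  by move: j1; case: (j) => ? ? /=; lia.
exists u; split=> [n|n j jint|n j'|n j ns jhalf].
- exact: l2_half.
- have j1 : 1 <= j.1 := set_mem jint.
  rewrite scheme_shift u_scheme// /source j1 ifF//.
  by apply/negbTE; rewrite -ltnNge addnS ltnS leq_addl.
- by rewrite (boundary_convolution (w := fun m => tr (u m)))// u_boundary.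
- have j1 : (1 - (r.1)%:Z <= j.1) := set_mem jhalf.
  pose e m i := restrict_half r (u m) i - f0 m i.
  have el2 m : l2 setT (e m).
    have := l2_linear (-1) (f0_l2 m) (l2_restrict_half (l2_half r (ul2 m))).
    by congr l2; apply/funext => i; rewrite mulN1r addrC.
  (* up to time s, u and the initial data solve the same boundary problem *)
  suff : e n j = 0.
    rewrite /e /f0 ns !restrict_halfE j1 => /eqP; rewrite subr_eq0 => /eqP //.
  have tre m : (m <= s)%N -> tr (e m) = fun j' => -1 *: tr (f0 m) j' + tr (u m) j'.
    move=> ms; rewrite -[tr (u m)]trace_restrict_half; apply: trace_linear => i.
    by rewrite mulN1r addrC.
  apply: (half_space_unique iso el2) => [m i mn i1|m i mn i1|m j' mn].
  + have ms := leq_trans mn ns.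
    by rewrite /e /f0 ms !restrict_halfE leNgt i1 subrr.
  + have ms := leq_trans mn ns.
    rewrite schemeB scheme_restrict_half// u_scheme// /source i1 ms subrr//.
  + have ms := leq_trans mn ns.
    have trf0_l2 k : vl2 (tr (f0 k)) by exact/vl2_trace/l2_half/f0_l2.
    have -> : (fun k => tr (e k)) = fun k j' => -1 *: tr (f0 k) j' + tr (u k) j'.
      apply/funext => k; rewrite -[tr (u k)]trace_restrict_half; apply: trace_linear => i.
      by rewrite mulN1r addrC.
    rewrite (trace_linear (-1) (response (fun k => tr (f0 k)) m)
      (response (fun k => tr (u k)) m)).
      by rewrite u_boundary g_initial// scaleN1r addNr.
    by move=> i; rewrite -response_linear.
Qed.

(** The difference of two solutions vanishes up to time s, so it solves the scheme
    from time 0 with zero source and zero boundary data. *)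
Lemma half_space_solution_unique u v :
  ibvp_solution r p s c dt Pi F g f u -> ibvp_solution r p s c dt Pi F g f v ->
  forall n j, j \in half_space r -> v n j = u n j.
Proof.
move=> [ul2 useq ubd uin] [vl2' vseq vbd vin] n j jhalf.
have j1 : (1 - (r.1)%:Z <= j.1) := set_mem jhalf.
pose e m i := restrict_half r (v m) i - restrict_half r (u m) i.
have eE m : e m = fun i => -1 * restrict_half r (u m) i + restrict_half r (v m) i.
  by apply/funext => i; rewrite mulN1r addrC.
have el2 m : l2 setT (e m).
  by rewrite eE; apply: l2_linear; exact: l2_restrict_half.
have e0 m i : (m <= s)%N -> e m i = 0.
  move=> ms; rewrite /e !restrict_halfE; case: ifP => i1; last by rewrite subrr.
  by rewrite vin ?uin ?subrr//; exact/mem_set.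
suff : e n j = 0.
  by rewrite /e !restrict_halfE j1 => /eqP; rewrite subr_eq0 => /eqP.
have tre m : tr (e m) = fun j' => -1 *: tr (u m) j' + tr (v m) j'.
  rewrite eE; apply/funext => j'; rewrite -[tr (u m)]trace_restrict_half.
  by rewrite -[tr (v m)]trace_restrict_half; apply/colP => i; rewrite !mxE.
have tru k : vl2 (tr (u k)) by exact: vl2_trace.
have trv k : vl2 (tr (v k)) by exact: vl2_trace.
apply: (half_space_unique iso el2) => [m i _ i1|m i _ i1|m j' _].
- by rewrite /e !restrict_halfE leNgt i1 subrr.
- have [ms|sm] := leqP m s.
    rewrite -[RHS](_ : scheme (fun _ _ => 0) m i = 0).
      by apply: eq_scheme => k km; apply/funext => l; rewrite e0// (leq_trans km).
    rewrite /scheme big1// => k _; rewrite (@eq_Qop R D r p _ _ (fun=> 0)) ?Qop0//.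
    by move=> l _; rewrite /delay if_same.
  have int_i : i \in @interior_cells D by exact/mem_set.
  have := useq (m - s.+1)%N i int_i; have := vseq (m - s.+1)%N i int_i.
  rewrite !scheme_shift subnK// => vm um.
  by rewrite schemeB !scheme_restrict_half// vm um subrr.
- have -> : (fun k => tr (e k)) = fun k j' => -1 *: tr (u k) j' + tr (v k) j'.
    by apply/funext => k; exact: tre.
  apply/colP => i; rewrite mxE response_linear// mulN1r.
  have traceE w : response w m ((p.1)%:Z - (i : nat)%:Z, j') =
      tr (response w m) j' i 0 by rewrite mxE.
  rewrite !traceE addrC -!boundary_convolution//.
  suff -> : \sum_(k < m.+1) Pi (m - k)%N (tr (v k)) j' =
      \sum_(k < m.+1) Pi (m - k)%N (tr (u k)) j' by rewrite subrr mxE.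
  have [ms|sm] := leqP m s; last first.
    have := ubd (m - s.+1)%N j'; have := vbd (m - s.+1)%N j'.
    by rewrite subnK// => -> ->.
  apply: eq_bigr => k _; congr (Pi _ _ _); apply/funext => l; apply/colP => q.
  have ks : (k <= s)%N by rewrite (leq_trans _ ms)// -ltnS.
  rewrite !mxE; have q1 : ((p.1)%:Z - (q : nat)%:Z, l) \in half_space r.
    by apply/mem_set; rewrite /half_space /=; have := ltn_ord q; lia.
  by rewrite vin// uin.
Qed.

End HalfSpaceProblem.

Theorem proposition1 (R : realType) (D s : nat) (r p : Nd D)
  (Delta : set (R * 'rV[R]_D.+1))
  (hDelta : forall del, Delta del -> 0 < del.1 /\ forall k, 0 < del.2 0 k)
  (a : R * 'rV[R]_D.+1 -> nat -> Zd D -> R[i])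
  (hA0 : forall del, Delta del -> assumption_A0 r p s (a del))
  (hA1 : forall del, Delta del -> assumption_A1 r p s (a del) del.2)
  (hA2 : forall del, Delta del -> assumption_A2 r p s (a del))
  (hA3 : forall del, Delta del -> assumption_A3 r p s (a del))
  (dt : R) (dx : 'rV[R]_D.+1) (hdel : Delta (dt, dx))
  (Pi : nat -> ('rV[int]_D -> 'cV[R[i]]_(p.1 + r.1)) ->
               ('rV[int]_D -> 'cV[R[i]]_(p.1 + r.1)))
  (hPi : boundary_operators r p s (a (dt, dx)) Pi)
  (f : nat -> Zd D -> R[i])
  (hf : forall n, (n <= s)%N -> l2 (half_space r) (f n))
  (g : nat -> 'rV[int]_D -> 'cV[R[i]]_(p.1 + r.1))
  (hg : forall n, (s < n)%N -> vl2 (g n))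
  (hg0 : forall n j', (n <= s)%N ->
     g n j' = \sum_(m < n.+1) Pi (n - m)%N (trace_col r p (f m)) j')
  (hcompat : forall n j', g n j' = \sum_(m < n.+1) Pi (n - m)%N (g m) j')
  (F : nat -> Zd D -> R[i])
  (hF : forall n, (s < n)%N -> l2 (@interior_cells D) (F n)) :
  exists u : nat -> Zd D -> R[i],
    ibvp_solution r p s (a (dt, dx)) dt Pi F g f u /\
    forall v : nat -> Zd D -> R[i],
      ibvp_solution r p s (a (dt, dx)) dt Pi F g f v ->
      forall n j, j \in half_space r -> v n j = u n j.
Proof.
have [iso _ _] := hA0 _ hdel.
have PiE n x : vl2 x -> Pi n x = trace_col r p (response s (a (dt, dx)) (impulse x) n).
  exact: (boundary_operator_response iso (hA2 _ hdel) n hPi).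
have [u uP] := half_space_solvable iso PiE dt hf hg hg0 hcompat hF.
by exists u; split=> // v; exact: (half_space_solution_unique iso PiE).
Qed.
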